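(* Let $p$ be a prime and $F$ a power of $p$, divisible by $p$, with $F\ne2$. Let $a$ be an integer not divisible by $p$. Then $\omega(a)^{-1}H_p(2,a,F)$ is irrational, i.e. lies in $\mathbb{Q}_p\setminus\mathbb{Q}$. For $F=2$ one has $H_2(2,1,2)=0$.
   Context: Bernoulli numbers: $\frac{t}{e^t-1}=\sum_{n\ge0}B_n\frac{t^n}{n!}$. Teichmüller character $\omega:\mathbb{Z}\to\mathbb{Z}_p$: $\omega(m)=0$ if $p\mid m$; if $p$ is odd and $p\nmid m$, $\omega(m)$ is the unique element of $\mathbb{Z}_p$ with $\omega(m)^{p-1}=1$ and $\omega(m)\equiv m \pmod p$; if $p=2$ and $m$ is odd, $\omega(m)=(-1)^{(m-1)/2}$. For $p\nmid m$ put $\langle m\rangle=\omega(m)^{-1}m$. $p$-adic Hurwitz zeta function: for a positive integer $F$ divisible by $p$, an integer $a$ not divisible by $p$, and $s\in\mathbb{Z}_p$, $s\neq1$, $$H_p(s,a,F)=\frac{1}{F(s-1)}\langle a\rangle^{1-s}\sum_{j=0}^\infty\binom{1-s}{j}B_j\left(\frac Fa\right)^j .$$ *)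

(* Defs.v *)
From HB Require Import structures.
From mathcomp Require Import all_boot all_order all_algebra.
From mathcomp Require Import all_classical all_reals all_analysis.

Set Implicit Arguments.
Unset Strict Implicit.
Unset Printing Implicit Defensive.

Import Order.TTheory GRing.Theory Num.Theory.

Local Open Scope classical_set_scope.
Local Open Scope ring_scope.

(* Z_p is the inverse limit of the rings Z/p^n: the n-th term of a p-adic     *)
(* integer is its residue modulo p^n, as a natural number below p^n.          *)
Record padic_int (p : nat) (p_pr : prime p) := PadicInt {
  residue :> nat -> nat;
  residueP : forall n, residue n = (residue n.+1 %% p ^ n)%N }.

Section PadicInt.
Variables (p : nat) (p_pr : prime p).
Local Notation Zp := (padic_int p_pr).
Implicit Types x y z : Zp.

HB.instance Definition _ := gen_eqMixin Zp.
HB.instance Definition _ := gen_choiceMixin Zp.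

Lemma residue_inj x y : (forall n, x n = y n) -> x = y.
Proof.
case: x y => [x xP] [y yP] /= /funext e; rewrite -{}e in yP *.
by congr PadicInt; apply: Prop_irrelevance.
Qed.

Lemma residue_mod x n : (x n %% p ^ n)%N = x n.
Proof. by rewrite (residueP x) modn_mod. Qed.

Lemma residue_le x m n : (m <= n)%N -> (x n %% p ^ m)%N = x m.
Proof.
elim: n => [|n IHn]; first by rewrite leqn0 => /eqP ->; exact: residue_mod.
rewrite leq_eqVlt => /orP[/eqP ->|]; first exact: residue_mod.
rewrite ltnS => mn; rewrite -[RHS](IHn mn) [in RHS](residueP x).
by rewrite modn_dvdm // dvdn_exp2l.
Qed.

Lemma reduce_subproof (f : nat -> nat) :
  (forall n, f n = f n.+1 %[mod p ^ n]) ->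
  forall n, (f n %% p ^ n = (f n.+1 %% p ^ n.+1) %% p ^ n)%N.
Proof. by move=> fP n; rewrite fP modn_dvdm // dvdn_exp2l. Qed.

Definition reduce f (fP : forall n, f n = f n.+1 %[mod p ^ n]) : Zp :=
  PadicInt p_pr (reduce_subproof fP).

Lemma const_subproof (c : nat) n : c = c %[mod p ^ n].
Proof. by []. Qed.

Lemma add_subproof x y n : (x n + y n = x n.+1 + y n.+1 %[mod p ^ n])%N.
Proof. by rewrite (residueP x n) (residueP y n) modnDm. Qed.

Lemma mul_subproof x y n : (x n * y n = x n.+1 * y n.+1 %[mod p ^ n])%N.
Proof. by rewrite (residueP x n) (residueP y n) modnMm. Qed.

Lemma residue_lt x n : (x n < p ^ n)%N.
Proof. by rewrite -residue_mod ltn_pmod // expn_gt0 prime_gt0. Qed.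

Lemma opp_subproof x n : (p ^ n - x n = p ^ n.+1 - x n.+1 %[mod p ^ n])%N.
Proof.
apply/eqP; rewrite -(eqn_modDr (x n)) subnK ?(ltnW (residue_lt _ _)) //.
rewrite {1}(residueP x n) modnDmr subnK ?(ltnW (residue_lt _ _)) //.
by rewrite expnS modnMl modnn.
Qed.

Definition padic_int_zero : Zp := reduce (const_subproof 0).
Definition padic_int_one : Zp := reduce (const_subproof 1).
Definition padic_int_add x y : Zp := reduce (add_subproof x y).
Definition padic_int_mul x y : Zp := reduce (mul_subproof x y).
Definition padic_int_opp x : Zp := reduce (opp_subproof x).

Fact padic_int_addA : associative padic_int_add.
Proof. by move=> x y z; apply: residue_inj => n /=; rewrite modnDml modnDmr addnA. Qed.

Fact padic_int_addC : commutative padic_int_add.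
Proof. by move=> x y; apply: residue_inj => n /=; rewrite addnC. Qed.

Fact padic_int_add0 : left_id padic_int_zero padic_int_add.
Proof. by move=> x; apply: residue_inj => n /=; rewrite modnDml residue_mod. Qed.

Fact padic_int_addN : left_inverse padic_int_zero padic_int_opp padic_int_add.
Proof.
move=> x; apply: residue_inj => n /=.
by rewrite modnDml subnK ?modnn ?mod0n // ltnW // residue_lt.
Qed.

HB.instance Definition _ := GRing.isZmodule.Build Zp
  padic_int_addA padic_int_addC padic_int_add0 padic_int_addN.

Fact padic_int_mulA : associative padic_int_mul.
Proof. by move=> x y z; apply: residue_inj => n /=; rewrite modnMml modnMmr mulnA. Qed.

Fact padic_int_mulC : commutative padic_int_mul.
Proof. by move=> x y; apply: residue_inj => n /=; rewrite mulnC. Qed.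

Fact padic_int_mul1 : left_id padic_int_one padic_int_mul.
Proof.
by move=> x; apply: residue_inj => n /=; rewrite modnMml mul1n residue_mod.
Qed.

Fact padic_int_mulD : left_distributive padic_int_mul padic_int_add.
Proof.
by move=> x y z; apply: residue_inj => n /=; rewrite modnMml modnDm mulnDl.
Qed.

Fact padic_int_one_neq0 : padic_int_one != 0.
Proof.
apply/eqP => /(congr1 (fun x : Zp => x 1%N)) /=.
by rewrite expn1 mod0n modn_small ?prime_gt1.
Qed.

HB.instance Definition _ := GRing.Zmodule_isComNzRing.Build Zp
  padic_int_mulA padic_int_mulC padic_int_mul1 padic_int_mulD
  padic_int_one_neq0.

Definition padic_int_unit : {pred Zp} := [pred x | `[< exists y, y * x = 1 >]].
Definition padic_int_inv x : Zp := xget x [set y | y * x = 1].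

Fact padic_int_mulV : {in padic_int_unit, left_inverse 1 padic_int_inv *%R}.
Proof.
move=> x /asboolP[y yx]; rewrite /padic_int_inv.
exact: (@xgetPex _ x [set y | y * x = 1] (ex_intro _ y yx)).
Qed.

Fact padic_int_unitP x y : y * x = 1 -> x \in padic_int_unit.
Proof. by move=> yx; apply/asboolP; exists y. Qed.

Fact padic_int_inv_out : {in [predC padic_int_unit], padic_int_inv =1 id}.
Proof.
move=> x /asboolPn xU; rewrite /padic_int_inv.
by case: xgetP => // y _ yx; case: xU; exists y.
Qed.

HB.instance Definition _ := GRing.ComNzRing_hasMulInverse.Build Zp
  padic_int_mulV padic_int_unitP padic_int_inv_out.

Lemma padic_int_neq0 x : x != 0 -> exists n, ~~ (p ^ n %| x n)%N.
Proof.
apply: contra_neqP => nx; apply: residue_inj => n /=; rewrite mod0n.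
rewrite -residue_mod; apply/eqP; apply: contra_notT nx => xn.
by exists n.
Qed.

Fact padic_int_idomain : GRing.integral_domain_axiom Zp.
Proof.
move=> x y xy0; apply: contraT; rewrite negb_or => /andP[].
move=> /padic_int_neq0[m xm] /padic_int_neq0[n yn].
have dvd_res (z : Zp) k l : (k <= l)%N -> (p ^ k %| z l)%N = (p ^ k %| z k)%N.
  by move=> kl; rewrite /dvdn -(residue_le z kl) modn_mod.
rewrite -(dvd_res x m (m + n)%N) ?leq_addr // in xm.
rewrite -(dvd_res y n (m + n)%N) ?leq_addl // in yn.
have x0 : (0 < x (m + n))%N by case: (x _) xm; rewrite ?dvdn0.
have y0 : (0 < y (m + n))%N by case: (y _) yn; rewrite ?dvdn0.
move: xm yn; rewrite !pfactor_dvdn // -!ltnNge => xm yn.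
have : (p ^ (m + n) %| x (m + n)%N * y (m + n)%N)%N.
  have /= := congr1 (fun z : Zp => z (m + n)%N) xy0.
  by rewrite mod0n => /eqP.
rewrite pfactor_dvdn ?muln_gt0 ?x0 // lognM // leqNgt.
by rewrite -addSn leq_add // ltnW.
Qed.

HB.instance Definition _ :=
  GRing.ComUnitRing_isIntegral.Build Zp padic_int_idomain.

HB.instance Definition _ := isPointed.Build Zp 0.

End PadicInt.

Definition padic (p : nat) (p_pr : prime p) := {fraction padic_int p_pr}.

Section Padic.
Variables (p : nat) (p_pr : prime p).
Local Notation Zp := (padic_int p_pr).
Local Notation Qp := (padic p_pr).

HB.instance Definition _ := GRing.Field.on Qp.
HB.instance Definition _ := isPointed.Build Qp 0.

Definition padic_of_int (x : Zp) : Qp := tofrac x.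

(* The coset x + p^n Z_p *)
Definition padic_coset (x : Qp) (n : nat) : set Qp :=
  [set y | exists z : Zp, y = x + padic_of_int (p%:R ^+ n * z)].

(* The topology of Q_p has the cosets of the p^n Z_p as a basis.              *)
Definition padic_nbhs (x : Qp) : set_system Qp :=
  [set A | exists n, padic_coset x n `<=` A].

HB.instance Definition _ := hasNbhs.Build Qp padic_nbhs.

Lemma padic_coset_refl x n : padic_coset x n x.
Proof. by exists 0; rewrite mulr0 /padic_of_int rmorph0 addr0. Qed.

Lemma padic_coset_le x m n :
  (m <= n)%N -> padic_coset x n `<=` padic_coset x m.
Proof.
move=> mn y [z ->]; exists (p%:R ^+ (n - m) * z).
by rewrite mulrA -exprD subnKC.
Qed.

Lemma padic_coset_trans x y n :
  padic_coset x n y -> padic_coset y n `<=` padic_coset x n.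
Proof.
move=> [z ->] _ [t ->]; exists (z + t).
by rewrite mulrDr /padic_of_int rmorphD addrA.
Qed.

Fact padic_nbhs_filter (x : Qp) : ProperFilter (nbhs x).
Proof.
split; first by move=> [n] /(_ x (padic_coset_refl x n)).
split.
- by exists 0%N.
- move=> A B [m Am] [n Bn]; exists (maxn m n) => y yx; split.
    by apply: Am; apply: padic_coset_le yx; exact: leq_maxl.
  by apply: Bn; apply: padic_coset_le yx; exact: leq_maxr.
- by move=> A B AB [n An]; exists n => y /An /AB.
Qed.

Fact padic_nbhs_singleton (x : Qp) (A : set Qp) : nbhs x A -> A x.
Proof. by move=> [n An]; apply/An/padic_coset_refl. Qed.

Fact padic_nbhs_nbhs (x : Qp) (A : set Qp) : nbhs x A -> nbhs x (nbhs^~ A).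
Proof.
move=> [n An]; exists n => y yx; exists n => z zy.
exact/An/(padic_coset_trans yx).
Qed.

HB.instance Definition _ := Nbhs_isNbhsTopological.Build Qp
  padic_nbhs_filter padic_nbhs_singleton padic_nbhs_nbhs.

Lemma residue_natr (m n : nat) : (m%:R : Zp) n = (m %% p ^ n)%N.
Proof.
elim: m => [//|m IHm]; rewrite -addn1 natrD /= IHm.
by rewrite modnDm.
Qed.

Lemma padic_hausdorff : hausdorff_space Qp.
Proof.
move=> x y xy; have d n : exists z : Zp, y - x = padic_of_int (p%:R ^+ n * z).
  have [|| _ [[z ->] [t e]]] :=
    xy (padic_coset x n) (padic_coset y n); [by exists n|by exists n|].
  exists (z - t); rewrite -[y](addrK (padic_of_int (p%:R ^+ n * t))) -e.
  by rewrite mulrBr /padic_of_int rmorphB addrAC [x + _]addrC addrK.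
have [z0 ez0] := d 0%N; suff z0_eq0 : z0 = 0.
  apply/esym/subr0_eq; rewrite ez0 z0_eq0 mulr0; exact: rmorph0.
apply: residue_inj => n; have [z] := d n.
rewrite ez0 mul1r => /eqP; rewrite /padic_of_int tofrac_eq => /eqP ->.
by rewrite -natrX /= residue_natr modnn mul0n !mod0n.
Qed.

End Padic.

(* The identity t = (\sum_n B_n t^n / n!) * (e^t - 1) of formal power series, *)
(* coefficient by coefficient: the n-th coefficient of e^t - 1 is 1 / n! for  *)
(* n != 0, and 0 for n = 0.                                                   *)
Definition bernoulli_gf (B : nat -> rat) : Prop :=
  forall n, \sum_(k < n.+1)
    (B k / k`!%:R) * ((n - k != 0)%N%:R / (n - k)`!%:R) = (n == 1%N)%:R.

Lemma bernoulli_gf_rec (B : nat -> rat) : bernoulli_gf B <->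
  forall n, B n = n`!%:R *
    ((n == 0%N)%:R - \sum_(k < n) B k / k`!%:R / (n.+1 - k)`!%:R).
Proof.
have sumE n : \sum_(k < n.+2)
    (B k / k`!%:R) * ((n.+1 - k != 0)%N%:R / (n.+1 - k)`!%:R) =
    \sum_(k < n) B k / k`!%:R / (n.+1 - k)`!%:R + B n / n`!%:R.
  rewrite !big_ord_recr /= subnn mul0r mulr0 addr0 subSnn mul1r divr1.
  congr (_ + _); apply: eq_bigr => k _.
  by rewrite subn_eq0 -ltnNge ltnW ?ltnS // mul1r.
have fact_neq0 n : n`!%:R != 0 :> rat by rewrite pnatr_eq0 -lt0n fact_gt0.
split=> [BP n|BP [|n]].
- have := BP n.+1; rewrite sumE eqSS => <-.
  by rewrite addrAC subrr add0r mulrC divfK.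
- by rewrite big_ord1 mul0r mulr0.
- by rewrite sumE [B n]BP mulrAC divff // mul1r addrC subrK eqSS.
Qed.

Fixpoint bernoulli_prefix (n : nat) : seq rat :=
  if n is m.+1 then
    let s := bernoulli_prefix m in
    rcons s (m`!%:R *
      ((m == 0%N)%:R - \sum_(k < m) s`_k / k`!%:R / (m.+1 - k)`!%:R))
  else [::].

Lemma bernoulli_gf_exists : exists B, bernoulli_gf B.
Proof.
exists (fun n => (bernoulli_prefix n.+1)`_n).
have sizeE n : size (bernoulli_prefix n) = n.
  by elim: n => //= n IHn; rewrite size_rcons IHn.
have prefixE m n : (m < n)%N ->
    (bernoulli_prefix n)`_m = (bernoulli_prefix m.+1)`_m.
  elim: n => // n IHn; rewrite ltnS leq_eqVlt => /orP[/eqP -> //|mn].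
  by rewrite -IHn //= nth_rcons sizeE mn.
apply/bernoulli_gf_rec => n.
rewrite [LHS]/= nth_rcons sizeE ltnn eqxx; congr (_ * (_ - _)).
by apply: eq_bigr => k _; rewrite prefixE.
Qed.

Lemma bernoulli_gf_uniq B B' : bernoulli_gf B -> bernoulli_gf B' -> B = B'.
Proof.
move=> /bernoulli_gf_rec BP /bernoulli_gf_rec B'P; apply/funext => n.
elim/ltn_ind: n => n IHn; rewrite BP B'P; congr (_ * (_ - _)).
by apply: eq_bigr => k _; rewrite IHn.
Qed.

Definition bernoulli : nat -> rat := xget (fun=> 0) [set B | bernoulli_gf B].

Lemma bernoulliP : bernoulli_gf bernoulli.
Proof. by have [B BP] := bernoulli_gf_exists; exact: (@xgetPex _ _ [set B | bernoulli_gf B] (ex_intro _ B BP)). Qed.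

Section HurwitzZeta.
Variables (p : nat) (p_pr : prime p).
Local Notation Zp := (padic_int p_pr).
Local Notation Qp := (padic p_pr).

Definition teichmuller (m : int) : Zp :=
  if (p %| m)%Z then 0
  else if p == 2%N then (-1) ^ ((m - 1) %/ 2)%Z
  else get [set w : Zp | w ^+ p.-1 = 1 /\ exists z : Zp, w - m%:~R = p%:R * z].

Definition angle (m : int) : Qp := (padic_of_int (teichmuller m))^-1 * m%:~R.

Definition padic_binom (x : Qp) (j : nat) : Qp :=
  (\prod_(i < j) (x - i%:R)) / j`!%:R.

(* u^x for u in 1 + p Z_p and x in Z_p, by the binomial series. *)
Definition padic_pow (u : Qp) (x : Zp) : Qp :=
  limn (series (fun j => padic_binom (padic_of_int x) j * (u - 1) ^+ j)).

Definition hurwitz_zeta (s : Zp) (a : int) (F : nat) : Qp :=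
  (F%:R * padic_of_int (s - 1))^-1 * padic_pow (angle a) (1 - s) *
  limn (series (fun j => padic_binom (padic_of_int (1 - s)) j *
                         ratr (bernoulli j) * (F%:R / a%:~R) ^+ j)).

Definition irrational_padic (x : Qp) : Prop := ~ exists q : rat, x = ratr q.

End HurwitzZeta.

(* Main.v *)
Require Import Defs.
From HB Require Import structures.
From mathcomp Require Import all_boot all_order all_algebra.
From mathcomp Require Import all_classical all_reals all_analysis.
From mathcomp Require Import cyclic.
From mathcomp Require Import zify ring lra.
From Stdlib Require BinNat Nnat.

(** Put [y = - a / F].  Since [<a>^(-1)], computed by the binomial series, is the
    inverse of [<a>], the number [omega(a)^(-1) H_p(2,a,F)] is [S / (F a)] with
    [S = \sum_j B_j y^(-j)].  Let L be the linear functional on polynomials that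
    sends [X^j] to [B_j], the Volkenborn integral.  Then [S / y] is the value of L
    at [1 / (y - X)], expanded in powers of [X / y], which is p-adically small.
    Only rational numbers enter the study of this value: p-adic size is measured
    by the local ring Z_(p), and Q_p itself is used to define the zeta value only.

    The recurrence of the Bernoulli numbers says that L sends [f(x+1) - f(x)] to
    [f'(0)].  So L is invariant under [x |-> -1-x], which exchanges [1 / (y - X)]
    and [- 1 / (-1-y - X)]; at the fixed point [y = -1/2] the value is zero, and
    this is the case F = 2.

    For the irrationality, Touchard's polynomials
    [f_n = \sum_k C(n,k) C(n+k,k) C(X,k)] are orthogonal for L, and they yield
    Padé approximants: the remainder [f_n(y) L(1/(y-X)) - p_n], multiplied by
    [h_n(y)], is [L(f_n h_n / (y - X))] for every polynomial [h_n] of degree at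
    most n ([pade_rem_cvg]).  Take [h_n = C(X+n,n)].  As [f_n h_n] takes integral
    values at the natural numbers, the last value has a p-adic denominator of at
    most linear size ([zloc_volkenborn_int_valued]), while [h_n(y)] has the
    denominator [M_n = p^(rn + v_p(n!))], where [F = p^r].  The numbers [f_n(y)]
    and [p_n] have the common denominator [lcm(1..n)^2 M_n], and the recurrence of
    the [f_n] shows that they are of subexponential real size.  If the limit were
    rational, a nonzero integer of size at most [lcm(1..n)^2 M_n e^(o(n))] would
    be divisible by [M_n^2], up to a polynomial factor.  But
    [lcm(1..n) <= e^(n(1+o(1)))] for infinitely many n ([lcm_upto_sq_not_geq]),
    and [M_n] grows faster than [7.45^n] if F is at least 4, while [e^2 < 7.39].
    Nonvanishing is free for one of any two consecutive n, by the Casoratian of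
    the recurrence.

    For F = 3 the growth rate of [M_n] is only [3^(3/2)].  Shifts and reflections
    reduce this case to [y = -1/3].  There L at [1 / (y - X)] is, up to a rational
    factor, the value at [1 / (eta - Z)], with [eta = y(y+1) = -2/9], of another
    functional theta, on polynomials in [Z = X(X+1)] ([theta_geom_cvg]).  The
    orthogonal polynomials of theta are dual Hahn polynomials, and the same Padé
    argument, with [h_n = Z^n], gains the factor [9^n], and [9 > e^2]. *)

Set Implicit Arguments.
Unset Strict Implicit.
Unset Printing Implicit Defensive.

Import Order.TTheory GRing.Theory Num.Theory.

Local Open Scope ring_scope.

(** * Least common multiples and Chebyshev's bound *)

Definition lcm_upto (n : nat) : nat := \big[lcmn/1%N]_(i < n) i.+1.

Lemma lcm_uptoS n : lcm_upto n.+1 = lcmn (lcm_upto n) n.+1.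
Proof. by rewrite /lcm_upto big_ord_recr. Qed.

Lemma lcm_upto_gt0 n : (0 < lcm_upto n)%N.
Proof.
elim: n => [|n IHn]; first by rewrite /lcm_upto big_ord0.
by rewrite lcm_uptoS lcmn_gt0 IHn.
Qed.

Lemma dvdn_lcm_upto i n : (0 < i <= n)%N -> (i %| lcm_upto n)%N.
Proof.
elim: n => [|n IHn]; first by case: i.
case/andP=> i0; rewrite lcm_uptoS leq_eqVlt => /orP[/eqP ->|]; first exact: dvdn_lcmr.
rewrite ltnS => ni; apply: dvdn_trans (dvdn_lcml _ _).
by apply: IHn; rewrite i0.
Qed.

Lemma leq_lcm_upto m n : (m <= n)%N -> (lcm_upto m <= lcm_upto n)%N.
Proof.
elim: n => [|n IHn]; first by rewrite leqn0 => /eqP ->.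
rewrite leq_eqVlt ltnS => /orP[/eqP -> //|/IHn mn].
apply: leq_trans mn _; rewrite lcm_uptoS dvdn_leq ?dvdn_lcml //.
by rewrite lcmn_gt0 lcm_upto_gt0.
Qed.

Lemma logn_lcm_upto l n : prime l ->
  (0 < n)%N -> (l ^ logn l (lcm_upto n) <= n)%N.
Proof.
move=> l_pr; elim: n => // -[|n] IHn _; first by rewrite /lcm_upto big_ord1 logn1.
rewrite lcm_uptoS logn_lcm ?lcm_upto_gt0 //.
case: (leqP (logn l (lcm_upto n.+1)) (logn l n.+2)) => [le1|lt1].
  by rewrite dvdn_leq // pfactor_dvdnn.
by rewrite (leq_trans (IHn _)).
Qed.

Lemma sum_lt_indicator n c : (c <= n)%N -> (\sum_(k < n) (k < c))%N = c.
Proof.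
elim: n c => [|n IHn] c; first by rewrite leqn0 big_ord0 => /eqP ->.
rewrite leq_eqVlt big_ord_recr /= => /orP[/eqP ->|]; last first.
  by rewrite ltnS => cn; rewrite IHn // ltnNge cn addn0.
rewrite ltnSn (eq_bigr (fun _ : 'I_n => 1%N)); last by move=> k _; rewrite ltnS ltnW.
by rewrite sum1_card card_ord addn1.
Qed.

Lemma divn_sum_indicator n d : (0 < d)%N ->
  (n %/ d)%N = (\sum_(k < n) (k.+1 * d <= n))%N.
Proof.
move=> d0; rewrite -{1}(@sum_lt_indicator n (n %/ d)) ?leq_div //.
by apply: eq_bigr => k _; rewrite leq_divRL.
Qed.

Lemma logn_leq_dvdn m n : (0 < m)%N -> (0 < n)%N ->
  (forall l, prime l -> logn l m <= logn l n)%N -> (m %| n)%N.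
Proof.
move=> m0 n0 mn; apply/dvdn_partP => // l.
rewrite mem_primes => /andP[l_pr _].
by rewrite p_part pfactor_dvdn // mn.
Qed.

Lemma logn_prod l (I : finType) (F : I -> nat) : (forall i, 0 < F i)%N ->
  logn l (\prod_i F i) = (\sum_i logn l (F i))%N.
Proof.
move=> F0; have [//] : logn l (\prod_i F i) = (\sum_i logn l (F i))%N /\ (0 < \prod_i F i)%N.
apply: (big_rec2 (fun x y => logn l x = y /\ 0 < x)%N); first by rewrite logn1.
by move=> i x y _ [<- y0]; rewrite lognM // muln_gt0 F0.
Qed.

(** For a prime l, the exponent of l in [n!] counts the pairs (k, i) with i > 0
    and [k * l ^ i <= n]; for a fixed k these i are the exponents with
    [l ^ i <= n / k], and they number at least the exponent of l in the k-th
    factor. *)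
Lemma prod_lcm_upto_le n :
  (\prod_(k < n) lcm_upto (n %/ k.+1) <= n`!)%N.
Proof.
apply: dvdn_leq; rewrite ?fact_gt0 //; apply: logn_leq_dvdn => [||l l_pr].
- by rewrite prodn_gt0 // => k; exact: lcm_upto_gt0.
- exact: fact_gt0.
rewrite logn_prod => [|k]; last exact: lcm_upto_gt0.
rewrite logn_fact // big_add1 /= big_mkord.
rewrite [leqRHS](eq_bigr (fun i : 'I_n => \sum_(k < n) (k.+1 * l ^ i.+1 <= n)))%N; last first.
  by move=> i _; rewrite divn_sum_indicator // expn_gt0 prime_gt0.
rewrite exchange_big /=; apply: leq_sum => k _.
have nk0 : (0 < n %/ k.+1)%N by rewrite divn_gt0.
have le_l := logn_lcm_upto l_pr nk0.
have logn_n : (logn l (lcm_upto (n %/ k.+1)) <= n)%N.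
  apply: (leq_trans _ (leq_div n k.+1)); apply: leq_trans le_l.
  by rewrite ltnW // ltn_expl // prime_gt1.
rewrite -{1}(sum_lt_indicator logn_n); apply: leq_sum => i _.
case: ltnP => // il; rewrite lt0b mulnC -leq_divRL //.
by apply: leq_trans le_l; rewrite leq_exp2l // prime_gt1.
Qed.

(** By doubling, the sum of the [n / k] grows faster than linearly. *)
Lemma sum_divn_double n :
  (2 * (\sum_(k < n) n %/ k.+1) + n <= \sum_(k < n + n) (n + n) %/ k.+1)%N.
Proof.
rewrite big_split_ord /= big_distrr /=; apply: leq_add.
  apply: leq_sum => k _; rewrite leq_divRL //= -mulnA mul2n -addnn.
  by rewrite leq_add // leq_divM.
rewrite -{1}(card_ord n) -sum1_card; apply: leq_sum => k _.
by rewrite divn_gt0 //= -addnS leq_add2l.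
Qed.

Lemma sum_divn_pow2 s :
  (2 ^ s * s <= 2 * \sum_(k < 2 ^ s) 2 ^ s %/ k.+1)%N.
Proof.
elim: s => [//|s IHs]; rewrite expnS mul2n -addnn.
apply: leq_trans (leq_mul (leqnn 2) (sum_divn_double _)).
lia.
Qed.

Lemma exprn_one_add (F : numDomainType) (x : F) n : 0 <= x ->
  1 + x *+ n <= (1 + x) ^+ n.
Proof.
move=> x0; elim: n => [|n IHn]; first by rewrite mulr0n addr0 expr0.
rewrite exprS; apply: (@le_trans _ _ ((1 + x) * (1 + x *+ n))).
  rewrite mulrDl mul1r mulrDr mulr1 mulrS addrA [leRHS]addrA.
  rewrite -[leLHS]addr0 [1 + x + _]addrAC lerD //.
  by rewrite mulr_ge0 // mulrn_wge0.
by rewrite ler_wpM2l // addr_ge0.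
Qed.

(** The sequence decreases to e, so that a single term, close to e, bounds all
    the later ones. *)
Lemma one_plus_inv_pow_decr (F : realFieldType) (k : nat) :
  (0 < k)%N -> (1 + k.+1%:R^-1) ^+ k.+2 <= (1 + k%:R^-1) ^+ k.+1 :> F.
Proof.
move=> k0; have := ltr0n F k; rewrite k0 -[in X in (1 + X^-1) ^+ k.+2]natr1.
move: (natr1 k : k%:R + 1 = k.+1%:R :> F); set x : F := k%:R => x1 kp.
have kn : x != 0 by rewrite gt_eqF.
rewrite exprS.
have e : 1 + x^-1 = (1 + (x + 1)^-1) * (1 + (x * (x + 2))^-1).
  by field; rewrite kn !gt_eqF // ?ltr_wpDr.
rewrite e exprMn mulrC ler_pM2l; last by rewrite exprn_gt0 // addr_gt0 // invr_gt0 addr_gt0.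
have y0 : 0 <= (x * (x + 2))^-1 by rewrite invr_ge0 mulr_ge0 // ?addr_ge0 // ltW.
apply: le_trans (exprn_one_add k.+1 y0).
have -> (z : F) : z *+ k.+1 = z * (x + 1) by rewrite x1 mulr_natr.
rewrite -subr_ge0.
suff -> : 1 + (x * (x + 2))^-1 * (x + 1) - (1 + (x + 1)^-1) = (x * (x + 2) * (x + 1))^-1.
  by rewrite invr_ge0 !mulr_ge0 ?addr_ge0 // ltW.
by field; rewrite kn !gt_eqF // ?ltr_wpDr.
Qed.

Lemma exprn_unbounded (F : archiRealFieldType) (t K : F) : 0 < t ->
  exists n, K < (1 + t) ^+ n.
Proof.
move=> t0; exists (Num.bound `|K / t|).
apply: lt_le_trans (exprn_one_add _ (ltW t0)).
apply: (@lt_trans _ _ (t *+ Num.bound `|K / t|)); last by rewrite ltrDr.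
rewrite -mulr_natr mulrC -ltr_pdivrMr //.
by apply: le_lt_trans (ler_norm _) (archi_boundP (normr_ge0 _)).
Qed.

Lemma one_plus_inv_pow_le (F : realFieldType) (k0 k : nat) :
  (0 < k0 <= k)%N -> (1 + k%:R^-1) ^+ k.+1 <= (1 + k0%:R^-1) ^+ k0.+1 :> F.
Proof.
case/andP=> k00; elim: k => [|k IHk]; first by case: k0 k00.
rewrite leq_eqVlt ltnS => /orP[/eqP -> //|k0k].
by apply: le_trans (IHk k0k); apply: one_plus_inv_pow_decr; exact: leq_trans k0k.
Qed.

Lemma prod_succ_ratio (F : realFieldType) (k0 n : nat) : (0 < k0 <= n)%N ->
  \prod_(k0 <= k < n) (k.+1%:R / k%:R) = n%:R / k0%:R :> F.
Proof.
case/andP=> k00; elim: n => [|n IHn]; first by case: k0 k00.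
rewrite leq_eqVlt => /orP[/eqP <-|]; first by rewrite big_geq // divff // pnatr_eq0 -lt0n.
rewrite ltnS => kn; rewrite big_nat_recr //= IHn // mulrC mulrA divfK //.
by rewrite pnatr_eq0 -lt0n (leq_trans k00).
Qed.

(** Telescoping writes [n!] as the product of the [((k+1) / k) ^ (n-k)]; the
    factors with [k < k0] are of exponential size only. *)
Lemma fact_le_prod_ratio (F : realFieldType) (k0 n : nat) : (0 < k0)%N ->
  n`!%:R <= (k0`! * k0 ^ n)%:R *
    \prod_(k0 <= k < n) (k.+1%:R / k%:R) ^+ (n - k) :> F.
Proof.
move=> k00; elim: n => [|n IHn].
  by rewrite big_geq // mulr1 ler_nat muln1 fact_gt0.
case: (ltnP n k0) => [nk|kn].
  rewrite big_geq // mulr1 ler_nat.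
  by rewrite -[n.+1`!]muln1 leq_mul ?expn_gt0 ?k00 // leq_fact.
rewrite (eq_big_nat _ _ (F2 := fun k => (k.+1%:R / k%:R) ^+ (n - k) * (k.+1%:R / k%:R))); last first.
  by move=> k /andP[_ kn']; rewrite -exprSr subSn.
rewrite big_split /= prod_succ_ratio; last by rewrite k00 ltnW.
rewrite big_nat_recr //= subnn expr0 mulr1.
set P := \prod_(_ <= _ < _) _ in IHn *.
have k0n : k0%:R != 0 :> F by rewrite pnatr_eq0 -lt0n.
have -> : (k0`! * k0 ^ n.+1)%:R * (P * (n.+1%:R / k0%:R)) =
          n.+1%:R * ((k0`! * k0 ^ n)%:R * P) :> F.
  by rewrite expnSr mulnA [in LHS]natrM; field.
by rewrite factS natrM ler_wpM2l.
Qed.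

(** Chebyshev's argument for [liminf lcm(1..m)^(1/m) <= e].  A lower bound
    [c * A ^ m <= lcm(1..m)^2] for all [m > 0] can be multiplied over the
    [m = n / k] to give [c ^ n * A ^ S(n) <= n!^2], where [S(n)] is the sum of the
    [n / k].  On the other hand [n - k <= (k+1) * (n / (k+1))], hence each factor
    [((k+1) / k) ^ (2(n-k))] of [n!^2] is at most [E ^ (n / (k+1))], and
    [n!^2 <= K ^ n * E ^ S(n)] for a constant K.  As [A > E] and [S(n) / n] is
    unbounded, this is absurd. *)
Lemma lcm_upto_sq_not_geq (F : archiRealFieldType) (k0 : nat) (E A c : F) :
    (0 < k0)%N -> ((1 + k0%:R^-1) ^+ k0.+1) ^+ 2 <= E -> E < A -> 0 < c ->
  ~ (forall m, (0 < m)%N -> c * A ^+ m <= (lcm_upto m)%:R ^+ 2).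
Proof.
move=> k00 leE ltEA c0 le_lcm.
have E1 : 1 <= E.
  apply: le_trans leE; rewrite -exprM exprn_ege1 // lerDl invr_ge0.
  by rewrite ler0n.
have E0 : 0 < E by apply: lt_le_trans E1.
(* t measures the gap: [A = E * (1 + t)]. *)
pose t := (A - E) / E; have t0 : 0 < t by rewrite divr_gt0 // subr_gt0.
have At : A = E * (1 + t) by rewrite /t mulrDr mulr1 mulrC divfK ?gt_eqF // addrC subrK.
pose S n := (\sum_(k < n) n %/ k.+1)%N.
pose P (n : nat) : F := \prod_(k0 <= k < n) (k.+1%:R / k%:R) ^+ (n - k).
have ratio_ge1 k : (0 < k)%N -> 1 <= k.+1%:R / k%:R :> F.
  by move=> kp; rewrite ler_pdivlMr ?ltr0n // mul1r ler_nat.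
have ratioE k : (k0 <= k)%N -> (k.+1%:R / k%:R) ^+ k.+1 ^+ 2 <= E.
  move=> kk; have kp : (0 < k)%N by exact: leq_trans kk.
  apply: le_trans leE.
  have -> : k.+1%:R / k%:R = 1 + k%:R^-1 :> F.
    by rewrite -natr1 mulrDl mul1r divff // pnatr_eq0 -lt0n.
  rewrite lerXn2r ?nnegrE ?exprn_ge0 ?addr_ge0 ?invr_ge0 ?ler0n //.
  by apply: one_plus_inv_pow_le; rewrite k00.
have leP n : P n ^+ 2 <= \prod_(k < n) E ^+ (n %/ k.+1).
  case: (leqP n k0) => [nk|kn].
    rewrite /P big_geq // expr1n; elim/big_rec: _ => // k x _ x1.
    by rewrite -[1]mulr1 ler_pM // exprn_ege1.
  rewrite /P -(big_mkord xpredT (fun k => E ^+ (n %/ k.+1))).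
  rewrite [leRHS](big_cat_nat (n := k0)) ?(ltnW kn) //= -[leLHS]mul1r.
  apply: ler_pM => //.
  - by rewrite exprn_ge0 // prodr_ge0 // => k _; rewrite exprn_ge0 // divr_ge0 ?ler0n.
  - by elim/big_rec: _ => // k x _ x1; rewrite -[1]mulr1 ler_pM // exprn_ege1.
  rewrite -prodrXl big_nat_cond [leRHS]big_nat_cond.
  apply: ler_prod => k /andP[/andP[kk kn'] _]; apply/andP; split.
    by rewrite !exprn_ge0 // divr_ge0 ?ler0n.
  have kp : (0 < k)%N by exact: leq_trans kk.
  apply: (@le_trans _ _ (((k.+1%:R / k%:R) ^+ k.+1 ^+ 2) ^+ (n %/ k.+1))); last first.
    by rewrite lerXn2r ?nnegrE ?exprn_ge0 ?ratioE ?(ltW E0) // divr_ge0 ?ler0n.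
  rewrite -!exprM; apply: ler_weXn2l; first exact: ratio_ge1.
  have : (n - k <= k.+1 * (n %/ k.+1))%N.
    rewrite leq_subLR {1}(divn_eq n k.+1) [leqRHS]addnC mulnC leq_add2l.
    by rewrite -ltnS ltn_pmod.
  by move: (n %/ k.+1)%N (n - k)%N => q r; nia.
have P0 n : 0 < P n ^+ 2.
  rewrite exprn_gt0 // /P big_nat_cond; apply: prodr_gt0 => k /andP[/andP[kk _] _].
  by rewrite exprn_gt0 // (lt_le_trans ltr01) // ratio_ge1 // (leq_trans k00).
have key n : c ^+ n * (1 + t) ^+ S n <= (k0`! * k0 ^ n)%:R ^+ 2.
  rewrite -(ler_pM2r (P0 n)).
  apply: (@le_trans _ _ (n`!%:R ^+ 2)); last first.
    by rewrite -exprMn lerXn2r ?nnegrE ?ler0n ?fact_le_prod_ratio //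
       (le_trans _ (fact_le_prod_ratio F n k00)) ?ler0n.
  apply: (@le_trans _ _ ((\prod_(k < n) lcm_upto (n %/ k.+1))%:R ^+ 2)); last first.
    by rewrite lerXn2r ?nnegrE ?ler0n // ler_nat prod_lcm_upto_le.
  rewrite natr_prod -[leRHS]prodrXl.
  apply: (@le_trans _ _ (\prod_(k < n) (c * A ^+ (n %/ k.+1)))); last first.
    apply: ler_prod => k _; rewrite le_lcm ?andbT ?divn_gt0 //.
    by rewrite mulr_ge0 ?exprn_ge0 ?(ltW c0) // ltW // (lt_trans E0).
  rewrite big_split /= prodr_const card_ord -mulrA ler_wpM2l ?exprn_ge0 ?(ltW c0) //.
  rewrite (eq_bigr (fun k : 'I_n => E ^+ (n %/ k.+1) * (1 + t) ^+ (n %/ k.+1))); last first.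
    by move=> k _; rewrite At exprMn.
  rewrite big_split /= [X in _ <= _ * X]prodrXr [leLHS]mulrC ler_wpM2r ?leP //.
  by rewrite exprn_ge0 // addr_ge0 // ltW.
(* The factors [c ^ n] and [k0! * k0 ^ n] are only exponential, whereas [S (2 ^ N)]
   is at least [2 ^ N * N / 2]. *)
pose K : F := (k0`! * k0)%:R ^+ 2 / c.
have [N KN] := exprn_unbounded (K ^+ 2) t0.
have t1 : 1 <= 1 + t by rewrite lerDl ltW.
have le_K n : (0 < n)%N -> (1 + t) ^+ S n <= K ^+ n.
  move=> n0; rewrite expr_div_n ler_pdivlMr ?exprn_gt0 // mulrC.
  apply: le_trans (key n) _; rewrite exprAC lerXn2r ?nnegrE ?exprn_ge0 ?ler0n //.
  rewrite -natrX ler_nat expnMn leq_mul2r; apply/orP; right.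
  by rewrite -{1}[k0`!]expn1 leq_pexp2l // fact_gt0.
have n0 : (0 < 2 ^ N)%N by rewrite expn_gt0.
have : (1 + t) ^+ N ^+ (2 ^ N) <= K ^+ 2 ^+ (2 ^ N).
  rewrite -[leLHS]exprM [leRHS]exprAC.
  apply: (@le_trans _ _ ((1 + t) ^+ S (2 ^ N)%N ^+ 2)); last first.
    by rewrite lerXn2r ?nnegrE ?le_K ?exprn_ge0 ?divr_ge0 ?exprn_ge0 ?ler0n ?addr_ge0 // ltW.
  by rewrite -exprM ler_weXn2l // mulnC [leqRHS]mulnC sum_divn_pow2.
have K0 : 0 <= K by rewrite divr_ge0 ?exprn_ge0 ?ler0n // ltW.
by rewrite leNgt ltrXn2r ?gtn_eqF // ?exprn_ge0.
Qed.

(** * Rational numbers that are integral at p *)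

Section Localization.
Variables (p : nat) (p_pr : prime p).

(** Indexing the ring Z_(p) by a proof of primality makes its closure under the
    ring operations a canonical instance. *)
Definition zloc of prime p : {pred rat} := [pred r : rat | ~~ (p %| `|denq r|)%N].

Lemma zlocP (r : rat) :
  reflect (exists (m : int) (d : nat), ~~ (p %| d)%N /\ r * d%:R = m%:~R)
    (r \in zloc p_pr).
Proof.
apply: (iffP idP) => [rp|[m [d [pd e]]]].
  exists (numq r), `|denq r|%N; split=> //.
  rewrite -{1}[r]divq_num_den; have := denq_gt0 r.
  case: (denq r) (denq_neq0 r) => // n n0 _.
  by rewrite absz_nat -pmulrn divfK // pnatr_eq0.
rewrite inE; apply: contra pd => /dvdn_trans; apply.
have /eqP : (numq r * d%:Z)%:~R = (m * denq r)%:~R :> rat.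
  by rewrite !intrM -e numqE -pmulrn mulrAC.
rewrite eqr_int => /eqP nd.
have : (denq r %| numq r * d%:Z)%Z by rewrite nd dvdz_mull.
by rewrite Gauss_dvdzr ?dvdzE // coprimezE coprime_sym coprime_num_den.
Qed.

Lemma zloc_int (m : int) : m%:~R \in zloc p_pr.
Proof. by rewrite inE denq_int /= dvdn1 gtn_eqF ?prime_gt1. Qed.

Fact zloc_subring : subring_closed (zloc p_pr).
Proof.
split; first exact: (zloc_int 1).
  move=> x y /zlocP[m [d [pd e]]] /zlocP[n [c [pc f]]]; apply/zlocP.
  exists (m * c%:Z - n * d%:Z), (d * c)%N; split; first by rewrite Euclid_dvdM // negb_or pd.
  by rewrite rmorphB /= !intrM -e -f natrM -!pmulrn; ring.
move=> x y /zlocP[m [d [pd e]]] /zlocP[n [c [pc f]]]; apply/zlocP.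
exists (m * n), (d * c)%N; split; first by rewrite Euclid_dvdM // negb_or pd.
by rewrite intrM -e -f natrM; ring.
Qed.

HB.instance Definition _ := GRing.isSubringClosed.Build rat (zloc p_pr) zloc_subring.

Lemma zlocV (m : int) : ~~ (p %| m)%Z -> m%:~R^-1 \in zloc p_pr.
Proof.
move=> pm; have m0 : m != 0 by apply: contraNneq pm => ->; rewrite dvdz0.
apply/zlocP; exists (sgz m), `|m|%N; split; first by [].
rewrite pmulrn abszE -[in RHS](mulKf (_ : m%:~R != 0 :> rat) (sgz m)%:~R) ?intr_eq0 //.
by rewrite -intrM mulrC [m * _]mulrC -normrEsg // mulrC.
Qed.

Lemma zloc_dvd_int (m : int) k : m%:~R / p%:R ^+ k \in zloc p_pr -> (p ^ k %| `|m|)%N.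
Proof.
case/zlocP=> n [d [pd e]].
have p0 : p%:R ^+ k != 0 :> rat by rewrite expf_neq0 // pnatr_eq0 -lt0n prime_gt0.
have /eqP : (m * d%:Z)%:~R = (n * (p ^ k)%:Z)%:~R :> rat.
  by rewrite !intrM -e -!pmulrn natrX mulrAC divfK.
rewrite eqr_int => /eqP md.
have : (p ^ k %| `|m| * d)%N.
  by have := congr1 absz md; rewrite !abszM !absz_nat => ->; rewrite dvdn_mull.
by rewrite Gauss_dvdl // coprimeXl // prime_coprime.
Qed.

End Localization.

(** * The functional sending X^n to B_n *)

Section Volkenborn.
Implicit Types f g : {poly rat}.

(** This is the Volkenborn integral over Z_p, restricted to polynomials. *)
Definition volkenborn f : rat := \sum_(i < size f) f`_i * bernoulli i.

Lemma volkenbornE n f : (size f <= n)%N ->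
  volkenborn f = \sum_(i < n) f`_i * bernoulli i.
Proof.
move=> fn; rewrite /volkenborn (big_ord_widen n (fun i => f`_i * bernoulli i)) //.
rewrite big_mkcond /=; apply: eq_bigr => i _.
by case: ltnP => // /(nth_default 0) ->; rewrite mul0r.
Qed.

Fact volkenborn_linear : linear_for *%R volkenborn.
Proof.
move=> a f g; pose n := maxn (size f) (size g).
have fn : (size f <= n)%N by rewrite leq_maxl.
have gn : (size g <= n)%N by rewrite leq_maxr.
rewrite (volkenbornE fn) (volkenbornE gn) (@volkenbornE n); last first.
  by rewrite (leq_trans (size_polyD _ _)) // geq_max gn andbT (leq_trans (size_scale_leq _ _)).
rewrite mulr_sumr -big_split /=; apply: eq_bigr => i _.
by rewrite coefD coefZ mulrDl mulrA.
Qed.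

HB.instance Definition _ :=
  GRing.isLinear.Build rat {poly rat} rat *%R volkenborn volkenborn_linear.

Lemma volkenbornXn n : volkenborn 'X^n = bernoulli n.
Proof.
rewrite (@volkenbornE n.+1) ?size_polyXn // big_ord_recr /= coefXn eqxx mul1r.
rewrite big1 ?add0r // => i _; rewrite coefXn ltn_eqF ?mul0r //.
Qed.

Lemma bernoulli_sum n :
  \sum_(i < n) 'C(n, i)%:R * bernoulli i = (n == 1%N)%:R.
Proof.
have := congr1 (fun x => n`!%:R * x) (bernoulliP n).
have -> : n`!%:R * (n == 1%N)%:R = (n == 1%N)%:R :> rat.
  by case: eqP => [->|]; rewrite ?mulr0 ?mulr1.
move=> <-; rewrite big_ord_recr /= subnn mul0r mulr0 addr0 mulr_sumr.
apply: eq_bigr => i _; rewrite subn_eq0 -ltnNge ltn_ord mul1r.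
have fact_neq0 m : m`!%:R != 0 :> rat by rewrite pnatr_eq0 -lt0n fact_gt0.
rewrite -(bin_fact (ltnW (ltn_ord i))) !natrM; field.
by rewrite !fact_neq0.
Qed.

Lemma poly_monomial_ind (Q : {poly rat} -> Prop) :
    Q 0 -> (forall a f g, Q f -> Q g -> Q (a *: f + g)) -> (forall n, Q 'X^n) ->
  forall f, Q f.
Proof.
move=> Q0 QD QX f; rewrite -[f]coefK poly_def.
by elim/big_rec: _ => // i g _ Qg; exact: QD.
Qed.

(** The recurrence of the Bernoulli numbers, freed from the monomial basis.  It
    determines the functional, because every polynomial is a difference; the
    symmetries below are all checked on differences. *)
Lemma volkenborn_diff f : volkenborn (f \Po ('X + 1) - f) = f^`().[0].
Proof.
elim/poly_monomial_ind: f => [|a f g IHf IHg|n].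
- by rewrite comp_poly0 subrr linear0 deriv0 horner0.
- rewrite comp_polyD comp_polyZ opprD addrACA -scalerBr linearP /= IHf IHg.
  by rewrite derivD derivZ hornerD hornerZ.
rewrite comp_Xn_poly [_ + 1]addrC exprDn big_ord_recr /= binn mulr1n subnn expr0 mul1r.
rewrite addrK linear_sum /=.
rewrite (eq_bigr (fun i : 'I_n => 'C(n, i)%:R * bernoulli i)) => [|i _]; last first.
  by rewrite expr1n mul1r raddfMn /= volkenbornXn mulr_natl.
rewrite bernoulli_sum derivXn hornerMn hornerXn.
by case: n => [|[|n]]; rewrite ?mulr0n ?expr0 // expr0n mul0rn.
Qed.

Lemma has_antidifference f : exists g, g \Po ('X + 1) - g = f.
Proof.
elim/poly_monomial_ind: f => [|a f g [F <-] [G <-]|n].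
- by exists 0; rewrite comp_poly0 subrr.
- by exists (a *: F + G); rewrite comp_polyD comp_polyZ opprD addrACA scalerBr.
elim/ltn_ind: n => n IHn.
have /choice [G GP] : forall i : 'I_n, exists g : {poly rat}, g \Po ('X + 1) - g = 'X^i.
  by move=> i; exact: IHn.
pose S : {poly rat} := \sum_(i < n) (G i *+ 'C(n.+1, i)).
have SE : S \Po ('X + 1) - S = \sum_(i < n) 'X^i *+ 'C(n.+1, i).
  rewrite /S raddf_sum -sumrB; apply: eq_bigr => i _.
  by rewrite raddfMn -mulrnBl GP.
have XE : ('X + 1) ^+ n.+1 =
    \sum_(i < n) 'X^i *+ 'C(n.+1, i) + 'X^n *+ n.+1 + 'X^(n.+1) :> {poly rat}.
  rewrite [_ + 1]addrC exprDn !big_ord_recr /= binn mulr1n subnn expr0 mul1r.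
  rewrite expr1n mul1r binSn; congr (_ + _ + _); apply: eq_bigr => i _.
  by rewrite expr1n mul1r.
exists ((n.+1%:R : rat)^-1 *: ('X^(n.+1) - S)).
rewrite comp_polyZ -scalerBr comp_polyB comp_Xn_poly XE -SE.
have cancel (a b c s : {poly rat}) : a - s + b + c - a - (c - s) = b by ring.
rewrite cancel.
by rewrite -scaler_nat scalerA mulVf ?scale1r // pnatr_eq0.
Qed.

Lemma volkenborn_reflect f : volkenborn (f \Po (- 1 - 'X)) = volkenborn f.
Proof.
have [g <-] := has_antidifference f; rewrite volkenborn_diff.
have -> : (g \Po ('X + 1) - g) \Po (- 1 - 'X) =
    - ((g \Po (- 'X)) \Po ('X + 1) - (g \Po (- 'X))).
  rewrite comp_polyB -!comp_polyA opprB !raddfN /= !raddfD /= !comp_polyX !comp_polyC.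
  by congr ((_ \Po _) - (_ \Po _)); ring.
rewrite linearN /= volkenborn_diff deriv_comp derivN derivX hornerM horner_comp.
by rewrite !hornerN hornerX hornerC oppr0 mulrN1 opprK.
Qed.

(** Raabe's multiplication formula for the factor 2. *)
Lemma volkenborn_double f :
  volkenborn (f \Po ('X *+ 2)) + volkenborn (f \Po ('X *+ 2 + 1)) = volkenborn f *+ 2.
Proof.
have [g <-] := has_antidifference f; rewrite volkenborn_diff -linearD /=.
have -> : ((g \Po ('X + 1) - g) \Po ('X *+ 2)) + ((g \Po ('X + 1) - g) \Po ('X *+ 2 + 1)) =
    (g \Po ('X *+ 2)) \Po ('X + 1) - (g \Po ('X *+ 2)).
  rewrite !comp_polyB -!comp_polyA.
  have -> : ('X + 1) \Po ('X *+ 2) = 'X *+ 2 + 1 :> {poly rat}.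
    by rewrite raddfD /= comp_polyX comp_polyC.
  have -> : ('X + 1) \Po ('X *+ 2 + 1) = ('X *+ 2) \Po ('X + 1) :> {poly rat}.
    by rewrite raddfD raddfMn /= !comp_polyX comp_polyC mulrnDl -addrA.
  by rewrite addrC addrA subrK.
rewrite volkenborn_diff deriv_comp derivMn derivX hornerM horner_comp.
by rewrite !hornerMn hornerX hornerC mul0rn mulr_natr.
Qed.

Definition ffact_poly (k : nat) : {poly rat} := \prod_(i < k) ('X - i%:R%:P).
Definition binom_poly (k : nat) : {poly rat} := k`!%:R^-1 *: ffact_poly k.

Lemma ffact_polyS k : ffact_poly k.+1 = ffact_poly k * ('X - k%:R%:P).
Proof. by rewrite /ffact_poly big_ord_recr. Qed.

Lemma size_ffact_poly k : size (ffact_poly k) = k.+1.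
Proof. by rewrite /ffact_poly size_prod_XsubC /index_enum -enumT size_enum_ord. Qed.

Lemma ffact_poly_shift k : ffact_poly k.+1 \Po ('X + 1) = ('X + 1) * ffact_poly k.
Proof.
rewrite /ffact_poly big_ord_recl rmorphM /= subr0 comp_polyX rmorph_prod /=.
congr (_ * _); apply: eq_bigr => i _.
rewrite comp_polyB comp_polyX comp_polyC -natr1 rmorphD /=.
by ring.
Qed.

Lemma ffact_poly_diff k :
  (ffact_poly k.+1 \Po ('X + 1)) - ffact_poly k.+1 = k.+1%:R *: ffact_poly k.
Proof.
rewrite ffact_poly_shift ffact_polyS mulrC -mulrBr -mul_polyC mulrC; congr (_ * _).
rewrite -natr1 rmorphD /=; ring.
Qed.

Lemma deriv_ffact_poly0 k : (ffact_poly k.+1)^`().[0] = (-1) ^+ k * k`!%:R.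
Proof.
rewrite /ffact_poly big_ord_recl subr0 derivM derivX mul1r hornerD hornerM hornerX mul0r addr0.
rewrite horner_prod; elim: k => [|k IHk]; first by rewrite big_ord0 mul1r.
rewrite big_ord_recr /= IHk hornerXsubC /bump /= add1n factS natrM exprS sub0r.
by rewrite mulN1r !mulNr mulrN -mulrA [k`!%:R * _]mulrC.
Qed.

Lemma volkenborn_ffact k : volkenborn (ffact_poly k) = (-1) ^+ k * k`!%:R / k.+1%:R.
Proof.
have k0 : k.+1%:R != 0 :> rat by rewrite pnatr_eq0.
apply: (mulfI k0); rewrite -[LHS]linearZ /= -ffact_poly_diff volkenborn_diff.
by rewrite deriv_ffact_poly0 [RHS]mulrC divfK.
Qed.

Lemma volkenborn_binom k : volkenborn (binom_poly k) = (-1) ^+ k / k.+1%:R.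
Proof.
rewrite /binom_poly linearZ /= volkenborn_ffact.
have k0 : k`!%:R != 0 :> rat by rewrite pnatr_eq0 -lt0n fact_gt0.
by rewrite [_ * k`!%:R]mulrC -mulrA mulKf.
Qed.

Lemma size_binom_poly k : size (binom_poly k) = k.+1.
Proof.
by rewrite size_scale ?size_ffact_poly // invr_eq0 pnatr_eq0 -lt0n fact_gt0.
Qed.

Lemma ffact_poly_nat k n : (ffact_poly k).[n%:R] = (n ^_ k)%:R.
Proof.
rewrite /ffact_poly horner_prod ffact_prod natr_prod.
case: (leqP k n) => kn.
  apply: eq_bigr => i _; rewrite hornerXsubC natrB //.
  by rewrite ltnW // (leq_trans _ kn).
rewrite (bigD1 (Ordinal kn)) //= hornerXsubC subrr mul0r.
by rewrite [RHS](bigD1 (Ordinal kn)) //= subnn mul0r.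
Qed.

Lemma binom_poly_nat k n : (binom_poly k).[n%:R] = 'C(n, k)%:R.
Proof.
rewrite hornerZ ffact_poly_nat -bin_ffact natrM mulrC mulfK.
  by [].
by rewrite pnatr_eq0 -lt0n fact_gt0.
Qed.
End Volkenborn.

Local Notation L := volkenborn.

(** * Denominators of the values of the functional *)

Section Denominators.
Variables (p : nat) (p_pr : prime p).
Implicit Types f g : {poly rat}.
Local Notation Zp := (zloc p_pr).

Let p_neq0 : p%:R != 0 :> rat.
Proof. by rewrite pnatr_eq0 -lt0n prime_gt0. Qed.

Lemma zloc_nat n : n%:R \in Zp.
Proof. exact: (zloc_int p_pr n). Qed.

Lemma zloc_pow_div (T m : nat) : (0 < m)%N -> (logn p m <= T)%N ->
  p%:R ^+ T / m%:R \in Zp.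
Proof.
move=> m0 vT; have [u cop_u mE] := pfactor_coprime p_pr m0.
have pu : ~~ (p %| u)%N by rewrite -prime_coprime.
have -> : p%:R ^+ T / m%:R = p%:R ^+ (T - logn p m) / u%:R :> rat.
  rewrite [in LHS]mE natrM natrX -{1}(subnK vT) exprD -mulf_div divff ?mulr1 //.
  by rewrite expf_neq0.
by rewrite rpredM ?rpredX ?zloc_nat // -[_^-1]/((u%:Z)%:~R^-1) zlocV.
Qed.

Lemma zloc_fact_div n : p%:R * n`!%:R / n.+1%:R \in Zp.
Proof.
case v: (logn p n.+1) => [|v'].
  rewrite !rpredM ?zloc_nat //.
  by rewrite -[_^-1]mul1r -(expr0 p%:R) zloc_pow_div ?v.
have pv : (p ^ v' <= n)%N.
  rewrite -ltnS; apply: leq_trans (_ : p ^ v'.+1 <= _)%N; first by rewrite ltn_exp2l ?prime_gt1.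
  by rewrite -v dvdn_leq // pfactor_dvdnn.
have /dvdnP[q ->] : (p ^ v' %| n`!)%N by rewrite dvdn_fact // expn_gt0 prime_gt0.
rewrite natrM natrX [p%:R * _]mulrCA -exprS -mulrA.
by rewrite rpredM ?zloc_nat // zloc_pow_div ?v.
Qed.

(** Half of the theorem of von Staudt and Clausen: p clears the p-part of the
    denominators.  Raising the length of the falling factorial trades the
    monomials for the values [i! / (i+1)]. *)
Lemma zloc_volkenborn_Xn_ffact j i : p%:R * volkenborn ('X^j * ffact_poly i) \in Zp.
Proof.
elim: j i => [|j IHj] i.
  rewrite mul1r volkenborn_ffact -[_ * _ / _]mulrA mulrCA.
  by rewrite rpredM ?rpredX ?rpredN1 // mulrA zloc_fact_div.
have -> : 'X^(j.+1) * ffact_poly i = 'X^j * ffact_poly i.+1 + i%:R *: ('X^j * ffact_poly i).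
  by rewrite ffact_polyS -mul_polyC exprSr; ring.
by rewrite linearD linearZ /= mulrDr rpredD // mulrCA rpredM ?zloc_nat.
Qed.

Lemma zloc_volkenborn f : f \is a polyOver Zp -> p%:R * volkenborn f \in Zp.
Proof.
move=> /polyOverP fZ; rewrite -[f]coefK poly_def linear_sum mulr_sumr rpred_sum //= => i _.
rewrite linearZ /= mulrCA rpredM //.
by have := zloc_volkenborn_Xn_ffact i 0; rewrite /ffact_poly big_ord0 mulr1.
Qed.

Lemma zloc_bernoulli n : p%:R * bernoulli n \in Zp.
Proof. by rewrite -volkenbornXn zloc_volkenborn // rpredX // polyOverX. Qed.

End Denominators.

Definition int_valued (f : {poly rat}) := forall n : nat, f.[n%:R] \is a Num.int.

Lemma int_valuedM f g : int_valued f -> int_valued g -> int_valued (f * g).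
Proof. by move=> fZ gZ n; rewrite hornerM rpredM. Qed.

Lemma int_valuedX : int_valued 'X.
Proof. by move=> n; rewrite hornerX; exact: natr_int. Qed.

Lemma int_valuedXn f n : int_valued f -> int_valued (f ^+ n).
Proof. by move=> fZ m; rewrite horner_exp rpredX. Qed.

Lemma int_valuedC (m : int) : int_valued m%:~R%:P.
Proof. by move=> n; rewrite hornerC. Qed.

Lemma int_valued_sum n (F : 'I_n -> {poly rat}) :
  (forall i, int_valued (F i)) -> int_valued (\sum_i F i).
Proof. by move=> FZ m; rewrite horner_sum rpred_sum // => i _; exact: FZ. Qed.

Lemma newton_values f : int_valued f ->
  forall d, exists c : nat -> int, forall n, (n < d)%N ->
    f.[n%:R] = \sum_(i < d) (c i)%:~R * 'C(n, i)%:R.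
Proof.
move=> fZ; elim=> [|d [c cP]]; first by exists (fun=> 0).
have /intrP[m mE] : f.[d%:R] - \sum_(i < d) (c i)%:~R * 'C(d, i)%:R \is a Num.int.
  by rewrite rpredB ?fZ // rpred_sum // => i _; rewrite rpredM // ?intr_int // natr_int.
exists (fun i => if i == d then m else c i) => n; rewrite ltnS leq_eqVlt.
rewrite big_ord_recr /= eqxx (eq_bigr (fun i : 'I_d => (c i)%:~R * 'C(n, i)%:R)); last first.
  by move=> i _; rewrite ltn_eqF.
case/orP=> [/eqP ->|nd]; first by rewrite -mE binn mulr1 addrC subrK.
by rewrite cP // [X in _ + _ * X%:R]bin_small // mulr0 addr0.
Qed.

(** Newton interpolation at the natural numbers has integral coefficients in the
    binomial basis. *)
Lemma newton_expansion f d : int_valued f -> (size f <= d)%N ->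
  exists c : nat -> int, f = \sum_(i < d) (c i)%:~R *: binom_poly i.
Proof.
move=> fZ fd; have [c cP] := newton_values fZ d; exists c.
apply/eqP; rewrite -subr_eq0; apply/eqP.
set g := \sum_(i < d) _; have gd : (size (f - g)%R <= d)%N.
  rewrite (leq_trans (size_polyD _ _)) // size_polyN geq_max fd /=.
  apply: leq_trans (size_sum _ _ _) _; apply/bigmax_leqP => i _.
  apply: leq_trans (size_scale_leq _ _) _.
  by rewrite size_binom_poly.
have : ~~ (size [seq i%:R : rat | i <- iota 0 d] < size (f - g)%R)%N.
  by rewrite size_map size_iota -leqNgt.
apply: contraNeq => fg; apply: max_poly_roots => //.
  apply/allP => x /mapP[n]; rewrite mem_iota add0n => /= nd ->.
  rewrite rootE hornerD hornerN cP // horner_sum subr_eq0; apply/eqP; apply: eq_bigr => i _.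
  by rewrite hornerZ binom_poly_nat.
by rewrite map_inj_uniq ?iota_uniq // => m n /eqP; rewrite eqr_nat => /eqP.
Qed.

(** In the binomial basis the values of the functional are [(-1)^k / (k+1)], so the
    denominator is governed by the degree and not by the coefficients of f in the
    monomial basis. *)
Lemma zloc_volkenborn_int_valued p (p_pr : prime p) f d :
  int_valued f -> (size f <= d)%N -> 
  p%:R ^+ trunc_log p d * volkenborn f \in zloc p_pr.
Proof.
move=> fZ fd; have [c ->] := newton_expansion fZ fd.
rewrite linear_sum mulr_sumr rpred_sum //= => i _.
rewrite linearZ /= volkenborn_binom mulrCA rpredM ?zloc_int // mulrCA.
rewrite rpredM ?rpredX ?rpredN1 // zloc_pow_div //.
rewrite trunc_log_max ?prime_gt1 //; apply: leq_trans (ltn_ord i).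
by rewrite dvdn_leq // pfactor_dvdnn.
Qed.

(** * The resolvent 1 / (y - X) as a p-adic geometric series *)

(** The expansion of [1 / (y - X)] in powers of [X / y], truncated at J. *)
Definition geom_poly (y : rat) (J : nat) : {poly rat} :=
  \sum_(j < J) y^-1 ^+ j.+1 *: 'X^j.

Lemma geom_polyP y J : y != 0 ->
  (y%:P - 'X) * geom_poly y J = 1 - y^-1 ^+ J *: 'X^J.
Proof.
move=> y0; elim: J => [|J IHJ].
  by rewrite /geom_poly big_ord0 mulr0 !expr0 scale1r subrr.
have -> : geom_poly y J.+1 = geom_poly y J + y^-1 ^+ J.+1 *: 'X^J.
  by rewrite /geom_poly big_ord_recr.
have yJ : y * y^-1 ^+ J.+1 = y^-1 ^+ J by rewrite exprS mulrA divff // mul1r.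
rewrite mulrDr IHJ mulrBl mul_polyC scalerA yJ.
by rewrite -scalerAr -exprS addrA subrK.
Qed.

Section Padic.
Variables (p : nat) (p_pr : prime p).
Local Notation Zp := (zloc p_pr).
Implicit Types (f g H E : {poly rat}) (u : nat -> rat).

Let p_neq0 : p%:R != 0 :> rat.
Proof. by rewrite pnatr_eq0 -lt0n prime_gt0. Qed.

(** Convergence in Q_p with the explicit rate [p ^ (J - c)], stated inside the
    rational numbers. *)
Definition padic_cvg u (a : rat) :=
  exists c, forall J, p%:R ^+ c * (u J - a) / p%:R ^+ J \in Zp.

Lemma denominator_clear (b : rat) : exists c, p%:R ^+ c * b \in Zp.
Proof.
exists `|denq b|%N; rewrite -[X in _ * X]divq_num_den mulrCA rpredM ?zloc_int //.
have := denq_neq0 b; have := denq_gt0 b; case: (denq b) => // d _ d0.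
have {}d0 : (0 < d)%N by rewrite lt0n.
rewrite /= -pmulrn zloc_pow_div // (leq_trans (ltnW (ltn_expl _ (prime_gt1 p_pr)))) //.
by rewrite dvdn_leq // pfactor_dvdnn.
Qed.

Lemma padic_cvgD u v a b :
  padic_cvg u a -> padic_cvg v b -> padic_cvg (fun J => u J + v J) (a + b).
Proof.
move=> [c uc] [d vd]; exists (c + d)%N => J.
have -> : p%:R ^+ (c + d) * (u J + v J - (a + b)) / p%:R ^+ J =
  p%:R ^+ d * (p%:R ^+ c * (u J - a) / p%:R ^+ J) +
  p%:R ^+ c * (p%:R ^+ d * (v J - b) / p%:R ^+ J) by rewrite exprD; ring.
by rewrite rpredD // rpredM ?rpredX ?zloc_nat.
Qed.

Lemma padic_cvgZ k u a : padic_cvg u a -> padic_cvg (fun J => k * u J) (k * a).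
Proof.
move=> [c uc]; have [d kd] := denominator_clear k; exists (c + d)%N => J.
have -> : p%:R ^+ (c + d) * (k * u J - k * a) / p%:R ^+ J =
  (p%:R ^+ d * k) * (p%:R ^+ c * (u J - a) / p%:R ^+ J) by rewrite exprD; ring.
by rewrite rpredM.
Qed.

Lemma eq_padic_cvg u v a : (forall J, u J = v J) -> padic_cvg u a -> padic_cvg v a.
Proof. by move=> uv [c uc]; exists c => J; rewrite -uv. Qed.

Lemma geom_poly_over y J : y^-1 / p%:R \in Zp -> geom_poly y J \is a polyOver Zp.
Proof.
move=> yp; rewrite /geom_poly rpred_sum // => j _.
rewrite polyOverZ ?rpredX ?polyOverX //.
by rewrite -[y^-1](divfK p_neq0) rpredM ?zloc_nat.
Qed.

(** Any p-integral approximation H of [k / (y - X)] modulo [p ^ J] differs from the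
    geometric one by [p ^ J] times a p-integral polynomial, at which the
    functional has denominator at most p. *)
Lemma resolvent_cvg y k (H E : nat -> {poly rat}) : y != 0 -> y^-1 / p%:R \in Zp ->
    (forall J, H J \is a polyOver Zp) -> (forall J, E J \is a polyOver Zp) ->
    (forall J, (y%:P - 'X) * H J = k%:P + p%:R ^+ J *: E J) ->
  padic_cvg (fun J => volkenborn (H J) - k * volkenborn (geom_poly y J)) 0.
Proof.
move=> y0 yp HZ EZ HE; exists 1%N => J; rewrite subr0 expr1.
have GP := geom_polyP J y0.
have e : H J - k *: geom_poly y J =
    p%:R ^+ J *: (geom_poly y J * E J + (y^-1 / p%:R) ^+ J *: ('X^J * H J)).
  have -> : p%:R ^+ J *: (geom_poly y J * E J + (y^-1 / p%:R) ^+ J *: ('X^J * H J)) =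
      geom_poly y J * (p%:R ^+ J *: E J) + (y^-1 ^+ J *: 'X^J) * H J.
    rewrite scalerDr scalerAr scalerA -exprMn [p%:R * _]mulrC divfK //.
    by congr (_ + _); rewrite scalerAl.
  apply/eqP; rewrite -mul_polyC -subr_eq0.
  have cancel (h a g e t : {poly rat}) :
    h - a * g - (g * e + t * h) = h * (1 - t) - g * (a + e) by ring.
  by rewrite cancel -GP -HE; apply/eqP; ring.
rewrite -linearZ -linearB /= e linearZ /= mulrCA mulrC mulKf ?expf_neq0 //.
rewrite zloc_volkenborn //.
apply: rpredD; first by apply: rpredM; [exact: geom_poly_over|exact: EZ].
apply: polyOverZ; first exact: rpredX.
by apply: rpredM; [rewrite rpredX // polyOverX|exact: HZ].
Qed.

End Padic.

(** * Reflection and shift of the resolvent *)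

Lemma geom_poly_comp y J (q : {poly rat}) : y != 0 ->
  (y%:P - q) * (geom_poly y J \Po q) = 1 - y^-1 ^+ J *: q ^+ J.
Proof.
move=> y0; have := congr1 (fun f => f \Po q) (geom_polyP J y0).
by rewrite rmorphM /= !comp_polyB comp_polyC !comp_polyX comp_polyC comp_polyZ comp_Xn_poly.
Qed.

Section Padic.
Variables (p : nat) (p_pr : prime p).
Local Notation Zp := (zloc p_pr).
Local Notation cvg := (padic_cvg p_pr).
Let p_neq0 : p%:R != 0 :> rat.
Proof. by rewrite pnatr_eq0 -lt0n prime_gt0. Qed.

Lemma polyOver_linear (a b : int) : a%:~R%:P + b%:~R *: 'X \is a polyOver Zp.
Proof.
by rewrite rpredD ?polyOverC ?zloc_int // polyOverZ ?zloc_int ?polyOverX.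
Qed.

(** The substitution [X := a + b X] turns [1 / (y - X)] into [k / (y' - X)] with
    [y' = (y - a) / b] and [k = 1 / b]. *)
Lemma resolvent_comp_cvg y y' k (a b : int) :
    y != 0 -> y' != 0 -> y^-1 / p%:R \in Zp -> y'^-1 / p%:R \in Zp ->
    k * (y - a%:~R) = y' -> k * b%:~R = 1 ->
  cvg (fun J => L (geom_poly y J \Po (a%:~R%:P + b%:~R *: 'X)) - k * L (geom_poly y' J)) 0.
Proof.
move=> y0 y'0 yp y'p ky kb; set q := a%:~R%:P + _.
have qZ : q \is a polyOver Zp by exact: polyOver_linear.
have yb : y = y' * b%:~R + a%:~R.
  by rewrite -ky mulrAC kb mul1r subrK.
have k0 : k != 0 by apply: contra_eq_neq kb => ->; rewrite mul0r eq_sym oner_eq0.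
have [d kd] := denominator_clear p_pr k.
have [e cvg0] : cvg (fun J => L (p%:R ^+ d *: (geom_poly y J \Po q)) -
     (p%:R ^+ d * k) * L (geom_poly y' J)) 0.
  apply: (@resolvent_cvg _ p_pr y' (p%:R ^+ d * k) (fun J => p%:R ^+ d *: (geom_poly y J \Po q))
    (fun J => - (p%:R ^+ d * k * (y^-1 / p%:R) ^+ J) *: q ^+ J)) => // J.
  - by rewrite polyOverZ ?rpredX ?zloc_nat // polyOver_comp ?geom_poly_over.
  - by rewrite polyOverZ ?rpredX // rpredN rpredM ?rpredX.
  have -> : y'%:P - 'X = k *: (y%:P - q).
    rewrite scalerBr scalerDr !scale_polyC scalerA kb scale1r yb opprD addrA -polyCB.
    by rewrite -mulrBr addrK mulrCA kb mulr1.
  rewrite -scalerAl -scalerAr geom_poly_comp // scalerA mulrC scalerBr alg_polyC.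
  congr (_ + _); rewrite -scaleNr scalerA scalerA; congr (_ *: _).
  rewrite [in RHS]exprMn [p%:R^-1 ^+ J]exprVn; move: (y^-1 ^+ J) (p%:R ^+ J) (expf_neq0 J p_neq0) => u v v0.
  by field.
exists (d + e)%N => J.
have := cvg0 J; rewrite linearZ /= !subr0 -[p%:R ^+ d * k * _]mulrA -mulrBr mulrA -exprD.
by rewrite addnC.
Qed.

(** The functional takes a rational value at [1 / (y - X)]. *)
Definition rational_value (y : rat) := exists a, cvg (fun J => L (geom_poly y J)) a.

(** The reflection [x |-> -1-x] preserves the functional and exchanges
    [1 / (y - X)] and [- 1 / (-1-y - X)]. *)
Lemma geom_reflect_cvg0 (y : rat) : y != 0 -> - 1 - y != 0 -> y^-1 / p%:R \in Zp ->
    (- 1 - y)^-1 / p%:R \in Zp ->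
  cvg (fun J => L (geom_poly y J) + L (geom_poly (- 1 - y) J)) 0.
Proof.
move=> y0 y'0 yp y'p.
have := @resolvent_comp_cvg y (- 1 - y) (- 1) (- 1) (- 1) y0 y'0 yp y'p.
move=> /(_ _ _)[||c cP]; [by rewrite mulN1r opprB rmorphN1|by rewrite rmorphN1 mulrNN mulr1|].
exists c => J; have := cP J; rewrite mulN1r opprK.
have -> : (-1)%:~R%:P + (-1)%:~R *: 'X = - 1 - 'X :> {poly rat}.
  by rewrite (_ : (-1)%:~R = -1 :> rat) // scaleN1r rmorphN1.
by rewrite volkenborn_reflect.
Qed.

Lemma rational_value_reflect (y : rat) : y != 0 -> - 1 - y != 0 -> y^-1 / p%:R \in Zp ->
  (- 1 - y)^-1 / p%:R \in Zp -> rational_value y -> rational_value (- 1 - y).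
Proof.
move=> y0 y'0 yp y'p [a ya]; exists (0 + (- 1) * a).
have := padic_cvgD (geom_reflect_cvg0 y0 y'0 yp y'p) (padic_cvgZ (- 1) ya).
by apply: eq_padic_cvg => J; rewrite mulN1r addrAC subrr add0r.
Qed.

Lemma padic_cvg_cst a : cvg (fun=> a) a.
Proof. by exists 0%N => J; rewrite subrr mulr0 mul0r rpred0. Qed.

Lemma padic_cvg_expr0 (y : rat) (z : nat -> rat) : y^-1 / p%:R \in Zp ->
  (forall J, z J \in Zp) -> cvg (fun J => y^-1 ^+ J * z J) 0.
Proof.
move=> yp zZ; exists 0%N => J; rewrite expr0 mul1r subr0.
have -> : y^-1 ^+ J * z J / p%:R ^+ J = (y^-1 / p%:R) ^+ J * z J.
  by rewrite exprMn [p%:R^-1 ^+ J]exprVn mulrAC.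
by rewrite rpredM ?rpredX.
Qed.

(** The values at y and [y + 1] differ by the derivative of [1 / (y + 1 - X)] at 0,
    which is the rational number [(y + 1) ^- 2]. *)
Lemma rational_value_shift (y : rat) : y != 0 -> y + 1 != 0 -> y^-1 / p%:R \in Zp ->
  (y + 1)^-1 / p%:R \in Zp -> rational_value y -> rational_value (y + 1).
Proof.
move=> y0 y'0 yp y'p [a ya].
pose q : {poly rat} := (-1)%:~R%:P + 1%:~R *: 'X.
have qE : q = 'X - 1 by rewrite /q (_ : (-1)%:~R = -1 :> rat) // scale1r addrC rmorphN1.
pose H J := geom_poly y J \Po q.
have H1 : cvg (fun J => L (H J) - 1 * L (geom_poly (y + 1) J)) 0.
  by apply: resolvent_comp_cvg => //; rewrite ?mulr1 // mul1r rmorphN1 opprK.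
have H2 J : L (geom_poly y J) - L (H J) = (H J)^`().[0].
  rewrite -volkenborn_diff linearB /= /H -comp_polyA qE.
  by rewrite comp_polyB comp_polyX comp_polyC addrK comp_polyXr.
have H3 J : (H J)^`().[0] =
    (y + 1) ^- 2 * (1 - y^-1 ^+ J * (-1) ^+ J) - (y + 1)^-1 * (y^-1 ^+ J * (J%:R * (-1) ^+ J.-1)).
  have e : ((y + 1)%:P - 'X) * H J = 1 - y^-1 ^+ J *: q ^+ J.
    by rewrite -geom_poly_comp // qE polyCD polyC1 opprB addrA /H qE.
  have := congr1 (fun f => f.[0]) e; have := congr1 (fun f => f^`().[0]) e.
  have d1 : 1^`() = 0 :> {poly rat} by rewrite -polyC1 derivC.
  rewrite derivM derivB derivC derivX sub0r mulN1r derivB d1 sub0r derivZ deriv_exp.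
  have -> : q^`() = 1 by rewrite qE derivB derivX d1 subr0.
  rewrite !hornerE /= qE.
  have -> : (('X - 1) ^+ J.-1 *+ J).[0] = J%:R * (-1) ^+ J.-1 :> rat.
    by rewrite hornerMn horner_exp hornerD hornerN hornerX -polyC1 hornerC sub0r mulr_natl.
  rewrite (_ : (-1)%:~R = -1 :> rat) // => h1 h2.
  have {}h2 : (H J).[0] = (1 - y^-1 ^+ J * (-1) ^+ J) / (y + 1).
    by rewrite -h2 mulrC mulKf.
  have {}h1 : (H J)^`().[0] = ((H J).[0] - y^-1 ^+ J * (J%:R * (-1) ^+ J.-1)) / (y + 1).
    suff <- : (y + 1) * (H J)^`().[0] = (H J).[0] - y^-1 ^+ J * (J%:R * (-1) ^+ J.-1).
      by rewrite mulrC mulKf.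
    by apply: (addrI (- (H J).[0])); rewrite h1 addKr.
  rewrite h1 h2; by field.
have H4 : cvg (fun J => (H J)^`().[0]) ((y + 1) ^- 2 * (1 + - 1 * 0) + - (y + 1)^-1 * 0).
  have z1 : cvg (fun J => y^-1 ^+ J * (-1) ^+ J) 0.
    by apply: padic_cvg_expr0 => // J; rewrite rpredX ?rpredN1.
  have z2 : cvg (fun J => y^-1 ^+ J * (J%:R * (-1) ^+ J.-1)) 0.
    by apply: padic_cvg_expr0 => // J; rewrite rpredM ?zloc_nat ?rpredX ?rpredN1.
  apply: eq_padic_cvg (padic_cvgD (padic_cvgZ _ (padic_cvgD (padic_cvg_cst 1) (padic_cvgZ (- 1) z1)))
     (padic_cvgZ (- (y + 1)^-1) z2)) => J.
  by rewrite H3 mulN1r mulNr.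
eexists; apply: eq_padic_cvg (padic_cvgD ya (padic_cvgD (padic_cvgZ (- 1) H4) (padic_cvgZ (- 1) H1))) => J.
by rewrite -H2; ring.
Qed.

End Padic.

(** * The alternating functional and polynomials in x(x+1) *)

Section ThetaFunctional.
Implicit Types f g h : {poly rat}.

(** The analogue of the functional for sums [f(x+1) + f(x)] in place of
    differences. *)
Definition volkenborn_alt f : rat := L f - L (f \Po ('X *+ 2 + 1)).

Fact volkenborn_alt_linear : linear_for *%R volkenborn_alt.
Proof.
move=> a f g; rewrite /volkenborn_alt comp_polyD comp_polyZ !linearP /=; ring.
Qed.

HB.instance Definition _ :=
  GRing.isLinear.Build rat {poly rat} rat *%R volkenborn_alt volkenborn_alt_linear.

Lemma volkenborn_alt_sum f : volkenborn_alt ((f \Po ('X + 1)) + f) = - f^`().[0].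
Proof.
have h1 : L (f \Po ('X + 1)) = f^`().[0] + L f.
  by rewrite -volkenborn_diff linearB subrK.
have h2 : L (f \Po ('X *+ 2 + 1 + 1)) = f^`().[0] *+ 2 + L (f \Po ('X *+ 2)).
  have := volkenborn_diff (f \Po ('X *+ 2)); rewrite linearB /= -comp_polyA.
  rewrite deriv_comp derivMn derivX hornerM horner_comp !hornerMn hornerX hornerC mul0rn mulr_natr.
  move=> /eqP; rewrite subr_eq => /eqP <-; congr (L (_ \Po _)).
  by rewrite raddfMn /= comp_polyX mulrnDl -addrA.
have h3 : L (f \Po ('X *+ 2 + 1)) = L f *+ 2 - L (f \Po ('X *+ 2)).
  by rewrite -(volkenborn_double f) [RHS]addrC addKr.
rewrite /volkenborn_alt comp_polyD -comp_polyA.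
have -> : ('X + 1) \Po ('X *+ 2 + 1) = 'X *+ 2 + 1 + 1 :> {poly rat}.
  by rewrite comp_polyD comp_polyX comp_polyC.
rewrite [L (_ + f)]linearD [L (_ + (_ \Po _))]linearD /= h1 h2 h3; ring.
Qed.

Definition quad : {poly rat} := 'X^2 + 'X.

Lemma quad_reflect : quad \Po (- 1 - 'X) = quad.
Proof. by rewrite /quad comp_polyD comp_Xn_poly comp_polyX; ring. Qed.

(** The alternating functional changes sign under the reflection [x |-> -1-x],
    which fixes [x(x+1)]. *)
Lemma volkenborn_alt_even h : volkenborn_alt (h \Po quad) = 0.
Proof.
rewrite /volkenborn_alt; set f := h \Po quad.
have fE : f \Po (- 1 - 'X) = f by rewrite -comp_polyA quad_reflect.
have h1 : L (f \Po ('X *+ 2)) = L (f \Po ('X *+ 2 + 1)).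
  rewrite -volkenborn_reflect -{1}fE -!comp_polyA; congr (L (_ \Po _)).
  rewrite raddfB /= rmorphN1 comp_polyX raddfMn /= comp_polyX; congr (_ \Po _); ring.
have := volkenborn_double f; rewrite h1 -!mulr2n => h2.
by apply/eqP; rewrite subr_eq0 -(eqr_pMn2r (n := 2)) // h2.
Qed.

(** As the alternating functional kills the polynomials in [z = x(x+1)], all of its
    information is in its values at their multiples by [2x+1]. *)
Definition theta h : rat := 2^-1 * volkenborn_alt (('X *+ 2 + 1) * (h \Po quad)).

Fact theta_linear : linear_for *%R theta.
Proof.
move=> a f g; rewrite /theta comp_polyD comp_polyZ.
have -> (q F G : {poly rat}) : q * (a *: F + G) = a *: (q * F) + q * G.
  by rewrite mulrDr scalerAr.
rewrite linearP /=; ring.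
Qed.

HB.instance Definition _ :=
  GRing.isLinear.Build rat {poly rat} rat *%R theta theta_linear.

(** In terms of x with [z = x(x+1)], the factors are [(x - i) (x + i + 1)]. *)
Definition quad_prod (k : nat) : {poly rat} := \prod_(i < k) ('X - (i * i.+1)%:R%:P).

Lemma quad_prodS k : quad_prod k.+1 = quad_prod k * ('X - (k * k.+1)%:R%:P).
Proof. by rewrite /quad_prod big_ord_recr. Qed.

Lemma quad_prodS_comp k : quad_prod k.+1 \Po quad =
  (quad_prod k \Po quad) * ('X - k%:R%:P) * ('X + k.+1%:R%:P).
Proof.
rewrite quad_prodS comp_polyM comp_polyB comp_polyX comp_polyC -mulrA; congr (_ * _).
by rewrite /quad natrM polyCM -natr1 polyCD; ring.
Qed.

Lemma quad_prod_shift k :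
  ((quad_prod k \Po quad) \Po ('X + 1)) * ('X + 1 - k%:R%:P) =
  (quad_prod k \Po quad) * ('X + k.+1%:R%:P).
Proof.
elim: k => [|k IHk].
  by rewrite /quad_prod big_ord0 !comp_polyC !mul1r subr0.
rewrite quad_prodS_comp !comp_polyM comp_polyB comp_polyD !comp_polyX !comp_polyC.
rewrite IHk -[k.+2%:R]natr1 -[k.+1%:R]natr1 !polyCD; ring.
Qed.

(** With [h = quad_prod k (x(x+1)) * (x - k)], the multiple of [quad_prod k] by
    [2x+1] is the sum [h(x+1) + h(x)]. *)
Lemma theta_quad_prod k : theta (quad_prod k) = - 2^-1 * ((-1) ^+ k * k`!%:R ^+ 2).
Proof.
pose h j := (quad_prod j \Po quad) * ('X - j%:R%:P).
have hS j : h j.+1 = h j * ('X^2 - (j.+1%:R ^+ 2)%:P).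
  by rewrite /h quad_prodS_comp -[j.+1%:R]natr1 !polyCD polyC_exp polyCD; ring.
have h0 j : (h j).[0] = 0.
  elim: j => [|j IHj]; last by rewrite hS hornerM IHj mul0r.
  by rewrite /h hornerM hornerXsubC subrr mulr0.
have dh j : (h j)^`().[0] = (-1) ^+ j * j`!%:R ^+ 2.
  elim: j => [|j IHj].
    by rewrite /h /quad_prod big_ord0 comp_polyC mul1r subr0 derivX hornerC.
  rewrite hS derivM hornerD (hornerM (h j)) (hornerM (h j)^`()) h0 mul0r addr0 IHj hornerD hornerN hornerC hornerXn.
  rewrite expr0n /= factS natrM sub0r [in RHS]exprS.
  have gen (a b c : rat) : a * b ^+ 2 * - c ^+ 2 = (-1 * a) * (c * b) ^+ 2 by ring.
  exact: gen.
have -> : theta (quad_prod k) = 2^-1 * volkenborn_alt ((h k \Po ('X + 1)) + h k).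
  rewrite /theta; congr (_ * volkenborn_alt _).
  rewrite {1}/h comp_polyM comp_polyB comp_polyX comp_polyC quad_prod_shift /h.
  by rewrite -[k.+1%:R]natr1 polyCD; ring.
by rewrite volkenborn_alt_sum dh mulrN mulNr.
Qed.
End ThetaFunctional.

(** * From x to x(x+1) at the point -1/3 *)

Section MinusThird.
Variable p3 : prime 3.
Local Notation Z3 := (zloc p3).
Variables y eta : rat.
Hypothesis yE : y = - 3%:R^-1.
Hypothesis etaE : eta = - (2%:R / 9%:R).

Lemma zloc3_half : 2%:R^-1 \in Z3.
Proof. exact: (@zlocV 3 p3 2). Qed.

Lemma eta_inv : eta^-1 / 3%:R = - (3%:R * 2%:R^-1).
Proof. by rewrite etaE; field. Qed.

Lemma zloc3_eta : eta^-1 / 3%:R \in Z3.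
Proof. by rewrite eta_inv rpredN rpredM ?zloc3_half ?zloc_nat. Qed.

Lemma zloc3_y : y^-1 / 3%:R \in Z3.
Proof. by rewrite yE (_ : _ / _ = -1) ?rpredN1 //; field. Qed.

Lemma quad_over : quad \is a polyOver Z3.
Proof. by rewrite /quad rpredD ?rpredX ?polyOverX. Qed.

(** The point [y = -1/3] is special in that [y - (-1-2x) = -2 (y - x)].  Since
    moreover [(y - x) (3x+2) = 3 (eta - z)], the function [K = (3x+2) / (eta - z)]
    is [3 / (y - x)] and its transform under [x |-> -1-2x] is [- (3/2) / (y - x)].
    The value of theta at [1 / (eta - z)] is a third of the difference of the
    values of L at these two functions. *)
Lemma theta_geom_cvg a : padic_cvg p3 (fun J => L (geom_poly y J)) a ->
  padic_cvg p3 (fun J => theta (geom_poly eta J)) (3%:R / 2%:R * a).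
Proof.
move=> ya.
pose E J : {poly rat} := geom_poly eta J \Po quad.
pose K J : {poly rat} := ('X *+ 3 + 2%:R) * E J.
pose q : {poly rat} := - 1 - 'X *+ 2.
have eta0 : eta != 0 by rewrite etaE.
have y0 : y != 0 by rewrite yE.
have EZ J : E J \is a polyOver Z3.
  by apply: polyOver_comp; [exact: geom_poly_over zloc3_eta|exact: quad_over].
have qZ : q \is a polyOver Z3 by rewrite rpredB ?rpredN1 ?rpredMn ?polyOverX.
have KZ J : K J \is a polyOver Z3.
  by apply: rpredM (EZ J); rewrite rpredD ?rpredMn ?rpred1 ?polyOverX.
have thetaE J : theta (geom_poly eta J) = 3%:R^-1 * (L (K J) - L (K J \Po q)).
  have -> : L (K J \Po q) = L (K J \Po ('X *+ 2 + 1)).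
    rewrite -[RHS]volkenborn_reflect -comp_polyA; congr (L (_ \Po _)).
    by rewrite raddfD raddfMn /= comp_polyX rmorph1 /q; ring.
  rewrite -[L (K J) - _]/(volkenborn_alt (K J)) /theta.
  have : K J *+ 2 = (('X *+ 2 + 1) * E J) *+ 3 + E J by rewrite /K; ring.
  move/(congr1 volkenborn_alt); rewrite [LHS]raddfMn [RHS]linearD /=.
  have -> : volkenborn_alt (E J) = 0 by exact: volkenborn_alt_even.
  rewrite addr0 raddfMn /= -/(E J).
  move=> uv; have -> : volkenborn_alt (K J) = (volkenborn_alt (K J) *+ 2) / 2%:R by field.
  by rewrite uv; field.
have e1 : eta%:P *+ 3 = y%:P *+ 2 :> {poly rat}.
  by rewrite -!polyCMn etaE yE; congr (_%:P); field.
have e2 : y%:P *+ 3 = - 1 :> {poly rat}.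
  by rewrite -polyCMn yE -polyC1 -polyCN; congr (_%:P); field.
have yK J : (y%:P - 'X) * K J = (1 - eta^-1 ^+ J *: quad ^+ J) *+ 3.
  rewrite -geom_poly_comp // -/(E J) /K mulrA -mulrnAl; congr (_ * _).
  have -> : (y%:P - 'X) * ('X *+ 3 + 2%:R) =
    'X * (y%:P *+ 3) + y%:P *+ 2 - ('X ^+ 2 *+ 3 + 'X *+ 2) by ring.
  by rewrite e2 -e1 /quad; ring.
have yKq J : (y%:P - 'X) * (K J \Po q) =
    (- (3%:R / 2%:R)) *: (1 - eta^-1 ^+ J *: (quad \Po q) ^+ J).
  have : y%:P - q = - ((y%:P - 'X) *+ 2).
    rewrite /q -[1 in LHS]opprK -e2; ring.
  have := congr1 (fun f => f \Po q) (yK J).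
  rewrite rmorphM rmorphB /= comp_polyC comp_polyX => + yq; rewrite yq.
  have -> : (1 - eta^-1 ^+ J *: quad ^+ J) *+ 3 \Po q =
      (1 - eta^-1 ^+ J *: (quad \Po q) ^+ J) *+ 3.
    rewrite (raddfMn (comp_poly q)) /= comp_polyB comp_polyZ (rmorphXn (comp_poly q)) /=.
    by rewrite -polyC1 comp_polyC.
  move: (_ - _ *: _) (K J \Po q) => u v uv.
  have -> : (y%:P - 'X) * v = (- 2%:R^-1) *: ((- ((y%:P - 'X) *+ 2)) * v).
    by rewrite mulNr scaleNr scalerN opprK -scaler_nat -scalerAl scalerA mulVf ?scale1r.
  by rewrite uv -scaler_nat scalerA mulNr [_^-1 * _]mulrC.
have pw J : 3%:R ^+ J * (eta^-1 / 3%:R) ^+ J = eta^-1 ^+ J.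
  by rewrite -exprMn mulrC divfK.
have H1 : padic_cvg p3 (fun J => L (K J) - 3%:R * L (geom_poly y J)) 0.
  apply: (@resolvent_cvg _ _ _ _ _ (fun J => - (3%:R * (eta^-1 / 3%:R) ^+ J) *: quad ^+ J) y0 zloc3_y KZ).
    move=> J; apply: polyOverZ; last by rewrite rpredX ?quad_over.
    by rewrite rpredN rpredM ?rpredX ?zloc3_eta ?zloc_nat.
  move=> J; rewrite yK mulrnBl scalerA mulrN mulrCA pw scaleNr polyCMn; congr (_ - _).
  by rewrite -[LHS]scaler_nat scalerA.
have H2 : padic_cvg p3 (fun J => L (K J \Po q) - (- (3%:R / 2%:R)) * L (geom_poly y J)) 0.
  apply: (@resolvent_cvg _ _ _ _ _ (fun J => (3%:R / 2%:R * (eta^-1 / 3%:R) ^+ J) *: (quad \Po q) ^+ J) y0 zloc3_y).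
  - by move=> J; apply: polyOver_comp.
  - move=> J; apply: polyOverZ; last by apply: rpredX; apply: polyOver_comp; first exact: quad_over.
    by rewrite rpredM ?rpredX ?zloc3_eta // rpredM ?zloc_nat ?zloc3_half.
  by move=> J; rewrite yKq scalerBr alg_polyC !scalerA [_ * (_ * _)]mulrCA pw mulNr scaleNr opprK.
have := padic_cvgD (padic_cvgZ 3%:R^-1 (padic_cvgD H1 (padic_cvgZ (- 1) H2))) (padic_cvgZ (3%:R / 2%:R) ya).
rewrite [X in padic_cvg _ _ X](_ : _ = 3%:R / 2%:R * a); last by ring.
apply: eq_padic_cvg => J.
by rewrite thetaE; field.
Qed.
End MinusThird.

(** * Padé approximation from a three-term recurrence *)

Section DiffQuot.
Variable eta : rat.
Implicit Types f g : {poly rat}.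

Definition diff_quot f : {poly rat} := (f - f.[eta]%:P) %/ ('X - eta%:P).

Lemma diff_quotP f : diff_quot f * ('X - eta%:P) = f - f.[eta]%:P.
Proof.
by rewrite /diff_quot divpK // dvdp_XsubCl rootE hornerD hornerN hornerC subrr.
Qed.

Lemma diff_quot_uniq f g : g * ('X - eta%:P) = f - f.[eta]%:P -> diff_quot f = g.
Proof.
have nz : 'X - eta%:P != 0 by rewrite polyXsubC_eq0.
by rewrite -diff_quotP => /(mulIf nz) ->.
Qed.

Fact diff_quot_linear : linear diff_quot.
Proof.
move=> a f g; apply: diff_quot_uniq.
rewrite mulrDl -scalerAl !diff_quotP hornerD hornerZ polyCD polyCM -!mul_polyC.
ring.
Qed.

HB.instance Definition _ :=
  GRing.isLinear.Build rat {poly rat} {poly rat} *:%R diff_quot diff_quot_linear.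

Lemma size_diff_quot f n : (size f <= n.+1)%N -> (size (diff_quot f) <= n)%N.
Proof.
move=> fn; rewrite /diff_quot size_divp ?polyXsubC_eq0 // size_XsubC leq_subLR add1n.
rewrite (leq_trans (size_polyD _ _)) // geq_max fn size_polyN.
by rewrite (leq_trans (size_polyC_leq1 _)).
Qed.

End DiffQuot.

Section Pade.
Variables (p : nat) (p_pr : prime p).
Variables (V : {scalar {poly rat}}) (eta : rat) (f h : nat -> {poly rat}).
Variables (b g : nat -> rat) (eps : rat).
Local Notation Zp := (zloc p_pr).
Local Notation dq := (diff_quot eta).

Hypothesis f0 : f 0%N = 1.
Hypothesis f_rec : forall n, n.+1%:R ^+ 2 *: f n.+1 =
  b n *: f n + g n *: ('X * f n) + (eps * n%:R ^+ 2) *: f n.-1.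
Hypothesis g_neq0 : forall n, g n != 0.
Hypothesis eps_neq0 : eps != 0.
Hypothesis V_f : forall n, V (f n.+1) = 0.
Hypothesis V1_neq0 : V 1 != 0.

Lemma V_f_Xn n j : (j < n)%N -> V ('X^j * f n) = 0.
Proof.
elim: j n => [|j IHj] [//|n]; first by rewrite mul1r V_f.
rewrite ltnS => jn; have := congr1 (fun q => V ('X^j * q)) (f_rec n.+1).
rewrite !mulrDr -!scalerAr !linearD !linearZ /= mulrA -exprSr.
rewrite (IHj n.+2) ?(ltn_trans jn) // (IHj n.+1) ?(ltn_trans jn) // IHj //.
rewrite !mulr0 add0r addr0 => /esym/eqP.
by rewrite mulf_eq0 (negPf (g_neq0 _)) /= => /eqP.
Qed.

(** The three-term recurrence makes each [f n] orthogonal to all polynomials of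
    smaller degree; this is the easy half of Favard's theorem. *)
Lemma V_f_orth n (q : {poly rat}) : (size q <= n)%N -> V (f n * q) = 0.
Proof.
move=> qn; rewrite -[q]coefK poly_def mulr_sumr linear_sum big1 //= => i _.
rewrite -scalerAr linearZ /= mulrC [_ * 'X^i]mulrC V_f_Xn ?mul0r //.
exact: leq_trans qn.
Qed.

Definition pade_den n : rat := (f n).[eta].
Definition pade_num n : rat := V (dq (f n)).

Lemma pade_den_rec n : n.+1%:R ^+ 2 * pade_den n.+1 =
  (b n + g n * eta) * pade_den n + eps * n%:R ^+ 2 * pade_den n.-1.
Proof.
have := congr1 (fun q => q.[eta]) (f_rec n).
by rewrite !hornerE /= -/(pade_den n) -/(pade_den n.+1) -/(pade_den n.-1) => ->; ring.
Qed.

Lemma diff_quot_mulX (q : {poly rat}) : dq ('X * q) = q + eta *: dq q.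
Proof.
apply: diff_quot_uniq; rewrite mulrDl -scalerAl diff_quotP hornerM hornerX polyCM.
by rewrite -mul_polyC; ring.
Qed.

Lemma pade_num_rec n : n.+2%:R ^+ 2 * pade_num n.+2 =
  (b n.+1 + g n.+1 * eta) * pade_num n.+1 + eps * n.+1%:R ^+ 2 * pade_num n.
Proof.
have := congr1 (fun q => V (dq q)) (f_rec n.+1).
rewrite !linearD !linearZ /= diff_quot_mulX linearD linearZ /= V_f add0r.
rewrite -/(pade_num n.+1) -/(pade_num n.+2) -/(pade_num n) => ->; ring.
Qed.

Lemma diff_quot1 : dq 1 = 0.
Proof. by apply: diff_quot_uniq; rewrite mul0r hornerC subrr. Qed.

Lemma pade_num0 : pade_num 0 = 0.
Proof. by rewrite /pade_num f0 diff_quot1 linear0. Qed.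

Lemma pade_num1 : pade_num 1 = g 0 * V 1.
Proof.
have := congr1 (fun q => V (dq q)) (f_rec 0).
rewrite f0 expr1n scale1r expr0n mulr0 scale0r addr0 mulr1 !linearD !linearZ /=.
have := diff_quot_mulX 1; rewrite mulr1 => ->.
by rewrite diff_quot1 linear0 mulr0 add0r scaler0 addr0.
Qed.

(** Two solutions of a linear recurrence with nonzero coefficients that are
    independent at the start remain so; hence two consecutive remainders never
    vanish together, whatever the limit is. *)
Lemma casoratian_neq0 n :
  pade_den n * pade_num n.+1 - pade_den n.+1 * pade_num n != 0.
Proof.
elim: n => [|n IHn].
  by rewrite pade_num0 mulr0 subr0 /pade_den f0 hornerC mul1r pade_num1 mulf_neq0.
apply: contraNneq IHn => /(congr1 (fun x => n.+2%:R ^+ 2 * x)).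
rewrite mulr0 mulrBr mulrCA pade_num_rec [X in _ - X]mulrA pade_den_rec /= => e.
have : eps * n.+1%:R ^+ 2 *
  (pade_den n * pade_num n.+1 - pade_den n.+1 * pade_num n) = 0.
  by rewrite -[RHS]oppr0 -e; ring.
by move/eqP; rewrite mulf_eq0 mulf_eq0 (negPf eps_neq0) expf_eq0 pnatr_eq0.
Qed.

Hypothesis eta_neq0 : eta != 0.
Hypothesis eta_p : eta^-1 / p%:R \in Zp.
Hypothesis size_h : forall n, (size (h n) <= n.+1)%N.
(* The value of V at [1 / (eta - X)] is supposed to be the rational number a. *)
Variable a : rat.
Hypothesis V_geom : padic_cvg p_pr (fun J => V (geom_poly eta J)) a.
Hypothesis V_integral : forall q : {poly rat}, q \is a polyOver Zp -> p%:R * V q \in Zp.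

Definition pade_rem n : rat := pade_den n * a - pade_num n.

Let p_neq0 : p%:R != 0 :> rat.
Proof. by rewrite pnatr_eq0 -lt0n prime_gt0. Qed.

Lemma pade_rem_neq0 n : (pade_rem n != 0) || (pade_rem n.+1 != 0).
Proof.
rewrite -negb_and; apply: contra (casoratian_neq0 n) => /andP[/eqP r0 /eqP r1].
have -> : pade_num n = pade_den n * a by apply/esym/eqP; rewrite -subr_eq0 -/(pade_rem n) r0.
have -> : pade_num n.+1 = pade_den n.+1 * a.
  by apply/esym/eqP; rewrite -subr_eq0 -/(pade_rem n.+1) r1.
by rewrite mulrCA mulrA mulrAC -mulrA [a * _]mulrC mulrA subrr.
Qed.

Lemma poly_denominator_clear (q : {poly rat}) : exists c, p%:R ^+ c *: q \is a polyOver Zp.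
Proof.
elim/poly_monomial_ind: q => [|k q r [c qc] [d rd]|n].
- by exists 0%N; rewrite scaler0 rpred0.
- have [e ke] := denominator_clear p_pr k; exists (c + d + e)%N.
  rewrite scalerDr; apply: rpredD.
    have -> : p%:R ^+ (c + d + e) *: (k *: q) = (p%:R ^+ d * (p%:R ^+ e * k)) *: (p%:R ^+ c *: q).
      by rewrite !scalerA; congr (_ *: _); rewrite !exprD; ring.
    by apply: polyOverZ qc; rewrite rpredM ?rpredX ?zloc_nat.
  have -> : p%:R ^+ (c + d + e) *: r = (p%:R ^+ c * p%:R ^+ e) *: (p%:R ^+ d *: r).
    by rewrite !scalerA; congr (_ *: _); rewrite !exprD; ring.
  by apply: polyOverZ rd; rewrite rpredM ?rpredX ?zloc_nat.
by exists 0%N; rewrite expr0 scale1r rpredX ?polyOverX.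
Qed.

Lemma V_tail_cvg (T : {poly rat}) : padic_cvg p_pr (fun J => eta^-1 ^+ J * V ('X^J * T)) 0.
Proof.
have [c Tc] := poly_denominator_clear T; exists c.+1 => J; rewrite subr0.
have -> : p%:R ^+ c.+1 * (eta^-1 ^+ J * V ('X^J * T)) / p%:R ^+ J =
    (eta^-1 / p%:R) ^+ J * (p%:R * V ('X^J * (p%:R ^+ c *: T))).
  rewrite -scalerAr linearZ /= exprMn [p%:R^-1 ^+ J]exprVn exprS; ring.
rewrite rpredM ?rpredX // V_integral //; apply: rpredM Tc.
by rewrite rpredX ?polyOverX.
Qed.

(** By orthogonality, [f n * h n / (eta - X)] and [h n (eta) * f n / (eta - X)]
    have the same image under V; the first one is p-adically as small as the
    integrality of [f n * h n] permits. *)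
Lemma pade_rem_cvg n :
  padic_cvg p_pr (fun J => V (f n * h n * geom_poly eta J)) ((h n).[eta] * pade_rem n).
Proof.
pose hn := (h n).[eta]; pose T := f n * dq (h n) + hn *: dq (f n).
have e J : V (f n * h n * geom_poly eta J) =
    hn * pade_den n * V (geom_poly eta J) + - (hn * pade_num n) + eta^-1 ^+ J * V ('X^J * T).
  pose t := eta^-1 ^+ J *: 'X^J : {poly rat}.
  have G : ('X - eta%:P) * geom_poly eta J = t - 1.
    by rewrite -opprB mulNr geom_polyP // opprB.
  have split_at (q : {poly rat}) : q * geom_poly eta J = q.[eta] *: geom_poly eta J + dq q * t - dq q.
    rewrite -[q in LHS](subrK q.[eta]%:P) -diff_quotP mulrDl -mulrA G -mul_polyC; ring.
  rewrite -mulrA split_at mulrBr mulrDr linearB linearD /= (V_f_orth (q := dq (h n))) ?size_diff_quot // subr0.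
  rewrite -[f n * (_ *: _)]scalerAr linearZ /= split_at linearB linearD linearZ /=.
  rewrite -/(pade_den n) -/(pade_num n) -/hn.
  have -> : eta^-1 ^+ J * V ('X^J * T) = V (f n * (dq (h n) * t)) + hn * V (dq (f n) * t).
    rewrite -!linearZ -linearD /=; congr (V _).
    by rewrite /T /t -!mul_polyC; ring.
  ring.
have := padic_cvgD (padic_cvgD (padic_cvgZ (hn * pade_den n) V_geom)
  (padic_cvg_cst p_pr (- (hn * pade_num n)))) (V_tail_cvg T).
rewrite [X in padic_cvg _ _ X](_ : _ = hn * pade_rem n); last by rewrite /pade_rem; ring.
by apply: eq_padic_cvg => J; rewrite e.
Qed.

Lemma padic_cvg_integral u (x : rat) e : padic_cvg p_pr u x ->
  (forall J, p%:R ^+ e * u J \in Zp) -> p%:R ^+ e * x \in Zp.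
Proof.
move=> [c uc] uZ; have := uc c; rewrite mulrAC divff ?expf_neq0 // mul1r => ux.
have -> : p%:R ^+ e * x = p%:R ^+ e * u c - p%:R ^+ e * (u c - x) by ring.
by rewrite rpredB // rpredM ?rpredX ?zloc_nat.
Qed.

Variable C : nat.
Hypothesis V_fhX : forall n j, exists2 e, (p ^ e <= C * (n + j).+1)%N &
  p%:R ^+ e * V (f n * h n * 'X^j) \in Zp.

(** The j-th term of the geometric series is divisible by [p ^ (j+1)], which
    outweighs the growth with j of the denominator of [V (f n * h n * X^j)]; what
    remains is the denominator for j = 0, up to a constant. *)
Lemma pade_rem_integral n : exists2 e, (p ^ e <= C * n.+1)%N &
  p%:R ^+ e * ((h n).[eta] * pade_rem n) \in Zp.
Proof.
have C0 : (0 < C)%N.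
  have [e + _] := V_fhX 0 0; case: C => //; rewrite mul0n leqNgt expn_gt0 prime_gt0 //.
have p1 := prime_gt1 p_pr.
pose e := trunc_log p (C * n.+1).
exists e; first by rewrite trunc_logP // muln_gt0 C0.
apply: padic_cvg_integral (pade_rem_cvg n) _ => J.
rewrite /geom_poly mulr_sumr linear_sum mulr_sumr rpred_sum //= => j _.
rewrite -scalerAr linearZ /=; have [e' e'C e'Z] := V_fhX n j.
have le_e : (e' <= e + j.+1)%N.
  rewrite -ltnS -(ltn_exp2l _ _ p1); apply: leq_ltn_trans e'C _.
  apply: (@leq_ltn_trans (C * n.+1 * j.+1)).
    by rewrite -mulnA leq_mul2l; apply/orP; right; nia.
  rewrite -addSn expnD; apply: ltn_mul; first exact: trunc_log_ltn.
  exact: ltn_expl.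
have -> : p%:R ^+ e * (eta^-1 ^+ j.+1 * V (f n * h n * 'X^j)) =
   (eta^-1 / p%:R) ^+ j.+1 * (p%:R ^+ (e + j.+1 - e') * (p%:R ^+ e' * V (f n * h n * 'X^j))).
  rewrite [X in _ = _ * X]mulrA -exprD subnK // exprD exprMn [p%:R^-1 ^+ _]exprVn.
  move: (p%:R ^+ j.+1) (expf_neq0 j.+1 p_neq0) => u u0; by field.
by rewrite rpredM ?rpredX // rpredM ?rpredX ?zloc_nat.
Qed.

(* [D n] is a common denominator of the approximants, and [k n] measures the p-adic
   gain: [p ^ k n] divides [D n / h n (eta)]. *)
Variables (M k : nat -> nat) (c0 : nat).
Local Notation D n := (c0 * lcm_upto n ^ 2 * M n)%N.
Hypothesis den_int : forall n, (D n)%:R * pade_den n \is a Num.int.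
Hypothesis num_int : forall n, (D n)%:R * pade_num n \is a Num.int.
Hypothesis h_neq0 : forall n, (h n).[eta] != 0.
Hypothesis h_padic : forall n, (D n)%:R / (h n).[eta] / p%:R ^+ k n \in Zp.

Hypothesis c0_gt0 : (0 < c0)%N.
Hypothesis M_gt0 : forall n, (0 < M n)%N.

(** If the limit is a rational number a, then [denq a * D n * pade_rem n] is a
    nonzero integer that [p ^ k n] divides up to a factor at most [C * (n+1)]. *)
Lemma pade_rem_lower n : pade_rem n != 0 ->
  p%:R ^+ k n <= `|denq a|%N%:R * (C * n.+1)%:R * ((D n)%:R * `|pade_rem n|) :> rat.
Proof.
move=> rn0; have [e eC eZ] := pade_rem_integral n.
pose B := `|denq a|%N; have B0 : (0 < B)%N by rewrite absz_gt0 denq_neq0.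
have D0 : (0 < D n)%N by rewrite !muln_gt0 c0_gt0 M_gt0 ?expn_gt0 lcm_upto_gt0.
have aB : a * B%:R = (numq a)%:~R.
  by rewrite numqE /B -[in RHS](gez0_abs (ltW (denq_gt0 a))).
have /intrP[m mE] : B%:R * ((D n)%:R * pade_rem n) \is a Num.int.
  have -> : B%:R * ((D n)%:R * pade_rem n) =
      (numq a)%:~R * ((D n)%:R * pade_den n) - B%:R * ((D n)%:R * pade_num n).
    by rewrite -aB /pade_rem; ring.
  by apply: rpredB; apply: rpredM => //; [exact: intr_int|exact: natr_int].
have m0 : m != 0.
  apply: contraNneq rn0 => m0; move: mE; rewrite m0 => /eqP.
  by rewrite !mulf_eq0 !pnatr_eq0 (gtn_eqF B0) (gtn_eqF D0).
have : (m * p%:Z ^+ e)%:~R / p%:R ^+ k n \in Zp.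
  have -> : (m * p%:Z ^+ e)%:~R / p%:R ^+ k n =
     B%:R * ((D n)%:R / (h n).[eta] / p%:R ^+ k n) * (p%:R ^+ e * ((h n).[eta] * pade_rem n)).
    rewrite rmorphM rmorphXn /= -mE -pmulrn.
    move: (p%:R ^+ k n) (expf_neq0 (k n) p_neq0) => u u0.
    by field; rewrite ?h_neq0 ?u0.
  by rewrite rpredM // rpredM ?zloc_nat.
move=> /zloc_dvd_int; rewrite abszM abszX absz_nat => /dvdn_leq.
rewrite muln_gt0 absz_gt0 m0 expn_gt0 prime_gt0 // => /(_ isT) le_k.
apply: (@le_trans _ _ ((C * n.+1)%:R * (`|m|%N)%:R)); last first.
  have -> : `|m|%N%:R = B%:R * ((D n)%:R * `|pade_rem n|) :> rat.
    by rewrite natr_absz intr_norm -mE !normrM !normr_nat.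
  by rewrite mulrCA mulrA.
rewrite -natrX -natrM ler_nat (leq_trans le_k) // mulnC leq_mul2r eC.
by rewrite orbT.
Qed.

(* E and A are slightly larger than [e^2], Y is the growth rate of [p ^ k n / M n], and
   delta absorbs the subexponential factors. *)
Variables (E A Y c1 delta : rat) (k0 : nat).
Hypothesis delta_gt0 : 0 < delta.
Hypothesis c1_gt0 : 0 < c1.
Hypothesis k0_gt0 : (0 < k0)%N.
Hypothesis E_ge : ((1 + k0%:R^-1) ^+ k0.+1) ^+ 2 <= E.
Hypothesis E_lt : E < A.
Hypothesis A_le : A * (1 + delta) ^+ 2 <= Y.
Hypothesis Y_le : forall n, c1 * Y ^+ n * (M n)%:R <= p%:R ^+ k n.
Hypothesis growth : exists K, forall n,
  `|pade_den n| <= K * (1 + delta) ^+ n /\ `|pade_num n| <= K * (1 + delta) ^+ n.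

(** The remainders are of subexponential real size, so the preceding lower bound
    gives [Y ^ n <= K (1 + delta)^(2n) lcm(1..n)^2] for one of any two consecutive
    n, against Chebyshev's bound. *)
Theorem pade_contradiction : False.
Proof.
have [K Kgrowth] := growth.
have K0 : 0 <= K.
  have [+ _] := Kgrowth 0%N; rewrite expr0 mulr1; apply: le_trans; exact: normr_ge0.
have d1 : 0 < 1 + delta by rewrite addr_gt0.
have A0 : 0 < A.
  apply: le_lt_trans E_lt; apply: le_trans E_ge.
  by rewrite exprn_even_ge0.
have Y0 : 0 < Y by apply: lt_le_trans A_le; rewrite mulr_gt0 // exprn_gt0.
pose K1 := `|denq a|%N%:R * C%:R * c0%:R * (K * (`|a| + 1)) / delta / c1.
have bound n : pade_rem n != 0 ->
    Y ^+ n <= K1 * (1 + delta) * (lcm_upto n)%:R ^+ 2 * (1 + delta) ^+ (2 * n).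
  move=> rn0; have := le_trans (Y_le n) (pade_rem_lower rn0).
  have rem_le : `|pade_rem n| <= K * (`|a| + 1) * (1 + delta) ^+ n.
    rewrite /pade_rem (le_trans (ler_normB _ _)) // normrM.
    have [qn pn] := Kgrowth n.
    have -> : K * (`|a| + 1) * (1 + delta) ^+ n =
       K * (1 + delta) ^+ n * `|a| + K * (1 + delta) ^+ n by ring.
    by rewrite lerD // ler_wpM2r.
  have n_le : n.+1%:R <= (1 + delta) / delta * (1 + delta) ^+ n.
    rewrite mulrAC ler_pdivlMr // -exprS.
    apply: le_trans (exprn_one_add n.+1 (ltW delta_gt0)).
    by rewrite mulrC mulr_natr lerDr.
  have M0 : 0 < (M n)%:R :> rat by rewrite ltr0n.
  move=> le1; have {le1} : c1 * Y ^+ n * (M n)%:R <=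
     `|denq a|%N%:R * (C%:R * ((1 + delta) / delta * (1 + delta) ^+ n)) *
     ((D n)%:R * (K * (`|a| + 1) * (1 + delta) ^+ n)).
    apply: le_trans le1 _; apply: ler_pM; rewrite ?mulr_ge0 ?ler0n //.
      by rewrite ler_wpM2l ?ler0n // natrM ler_wpM2l ?ler0n.
    by rewrite ler_wpM2l ?ler0n.
  rewrite mulrAC [X in _ <= X](_ : _ = c1 * (M n)%:R *
     (K1 * (1 + delta) * (lcm_upto n)%:R ^+ 2 * (1 + delta) ^+ (2 * n))).
    by rewrite ler_pM2l // mulr_gt0.
  rewrite !natrM mulnC exprM /K1; move: ((1 + delta) ^+ n) => w.
  by field; rewrite ?(gt_eqF delta_gt0) ?(gt_eqF c1_gt0).
have K10 : 0 <= K1.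
  by rewrite /K1 !mulr_ge0 ?ler0n ?invr_ge0 ?(ltW delta_gt0) ?(ltW c1_gt0) ?addr_ge0.
clearbody K1.
pose c := (K1 * (1 + delta) * Y + 1)^-1.
have c_gt0 : 0 < c.
  by rewrite invr_gt0 ltr_wpDl // mulr_ge0 ?(ltW Y0) // mulr_ge0 ?(ltW d1).
have Y1 : 1 <= Y.
  apply: le_trans A_le; apply: (@le_trans _ _ A).
    apply: le_trans (ltW E_lt); apply: le_trans E_ge.
    by rewrite -exprM exprn_ege1 // lerDl invr_ge0 ler0n.
  by rewrite ler_peMr ?(ltW A0) // exprn_ege1 // lerDl ltW.
apply: (lcm_upto_sq_not_geq k0_gt0 E_ge E_lt c_gt0) => m m_gt0.
(* A nonzero remainder of index m-1 or m serves for m, at the cost of a factor Y. *)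
have [n nm rn0] : exists2 n, (m.-1 <= n <= m)%N & pade_rem n != 0.
  have /orP[r|r] := pade_rem_neq0 m.-1; [exists m.-1|exists m] => //.
  - by rewrite leqnn leq_pred.
  - by rewrite leq_pred leqnn.
  - by rewrite prednK in r.
have key : Y ^+ m.-1 <= K1 * (1 + delta) * (lcm_upto m)%:R ^+ 2 * (1 + delta) ^+ (2 * m).
  have /andP[mn n_m] := nm.
  apply: le_trans (ler_weXn2l Y1 mn) _; apply: le_trans (bound n rn0) _.
  apply: ler_pM; rewrite ?mulr_ge0 ?exprn_ge0 ?(ltW d1) ?ler0n //.
    rewrite ler_wpM2l ?mulr_ge0 ?(ltW d1) // lerXn2r ?nnegrE ?ler0n // ler_nat.
    exact: leq_lcm_upto.
  by rewrite ler_weXn2l ?lerDl ?(ltW delta_gt0) // leq_mul2l.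
rewrite /c mulrC ler_pdivrMr; last by rewrite -invr_gt0.
rewrite -(ler_pM2r (exprn_gt0 (2 * m) d1)) [(1 + delta) ^+ (2 * m)]exprM -exprMn.
apply: (@le_trans _ _ (Y ^+ m)).
  rewrite lerXn2r ?nnegrE ?(ltW Y0) // mulr_ge0 ?exprn_ge0 ?(ltW d1) ?(ltW A0) //.
rewrite -(prednK m_gt0) exprS prednK // -[(1 + delta) ^+ 2 ^+ m]exprM.
apply: (@le_trans _ _ (Y * (K1 * (1 + delta) * (lcm_upto m)%:R ^+ 2 * (1 + delta) ^+ (2 * m)))).
  by rewrite ler_wpM2l ?(ltW Y0).
rewrite mulrA ler_wpM2r ?exprn_ge0 ?(ltW d1) //.
rewrite [X in X <= _](_ : _ = K1 * (1 + delta) * Y * (lcm_upto m)%:R ^+ 2); last by ring.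
by rewrite [leRHS]mulrC ler_wpM2r ?exprn_ge0 ?ler0n // lerDl.
Qed.

End Pade.

(** * Touchard polynomials *)

Section Touchard.
Definition touchard_coef (n k : nat) : nat := ('C(n, k) * 'C(n + k, k))%N.
Local Notation a := touchard_coef.

Lemma touchard_coef_small n k : (n < k)%N -> a n k = 0%N.
Proof. by move=> nk; rewrite /a bin_small. Qed.

Lemma touchard_coefSl n k : (a n.+1 k * (n.+1 - k) = a n k * (n.+1 + k))%N.
Proof.
have e1 := mul_bin_down n.+1 k; have e2 := mul_bin_down (n.+1 + k) k.
rewrite addnK in e2; rewrite /touchard_coef; move: e1 e2 => /=.
move: 'C(n, k) 'C(n.+1, k) 'C(n + k, k) 'C(n.+1 + k, k) (n.+1 - k)%N => x x' y y' d e1 e2.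
have h1 : (n.+1 * x * y' = d * x' * y')%N by rewrite e1.
have h2 : (x * ((n.+1 + k) * y) = x * (n.+1 * y'))%N by rewrite e2.
nia.
Qed.

Lemma touchard_coefSr n k : (a n k.+1 * k.+1 ^ 2 = a n k * ((n - k) * (n + k.+1)))%N.
Proof.
have e1 := mul_bin_left n k; have e2 := mul_bin_diag (n + k.+1) k.
rewrite addnS /= in e2; rewrite /touchard_coef addnS; move: e1 e2.
move: 'C(n, k) 'C(n, k.+1) 'C(n + k, k) 'C((n + k).+1, k.+1) (n - k)%N => x x' y y' d e1 e2.
have h1 : (k.+1 * x' * (k.+1 * y') = d * x * (k.+1 * y'))%N by rewrite e1.
have h2 : (d * x * ((n + k).+1 * y) = d * x * (k.+1 * y'))%N by rewrite e2.
nia.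
Qed.

Definition touchard (n : nat) : {poly rat} := \sum_(k < n.+1) (a n k)%:R *: binom_poly k.

Lemma touchardE n N : (n < N)%N -> touchard n = \sum_(k < N) (a n k)%:R *: binom_poly k.
Proof.
move=> nN; rewrite /touchard (big_ord_widen N (fun k => (a n k)%:R *: binom_poly k)) //.
rewrite big_mkcond; apply: eq_bigr => k _ /=.
by case: ltnP => // nk; rewrite touchard_coef_small ?scale0r.
Qed.

Lemma binom_poly0 : binom_poly 0 = 1.
Proof. by rewrite /binom_poly /ffact_poly big_ord0 invr1 scale1r. Qed.

Lemma binom_polyS k : k.+1%:R *: binom_poly k.+1 = binom_poly k * ('X - k%:R%:P).
Proof.
rewrite /binom_poly ffact_polyS factS natrM invfM scalerA mulrA divff ?mul1r ?scalerAl //.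
Qed.

Lemma mulX_binom_poly k :
  'X * binom_poly k = k.+1%:R *: binom_poly k.+1 + k%:R *: binom_poly k.
Proof. by rewrite binom_polyS -mul_polyC; ring. Qed.

Lemma touchard0 : touchard 0 = 1.
Proof. by rewrite /touchard big_ord1 binom_poly0 /a !bin0 scale1r. Qed.

(** The contiguity relations express all the coefficients in this identity through
    a single one, and it becomes an identity between rational functions of n
    and k. *)
Lemma touchard_coef_rec n k :
  n.+1%:R ^+ 2 * (a n.+1 k)%:R =
  (2 * n + 1)%:R * ((2 * k + 1)%:R * (a n k)%:R + 2%:R * k%:R * (a n k.-1)%:R) +
  n%:R ^+ 2 * (a n.-1 k)%:R :> rat.
Proof.
case: (ltngtP k n.+1) => [|nk|->].
- rewrite ltnS => kn.
  have e1 : (a n.+1 k)%:R = (a n k)%:R * (n%:R + 1 + k%:R) / (n%:R + 1 - k%:R) :> rat.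
    have nz : n%:R + 1 - k%:R != 0 :> rat.
      by rewrite natr1 -natrB ?(leqW kn) // pnatr_eq0 subn_eq0 -ltnNge.
    apply/(mulIf nz); rewrite divfK // !natr1 -natrD -natrB ?(leqW kn) //.
    by rewrite -!natrM touchard_coefSl.
  have e2 : n%:R ^+ 2 * (a n.-1 k)%:R =
      n%:R ^+ 2 * ((a n k)%:R * (n%:R - k%:R) / (n%:R + k%:R)) :> rat.
    case: n kn {e1} => [|n] kn; first by rewrite expr0n !mul0r.
    congr (_ * _).
    have nz : n.+1%:R + k%:R != 0 :> rat by rewrite -natrD pnatr_eq0.
    apply/(mulIf nz); rewrite divfK // -natrB // -natrD -!natrM.
    by rewrite touchard_coefSl.
  rewrite e1 e2; case: k kn {e1 e2} => [|k] kn.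
    case: n kn => [|n] kn; first by apply/eqP; vm_compute.
    rewrite mulr0 mul0r; field; have n0 := ler0n rat n.
    by apply/andP; split; rewrite gt_eqF //; lra.
  have e3 : (a n k)%:R * ((n%:R - k%:R) * (n%:R + k%:R + 1)) = (a n k.+1)%:R * (k%:R + 1) ^+ 2 :> rat.
    rewrite -natrB ?(ltnW kn) // -natrD !natr1 -natrX -!natrM touchard_coefSr.
    by rewrite addnS.
  have nz1 : n%:R - k%:R != 0 :> rat by rewrite -natrB ?(ltnW kn) // pnatr_eq0 subn_eq0 -ltnNge.
  have nz2 : n%:R + k%:R + 1 != 0 :> rat by rewrite -natrD natr1 pnatr_eq0.
  have {}e3 : (a n k)%:R = (a n k.+1)%:R * (k%:R + 1) ^+ 2 / ((n%:R - k%:R) * (n%:R + k%:R + 1)) :> rat.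
    by rewrite -e3 mulfK // mulf_neq0.
  rewrite /= e3; field.
  by rewrite nz1 andbT addrA addrAC.
- by rewrite !touchard_coef_small; [ring|lia..].
- rewrite [a n n.+1]touchard_coef_small // [a n.-1 n.+1]touchard_coef_small /=; last by lia.
  have e1 := touchard_coefSr n.+1 n; have e2 := touchard_coefSl n n.
  rewrite subSnn muln1 in e2; rewrite subSnn mul1n e2 in e1.
  have -> : n.+1%:R ^+ 2 * (a n.+1 n.+1)%:R = (a n n * (n.+1 + n) * (n.+1 + n.+1))%:R :> rat.
    by rewrite -e1 !natrM ?natrX; ring.
  by rewrite !natrM; ring.
Qed.

Lemma touchard_rec n : n.+1%:R ^+ 2 *: touchard n.+1 =
  (2 * n + 1)%:R *: touchard n + (2 * (2 * n + 1))%:R *: ('X * touchard n) +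
  (1 * n%:R ^+ 2) *: touchard n.-1.
Proof.
rewrite (@touchardE n n.+2) // (@touchardE n.+1 n.+2) // (@touchardE n.-1 n.+2) ?ltnS ?(leq_trans (leq_pred n)) //.
have -> : 'X * \sum_(k < n.+2) (a n k)%:R *: binom_poly k =
   \sum_(k < n.+2) (k%:R * ((a n k.-1)%:R + (a n k)%:R)) *: binom_poly k.
  under [RHS]eq_bigr do rewrite mulrDr scalerDl.
  rewrite big_split /= [X in _ = X + _]big_ord_recl mul0r scale0r add0r.
  rewrite big_distrr /= big_ord_recr /= touchard_coef_small // scale0r mulr0 addr0.
  rewrite [X in _ = _ + X]big_ord_recr /= touchard_coef_small // mulr0 scale0r addr0.
  rewrite -big_split; apply: eq_bigr => k _ /=.
  rewrite -scalerAr mulX_binom_poly scalerDr !scalerA /bump /= add1n.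
  by rewrite add0n [_ * k.+1%:R]mulrC [_ * k%:R]mulrC.
rewrite !scaler_sumr -!big_split /=; apply: eq_bigr => k _.
rewrite !scalerA -!scalerDl; congr (_ *: _).
rewrite -!mulrDl; congr (_ / _); rewrite touchard_coef_rec natrM; ring.
Qed.

(** The partial sums have a closed form, as Gosper's algorithm shows; it vanishes
    once m exceeds n. *)
Lemma touchard_alternating_sum n m : (0 < n)%N ->
  \sum_(k < m) (a n k)%:R * ((-1) ^+ k / k.+1%:R) =
  - (-1) ^+ m * m%:R * (a n m)%:R / (n%:R * n.+1%:R) :> rat.
Proof.
move=> n0; have nz : n%:R != 0 :> rat by rewrite pnatr_eq0 -lt0n.
elim: m => [|m IHm]; first by rewrite big_ord0 mulr0 !mul0r.
rewrite big_ord_recr /= IHm.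
have e : (a n m.+1)%:R * (m%:R + 1) ^+ 2 =
    (a n m)%:R * ((n%:R - m%:R) * (n%:R + m%:R + 1)) :> rat.
  case: (leqP m n) => mn; last by rewrite !touchard_coef_small ?mul0r // ltnW.
  rewrite -natrB // -natrD !natr1 -natrX -!natrM touchard_coefSr.
  by rewrite addnS.
have m1 : m%:R + 1 != 0 :> rat by rewrite natr1 pnatr_eq0.
have {}e : (a n m.+1)%:R =
    (a n m)%:R * ((n%:R - m%:R) * (n%:R + m%:R + 1)) / (m%:R + 1) ^+ 2 :> rat.
  by rewrite -e mulfK // expf_neq0.
have n1 : 1 + n%:R != 0 :> rat by rewrite addrC natr1 pnatr_eq0.
by rewrite e exprS; field; rewrite n1 nz m1.
Qed.

Lemma volkenborn_touchard n : L (touchard n.+1) = 0.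
Proof.
rewrite /touchard linear_sum /=.
under eq_bigr do rewrite linearZ /= volkenborn_binom.
by rewrite touchard_alternating_sum // touchard_coef_small // mulr0 mul0r.
Qed.

Lemma horner_binom_poly k x : (binom_poly k).[x] = (\prod_(i < k) (x - i%:R)) / k`!%:R.
Proof.
rewrite hornerZ /ffact_poly horner_prod mulrC; congr (_ / _).
by apply: eq_bigr => i _; rewrite hornerXsubC.
Qed.

Lemma int_valued_binom_poly k : int_valued (binom_poly k).
Proof. by move=> n; rewrite binom_poly_nat natr_int. Qed.

Lemma int_valued_touchard n : int_valued (touchard n).
Proof.
move=> m; rewrite horner_sum rpred_sum // => k _.
by rewrite hornerZ rpredM ?natr_int // int_valued_binom_poly.
Qed.

(** The auxiliary factor of the Padé argument: integer-valued, and with the largest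
    denominator that an integer-valued polynomial of degree n can have at
    [b / p ^ r]. *)
Definition binom_poly_up (n : nat) : {poly rat} := binom_poly n \Po ('X + n%:R%:P).

Lemma size_binom_poly_up n : size (binom_poly_up n) = n.+1.
Proof. by rewrite size_comp_poly2 ?size_XaddC ?size_binom_poly. Qed.

Lemma int_valued_binom_poly_up n : int_valued (binom_poly_up n).
Proof.
move=> m; rewrite horner_comp hornerD hornerX hornerC -natrD.
exact: int_valued_binom_poly.
Qed.

Lemma size_touchard n : (size (touchard n) <= n.+1)%N.
Proof.
apply: leq_trans (size_sum _ _ _) _; apply/bigmax_leqP => k _.
by rewrite (leq_trans (size_scale_leq _ _)) // size_binom_poly.
Qed.

Lemma zloc_touchard p (p_pr : prime p) n j : exists2 e, (p ^ e <= 2 * (n + j).+1)%N &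
  p%:R ^+ e * L (touchard n * binom_poly_up n * 'X^j) \in zloc p_pr.
Proof.
exists (trunc_log p (2 * (n + j).+1)); first by rewrite trunc_logP ?prime_gt1.
apply: zloc_volkenborn_int_valued.
  apply: int_valuedM; last exact/int_valuedXn/int_valuedX.
  by apply: int_valuedM; [exact: int_valued_touchard|exact: int_valued_binom_poly_up].
apply: leq_trans (size_polyMleq _ _) _; rewrite size_polyXn addnS /=.
apply: (@leq_trans ((n.+1 + n.+1).-1 + j)); last by lia.
rewrite leq_add2r; apply: leq_trans (size_polyMleq _ _) _.
by rewrite size_binom_poly_up -!subn1 leq_sub2r // leq_add2r size_touchard.
Qed.
End Touchard.

(** * Denominators of the Touchard approximants *)

Lemma dvdz_prodB (m : int) (k : nat) (x y : 'I_k -> int) :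
  (forall i, (m %| x i - y i)%Z) -> (m %| \prod_i x i - \prod_i y i)%Z.
Proof.
move=> xy; apply: (big_ind2 (fun u v => (m %| u - v)%Z)) => //.
move=> x1 x2 y1 y2 d1 d2.
have -> : x1 * y1 - x2 * y2 = (x1 - x2) * y1 + x2 * (y1 - y2) by ring.
by apply: rpredD; [exact: dvdz_mulr|exact: dvdz_mull].
Qed.

Lemma prod_ffactz (N k : nat) : \prod_(i < k) (N%:Z - i%:Z) = (N ^_ k)%:Z.
Proof.
apply/eqP; rewrite -(eqr_int rat) rmorph_prod /= -pmulrn -ffact_poly_nat.
rewrite /ffact_poly horner_prod; apply/eqP/eq_bigr => i _.
by rewrite hornerXsubC rmorphB.
Qed.

(** Modulo m prime to F, a progression of step F is a multiple of a run of
    consecutive integers. *)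
Lemma dvdz_prod_progression (m F k : nat) (c : int) :
  coprime m F -> (m %| k`!)%N -> (m%:Z %| \prod_(i < k) (c - i%:Z * F%:Z))%Z.
Proof.
move=> mF mk; have m0 : (0 < m)%N by rewrite (dvdn_gt0 (fact_gt0 k)).
have [u uF] : exists u : int, (m%:Z %| u * F%:Z - 1)%Z.
  have : coprimez m%:Z F%:Z by [].
  case/coprimezP => -[v u] /= e; exists u.
  by rewrite -e opprD addrCA subrr addr0 rpredN dvdz_mull.
(* [N = c / F] modulo m, so that [c - i F] is congruent to [(N - i) F]. *)
pose N := `|((c * u) %% m%:Z)%Z|%N.
have NE : N%:Z = ((c * u) %% m%:Z)%Z.
  by rewrite gez0_abs // modz_ge0 // gt_eqF // ltz_nat.
have Nc : (m%:Z %| N%:Z * F%:Z - c)%Z.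
  have -> : N%:Z * F%:Z - c = (N%:Z - c * u) * F%:Z + c * (u * F%:Z - 1) by ring.
  apply: rpredD; last exact: dvdz_mull.
  by apply: dvdz_mulr; rewrite -eqz_mod_dvd NE; apply/eqP/modz_mod.
have := @dvdz_prodB m%:Z k (fun i => c - i%:Z * F%:Z) (fun i => (N%:Z - i%:Z) * F%:Z).
rewrite big_split prod_ffactz /= => /(_ _) cong.
have {}cong := cong _; rewrite -[X in (_ %| X)%Z](subrK ((N ^_ k)%:Z * \prod_(i < k) F%:Z)).
apply: rpredD; last first.
  by apply: dvdz_mulr; rewrite dvdzE /=; apply: dvdn_trans mk _; rewrite -bin_ffact dvdn_mull.
apply: cong => i.
have -> : c - i%:Z * F%:Z - (N%:Z - i%:Z) * F%:Z = - (N%:Z * F%:Z - c) by ring.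
by rewrite rpredN.
Qed.

Lemma horner_binom_frac (F k : nat) (b : int) : (0 < F)%N -> (binom_poly k).[b%:~R / F%:R] =
  (\prod_(i < k) (b - i%:Z * F%:Z))%:~R / (F ^ k * k`!)%:R.
Proof.
move=> F_gt0; have F_neq0 : F%:R != 0 :> rat by rewrite pnatr_eq0 -lt0n.
rewrite horner_binom_poly natrM natrX invfM mulrA; congr (_ / _).
have -> : F%:R ^+ k = \prod_(i < k) F%:R :> rat by rewrite prodr_const card_ord.
rewrite rmorph_prod /= -prodf_div.
apply: eq_bigr => i _; rewrite rmorphB rmorphM /= -!pmulrn.
by field.
Qed.

Section Values.
Variables (p : nat) (p_pr : prime p) (r : nat).
Local Notation F := (p ^ r)%N.

(** The exact power of p in the denominator of [binom (b / p ^ r) n] for b prime to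
    p. *)
Definition denom_pow n := (p ^ (r * n + logn p n`!))%N.

Let F_neq0 : F%:R != 0 :> rat.
Proof. by rewrite pnatr_eq0 -lt0n expn_gt0 prime_gt0. Qed.

Lemma fact_p_part n : exists2 u, coprime p u & n`! = (u * p ^ logn p n`!)%N.
Proof. by have [u pu e] := pfactor_coprime p_pr (fact_gt0 n); exists u. Qed.

Lemma denom_pow_binom n k (b : int) : (k <= n)%N ->
  (denom_pow n)%:R * (binom_poly k).[b%:~R / F%:R] \is a Num.int.
Proof.
move=> kn; have [u pu uE] := fact_p_part k; rewrite horner_binom_frac ?expn_gt0 ?prime_gt0 //.
have u0 : (0 < u)%N by rewrite lt0n; apply: contraTneq (fact_gt0 k); rewrite uE => ->.
have : (u%:Z %| \prod_(i < k) (b - i%:Z * F%:Z))%Z.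
  apply: dvdz_prod_progression; first by rewrite coprime_sym coprimeXl.
  by rewrite uE dvdn_mulr.
case/dvdzP => q ->.
have le_v : (r * k + logn p k`! <= r * n + logn p n`!)%N.
  rewrite leq_add ?leq_mul2l ?kn ?orbT // dvdn_leq_log ?fact_gt0 //.
  by rewrite -(ffact_fact (leq_subr k n)) subKn // dvdn_mull.
have p0 m : (p ^ m)%:R != 0 :> rat by rewrite pnatr_eq0 -lt0n expn_gt0 prime_gt0.
move: le_v uE; rewrite /denom_pow; move: (logn p k`!) => v le_v ->.
rewrite -{1}(subnK le_v) expnD natrM -mulrA rpredM ?natr_int //.
rewrite -expnM [(p ^ (_ + v))%N]expnD intrM /= !natrM -pmulrn.
have un0 : u%:R != 0 :> rat by rewrite pnatr_eq0 -lt0n.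
have -> (x y w z : rat) : x != 0 -> y != 0 -> z != 0 ->
    x * y * (w * z / (x * (z * y))) = w by move=> *; field; do ?[apply/and3P; split|apply/andP; split].
- exact: intr_int.
- exact: p0.
- exact: p0.
exact: un0.
Qed.

Lemma zloc_denom_pow n (b : int) : ~~ (p %| b)%Z -> (0 < r)%N ->
  let c := (binom_poly n).[b%:~R / F%:R] in
  c != 0 /\ (denom_pow n)%:R^-1 / c \in zloc p_pr.
Proof.
move=> pb r0; rewrite /= horner_binom_frac ?expn_gt0 ?prime_gt0 //.
set P := \prod_(i < n) _.
have pP : ~~ (p %| P)%Z.
  rewrite /P dvdzE; elim/big_rec: _ => [|i x _ px].
    by rewrite dvdn1 gtn_eqF ?prime_gt1.
  rewrite abszM Euclid_dvdM // negb_or px andbT -dvdzE.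
  apply: contra pb => pbi; rewrite -[b](subrK (i%:Z * F%:Z)) rpredD //.
  by rewrite dvdz_mull // dvdzE /= dvdn_exp.
have P0 : P%:~R != 0 :> rat by rewrite intr_eq0; apply: contraNneq pP => ->; rewrite dvdz0.
have [u pu uE] := fact_p_part n.
have p0 m : (p ^ m)%:R != 0 :> rat by rewrite pnatr_eq0 -lt0n expn_gt0 prime_gt0.
have Fn0 : (F ^ n * n`!)%:R != 0 :> rat.
  by rewrite natrM natrX mulf_neq0 ?expf_neq0 // pnatr_eq0 -lt0n fact_gt0.
split; first by rewrite mulf_neq0 // invr_eq0.
rewrite invf_div mulrA; apply: rpredM; last exact: zlocV.
have -> : (F ^ n * n`!)%:R = u%:R * (denom_pow n)%:R :> rat.
  by rewrite /denom_pow {1}uE -expnM -natrM expnD mulnCA.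
by rewrite mulrC mulfK; [exact: zloc_nat|exact: p0].
Qed.
End Values.

(** The numbers [i! j! / (i+j+1)!] are the entries of Leibniz's harmonic triangle:
    the border consists of the [1 / (i+1)], and every other entry is a difference
    of two entries that are closer to the border. *)
Lemma leibniz_triangle n i j : (i + j < n)%N ->
  (lcm_upto n)%:R * (i`! * j`!)%:R / (i + j).+1`!%:R \is a @Num.int rat.
Proof.
have fact_neq0 m : m`!%:R != 0 :> rat by rewrite pnatr_eq0 -lt0n fact_gt0.
elim: j i => [|j IHj] i; rewrite ?addn0 ?addnS => ij.
  have /dvdnP[q ->] : (i.+1 %| lcm_upto n)%N by rewrite dvdn_lcm_upto.
  rewrite (_ : _ / _ = q%:R) ?natr_int // muln1 factS !natrM.
  by field; rewrite fact_neq0 addrC natr1 pnatr_eq0.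
have h1 := IHj i (ltnW ij); have := IHj i.+1; rewrite addSn => /(_ ij) h2.
have -> : (lcm_upto n)%:R * (i`! * j.+1`!)%:R / (i + j).+2`!%:R =
   (lcm_upto n)%:R * (i`! * j`!)%:R / (i + j).+1`!%:R -
   (lcm_upto n)%:R * (i.+1`! * j`!)%:R / (i + j).+2`!%:R :> rat.
  have n2 : (i%:R + j%:R + 1 + 1 : rat) != 0 by rewrite -natrD !natr1 pnatr_eq0.
  rewrite (factS (i + j).+1) (factS i) (factS j).
  move: ((i + j).+1`!) (fact_neq0 (i + j).+1) => w w0; rewrite !natrM.
  have -> : (i + j).+2%:R = i%:R + j%:R + 1 + 1 :> rat by rewrite -natrD !natr1.
  by field; rewrite w0 n2.
exact: rpredB.
Qed.

Lemma diff_quot_ffactS y k : diff_quot y (ffact_poly k.+1) =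
  ffact_poly k + (y - k%:R) *: diff_quot y (ffact_poly k).
Proof.
apply: diff_quot_uniq; rewrite mulrDl -scalerAl diff_quotP ffact_polyS hornerM hornerXsubC.
by rewrite -mul_polyC polyCM polyCB; ring.
Qed.

(** Expanded in this way, the numerators have factors [j! i!] with [i + j + 1 = k],
    and Leibniz's triangle absorbs the denominator [k!]. *)
Lemma volkenborn_diff_quot_ffact y k : L (diff_quot y (ffact_poly k)) =
  \sum_(j < k) L (ffact_poly j) * (ffact_poly (k.-1 - j)).[y - j.+1%:R].
Proof.
elim: k => [|k IHk].
  by rewrite big_ord0 /ffact_poly big_ord0 diff_quot1 linear0.
rewrite diff_quot_ffactS linearD linearZ /= IHk big_ord_recr /= subnn.
have -> z : (ffact_poly 0).[z] = 1 by rewrite /ffact_poly big_ord0 hornerC.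
rewrite mulr1 addrC mulr_sumr; congr (_ + _).
apply: eq_bigr => j _; rewrite mulrCA; congr (_ * _).
have -> : (k - j)%N = (k.-1 - j).+1.
  by rewrite -subSn ?prednK //; case: k {IHk} j => [[]|k j] //=; rewrite -ltnS.
rewrite ffact_polyS hornerM hornerXsubC mulrC; congr (_ * _).
have jk := ltn_ord j.
have -> : (k.-1 - j)%:R = k%:R - j.+1%:R :> rat.
  by rewrite -natrB //; congr (_%:R); lia.
by rewrite opprB addrA subrK.
Qed.

Section TouchardDenominators.
Variables (p : nat) (p_pr : prime p) (r : nat) (b : int).
Local Notation F := (p ^ r)%N.
Let y : rat := b%:~R / F%:R.

Lemma touchard_den_int n :
  (lcm_upto n ^ 2 * denom_pow p r n)%:R * (touchard n).[y] \is a Num.int.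
Proof.
rewrite natrM -mulrA rpredM ?natr_int // horner_sum mulr_sumr rpred_sum // => k _.
by rewrite hornerZ mulrCA rpredM ?natr_int // denom_pow_binom // -ltnS.
Qed.

(** One factor [lcm(1..n)] is for Leibniz's triangle, the other for the denominator
    [j + 1] of the value of the functional. *)
Lemma binom_num_int n k : (k <= n)%N ->
  (lcm_upto n ^ 2 * denom_pow p r n)%:R * L (diff_quot y (binom_poly k)) \is a Num.int.
Proof.
move=> kn; rewrite /binom_poly linearZ linearZ /= volkenborn_diff_quot_ffact.
rewrite mulr_sumr mulr_sumr rpred_sum // => j _; have jk := ltn_ord j.
pose i := (k.-1 - j)%N; have ijk : (j + i).+1 = k by rewrite /i; lia.
rewrite -/i volkenborn_ffact.
have -> : (ffact_poly i).[y - j.+1%:R] = i`!%:R * (binom_poly i).[y - j.+1%:R].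
  by rewrite hornerZ mulrA divff ?mul1r // pnatr_eq0 -lt0n fact_gt0.
have -> : y - j.+1%:R = (b - j.+1%:Z * F%:Z)%:~R / F%:R.
  rewrite rmorphB rmorphM /= -!pmulrn mulrBl mulfK //.
  by rewrite pnatr_eq0 -lt0n expn_gt0 prime_gt0.
set B := _.[_]; have BZ : (denom_pow p r n)%:R * B \is a Num.int.
  by apply: denom_pow_binom => //; lia.
have ji : (j + i < n)%N by lia.
have lZ := leibniz_triangle ji; rewrite ijk in lZ.
have jZ : (lcm_upto n)%:R / j.+1%:R \is a @Num.int rat.
  have /dvdnP[q ->] : (j.+1 %| lcm_upto n)%N by rewrite dvdn_lcm_upto //; lia.
  by rewrite natrM mulfK ?natr_int.
have -> : (lcm_upto n ^ 2 * denom_pow p r n)%:R *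
   (k`!%:R^-1 * ((-1) ^+ j * j`!%:R / j.+1%:R * (i`!%:R * B))) =
   (-1) ^+ j * ((lcm_upto n)%:R * (j`! * i`!)%:R / k`!%:R) * ((lcm_upto n)%:R / j.+1%:R) *
   ((denom_pow p r n)%:R * B).
  by rewrite !natrM; ring.
do 3![apply: rpredM => //]; by rewrite rpredX ?rpredN1.
Qed.

Lemma touchard_num_int n :
  (lcm_upto n ^ 2 * denom_pow p r n)%:R * L (diff_quot y (touchard n)) \is a Num.int.
Proof.
rewrite /touchard !linear_sum /= mulr_sumr rpred_sum // => k _.
rewrite [diff_quot _ _]linearZ [L _]linearZ /= mulrCA.
by apply: rpredM; [exact: natr_int|apply: binom_num_int; rewrite -ltnS].
Qed.

End TouchardDenominators.

(** * Irrationality from the Touchard approximants *)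

(** Once [s / n <= delta], a step multiplies the bound by at most [1 + delta]. *)
Lemma subexponential (F : archiRealFieldType) (u : nat -> F) (s delta : F) :
    0 <= s -> 0 < delta ->
    (forall n, `|u n.+2| <= s / n.+2%:R * `|u n.+1| + `|u n|) ->
  exists K, forall n, `|u n| <= K * (1 + delta) ^+ n.
Proof.
move=> s0 d0 u_rec; pose N := Num.bound `|s / delta|.
have d1 : 1 <= 1 + delta by rewrite lerDl ltW.
have step n : (N <= n.+2)%N -> s / n.+2%:R <= delta.
  move=> Nn; rewrite ler_pdivrMr ?ltr0n // mulrC -ler_pdivrMr //.
  rewrite (le_trans (ler_norm _)) // (le_trans (ltW (archi_boundP (normr_ge0 _)))) //.
  by rewrite ler_nat.
pose K := \sum_(i < N.+2) `|u i|.
have K0 : 0 <= K by rewrite sumr_ge0.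
have init n : (n < N.+2)%N -> `|u n| <= K * (1 + delta) ^+ n.
  move=> nN; apply: (@le_trans _ _ K); last by rewrite ler_peMr // exprn_ege1.
  by rewrite /K (bigD1 (Ordinal nN)) //= lerDl sumr_ge0.
exists K; elim/ltn_ind => n IHn; case: (ltnP n N.+2) => [/init //|].
case: n IHn => [|[|n]] IHn //; rewrite !ltnS => Nn.
apply: le_trans (u_rec n) _.
have h1 := IHn n.+1 (ltnSn _); have h0 := IHn n (ltnW (ltnSn _)).
have sd := step n (leq_trans Nn (leqW (leqnSn n))).
apply: (@le_trans _ _ (delta * (K * (1 + delta) ^+ n.+1) + K * (1 + delta) ^+ n)).
  rewrite lerD // ler_pM // ?divr_ge0 ?ler0n //.
rewrite !exprS -subr_ge0.
have -> : K * ((1 + delta) * ((1 + delta) * (1 + delta) ^+ n)) -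
   (delta * (K * ((1 + delta) * (1 + delta) ^+ n)) + K * (1 + delta) ^+ n) =
   delta * (K * (1 + delta) ^+ n) by ring.
by rewrite mulr_ge0 ?(ltW d0) // mulr_ge0 // exprn_ge0 // (le_trans ler01).
Qed.

Section Growth.
Variables (p : nat) (p_pr : prime p) (r : nat).
Local Notation M := (denom_pow p r).

Lemma denom_pow_gt0 n : (0 < M n)%N.
Proof. by rewrite expn_gt0 prime_gt0. Qed.

Lemma leq_denom_powD m n : (M m * M n <= M (m + n))%N.
Proof.
rewrite -expnD leq_exp2l ?prime_gt1 // addnACA -mulnDr leq_add2l.
rewrite -lognM ?fact_gt0 // dvdn_leq_log ?fact_gt0 //.
by rewrite -(bin_fact (leq_addr n m)) addKn dvdn_mull.
Qed.

(** The sequence is supermultiplicative, hence a single value determines a lower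
    bound for its rate of growth. *)
Lemma denom_pow_growth (Y : rat) T : 1 <= Y -> (0 < T)%N ->
  Y ^+ T <= (M T)%:R -> forall n, Y ^- T * Y ^+ n <= (M n)%:R.
Proof.
move=> Y1 T0 YT; have Y0 : 0 < Y by apply: lt_le_trans Y1.
have le_q q : Y ^+ (q * T) <= (M (q * T))%:R.
  elim: q => [|q IHq]; first by rewrite expr0 ler1n denom_pow_gt0.
  rewrite mulSn exprD; apply: le_trans (_ : (M T * M (q * T))%:R <= _).
    by rewrite natrM ler_pM // exprn_ge0 // ltW.
  by rewrite ler_nat leq_denom_powD.
move=> n; have := ltn_pmod n T0; move: (n %/ T)%N (n %% T)%N (divn_eq n T) => q m -> mT.
apply: (@le_trans _ _ (M (q * T))%:R); last first.
  by rewrite ler_nat (leq_trans _ (leq_denom_powD _ _)) // leq_pmulr // denom_pow_gt0.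
apply: le_trans (le_q q); rewrite mulrC ler_pdivrMr ?exprn_gt0 // exprD.
by rewrite ler_wpM2l ?exprn_ge0 ?(ltW Y0) // ler_weXn2l // ltnW.
Qed.

(** Only the multiples of p up to [p * n] count, and they are p times the numbers up
    to n; this is the recursive form of
    Legendre's formula. *)
Lemma leq_logn_fact_mul n : (n + logn p n`! <= logn p (p * n)`!)%N.
Proof.
case: (posnP n) => [->|n0]; first by rewrite muln0.
have p1 := prime_gt1 p_pr; have p0 := prime_gt0 p_pr.
have pn : (n < p * n)%N by rewrite -{1}[n]mul1n ltn_pmul2r.
rewrite !logn_fact // [leqRHS]big_ltn ?ltnS ?muln_gt0 ?p0 // expn1 mulKn // leq_add2l.
rewrite [leqRHS]big_add1 /= [leqRHS](big_cat_nat (n := n.+1)) //=.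
rewrite -[leqLHS]addn0 leq_add // leq_sum // => k _.
by rewrite expnS divnMl.
Qed.
End Growth.

Lemma touchard_recurrence_growth (delta : rat) : 0 < delta ->
  forall (y : rat) (u : nat -> rat),
    (forall n, n.+2%:R ^+ 2 * u n.+2 =
      ((2 * n.+1 + 1)%:R + (2 * (2 * n.+1 + 1))%:R * y) * u n.+1 +
      1 * n.+1%:R ^+ 2 * u n) ->
  exists K, forall n, `|u n| <= K * (1 + delta) ^+ n.
Proof.
move=> d0 y u u_rec.
have s0 : 0 <= 2%:R * `|1 + 2%:R * y| by rewrite mulr_ge0 ?ler0n.
apply: (subexponential s0 d0) => n.
have n2 : 0 < n.+2%:R :> rat by rewrite ltr0n.
have -> : u n.+2 = ((2 * n.+1 + 1)%:R / n.+2%:R ^+ 2 * (1 + 2%:R * y)) * u n.+1 +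
   (n.+1%:R / n.+2%:R) ^+ 2 * u n.
  apply: (mulfI (expf_neq0 2 (lt0r_neq0 n2))); rewrite u_rec.
  by move: (n.+2%:R) (lt0r_neq0 n2) => x x0; field.
apply: le_trans (ler_normD _ _) _; rewrite !normrM; apply: lerD.
  apply: ler_wpM2r; first exact: normr_ge0.
  have -> : `|n.+2%:R ^- 2| = n.+2%:R ^- 2 :> rat.
    by rewrite ger0_norm // invr_ge0 exprn_ge0 // ltW.
  rewrite normr_nat [leRHS]mulrAC; apply: ler_wpM2r; first exact: normr_ge0.
  rewrite ler_pdivrMr ?exprn_gt0 // expr2 mulrA divfK ?lt0r_neq0 //.
  by rewrite -natrM ler_nat; lia.
have q1 : `|n.+1%:R| * `|n.+2%:R^-1| <= 1 :> rat.
  by rewrite -normrM ger0_norm ?divr_ge0 ?ler0n // ler_pdivrMr // mul1r ler_nat.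
apply: ler_piMl; first exact: normr_ge0.
by rewrite mulr_ile1 // mulr_ge0.
Qed.

Section TouchardCase.
Variables (p : nat) (p_pr : prime p) (r : nat) (b : int).
Local Notation F := (p ^ r)%N.
Hypothesis r_gt0 : (0 < r)%N.
Hypothesis pb : ~~ (p %| b)%Z.

Let F_neq0 : F%:R != 0 :> rat.
Proof. by rewrite pnatr_eq0 -lt0n expn_gt0 prime_gt0. Qed.

Lemma frac_neq0 : b%:~R / F%:R != 0 :> rat.
Proof.
by rewrite mulf_neq0 ?invr_eq0 // intr_eq0; apply: contraNneq pb => ->; rewrite dvdz0.
Qed.

Lemma frac_inv_zloc : (b%:~R / F%:R)^-1 / p%:R \in zloc p_pr.
Proof.
rewrite invf_div mulrAC rpredM ?zlocV //.
by rewrite -(prednK r_gt0) expnS natrM mulrAC mulfV ?mul1r ?zloc_nat // pnatr_eq0 -lt0n prime_gt0.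
Qed.

(** The Padé argument with the Touchard polynomials: [M n ^ 2] divides an integer of
    size [lcm(1..n)^2 * M n] times the remainder, so that the growth rate of [M n]
    competes with [e^2]. *)
Lemma irrational_of_lcm_bound (k0 T : nat) (E A Y delta : rat) :
    0 < delta -> (0 < k0)%N -> ((1 + k0%:R^-1) ^+ k0.+1) ^+ 2 <= E -> E < A ->
    A * (1 + delta) ^+ 2 <= Y -> (0 < T)%N -> Y ^+ T <= (denom_pow p r T)%:R ->
  ~ rational_value p_pr (b%:~R / F%:R).
Proof.
set y := b%:~R / F%:R => d0 k00 leE ltEA leA T0 YT [a ya].
have y0 : y != 0 := frac_neq0; have yp : y^-1 / p%:R \in zloc p_pr := frac_inv_zloc.
have Y1 : 1 <= Y.
  apply: le_trans leA; apply: (@le_trans _ _ A); last first.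
    rewrite ler_peMr ?exprn_ege1 ?lerDl ?(ltW d0) //.
    by apply: le_trans (ltW ltEA); apply: le_trans leE; rewrite exprn_even_ge0.
  apply: le_trans (ltW ltEA); apply: le_trans leE.
  by rewrite -exprM exprn_ege1 // lerDl invr_ge0 ler0n.
have hn n : (binom_poly_up n).[y] != 0 /\
    (denom_pow p r n)%:R^-1 / (binom_poly_up n).[y] \in zloc p_pr.
  have -> : (binom_poly_up n).[y] = (binom_poly n).[(b + n%:Z * F%:Z)%:~R / F%:R].
    rewrite horner_comp hornerD hornerX hornerC; congr (_.[_]).
    by rewrite rmorphD rmorphM /= -!pmulrn mulrDl mulfK.
  apply: zloc_denom_pow => //; apply: contra pb => pbn.
  rewrite -[b](addrK (n%:Z * F%:Z)) rpredB // dvdz_mull // dvdzE /= dvdn_exp //.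
have recN n : n.+1%:R ^+ 2 *: touchard n.+1 = (2 * n + 1)%:R *: touchard n +
    (2 * (2 * n + 1))%:R *: ('X * touchard n) + (1 * n%:R ^+ 2) *: touchard n.-1 := touchard_rec n.
have g0 n : (2 * (2 * n + 1))%:R != 0 :> rat by rewrite pnatr_eq0; lia.
have e0 : 1 != 0 :> rat by [].
have L1 : L 1 != 0.
  by rewrite -binom_poly0 volkenborn_binom expr0 mul1r invr1.
have grow := touchard_recurrence_growth d0.
(* Denominators and numerators satisfy the recurrence of the polynomials, evaluated
   at y. *)
have [K1 K1P] := grow y (fun n => (touchard n).[y]) (fun n => pade_den_rec y recN n.+1).
have [K2 K2P] := grow y (fun n => L (diff_quot y (touchard n)))
  (fun n => pade_num_rec y recN volkenborn_touchard n).
apply: (@pade_contradiction p p_pr volkenborn y touchard binom_poly_up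
  (fun n => (2 * n + 1)%:R) (fun n => (2 * (2 * n + 1))%:R) 1 touchard0 recN g0 e0
  volkenborn_touchard L1 y0 yp _ a ya (@zloc_volkenborn p p_pr) 2%N (zloc_touchard p_pr)
  (denom_pow p r) (fun n => 2 * (r * n + logn p n`!))%N 1%N _ _ _ _ isT _
  E A Y (Y ^- T) delta k0 d0 _ k00 leE ltEA leA _ _).
- by move=> n; rewrite size_binom_poly_up.
- by move=> n; rewrite mul1n; exact: touchard_den_int.
- by move=> n; rewrite mul1n; exact: touchard_num_int.
- by move=> n; have [] := hn n.
- move=> n; have [_ hz] := hn n; rewrite mul1n.
  have M0 : (denom_pow p r n)%:R != 0 :> rat.
    by rewrite pnatr_eq0 -lt0n denom_pow_gt0.
  have -> : (lcm_upto n ^ 2 * denom_pow p r n)%:R / (binom_poly_up n).[y] /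
      p%:R ^+ (2 * (r * n + logn p n`!)) =
    (lcm_upto n ^ 2)%:R * ((denom_pow p r n)%:R^-1 / (binom_poly_up n).[y]).
    have -> : p%:R ^+ (2 * (r * n + logn p n`!)) = (denom_pow p r n)%:R ^+ 2 :> rat.
      by rewrite mulnC exprM -natrX.
    rewrite natrM; move: (lcm_upto n ^ 2)%:R (denom_pow p r n)%:R M0 => l m m0.
    by field; rewrite m0 (hn n).1.
  by rewrite rpredM ?zloc_nat.
- by move=> n; exact: denom_pow_gt0.
- by rewrite invr_gt0 exprn_gt0 // (lt_le_trans ltr01).
- move=> n; rewrite mulnC exprM -natrX expr2 ler_wpM2r ?ler0n //.
  exact: denom_pow_growth.
have KK : forall n, 0 <= (1 + delta) ^+ n by move=> n; rewrite exprn_ge0 // addr_ge0 // ltW.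
exists (`|K1| + `|K2|) => n; split.
  apply: le_trans (K1P n) _; rewrite ler_wpM2r //.
  by rewrite (le_trans (ler_norm _)) // lerDl.
apply: le_trans (K2P n) _; rewrite ler_wpM2r //.
by rewrite (le_trans (ler_norm _)) // lerDr.
Qed.
End TouchardCase.

(** * Dual Hahn polynomials *)

Definition quad_binom (k : nat) : {poly rat} := (k`!%:R ^+ 2)^-1 *: quad_prod k.
(** On the [quad_binom k] theta takes the values [- (-1)^k / 2], so these binomial
    sums are orthogonal; they are continuous dual Hahn polynomials. *)
Definition dual_hahn (n : nat) : {poly rat} := \sum_(k < n.+1) 'C(n, k)%:R *: quad_binom k.

Lemma dual_hahnE n N : (n < N)%N -> dual_hahn n = \sum_(k < N) 'C(n, k)%:R *: quad_binom k.
Proof.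
move=> nN; rewrite /dual_hahn (big_ord_widen N (fun k => 'C(n, k)%:R *: quad_binom k)) //.
rewrite big_mkcond; apply: eq_bigr => k _ /=.
by case: ltnP => // nk; rewrite bin_small ?scale0r.
Qed.

Lemma quad_binom0 : quad_binom 0 = 1.
Proof. by rewrite /quad_binom /quad_prod big_ord0 expr1n invr1 scale1r. Qed.

Lemma dual_hahn0 : dual_hahn 0 = 1.
Proof. by rewrite /dual_hahn big_ord1 quad_binom0 bin0 scale1r. Qed.

Lemma mulX_quad_binom k : 'X * quad_binom k =
  (k.+1%:R ^+ 2) *: quad_binom k.+1 + (k * k.+1)%:R *: quad_binom k.
Proof.
have k0 : k.+1%:R != 0 :> rat by rewrite pnatr_eq0.
have f0 : k`!%:R != 0 :> rat by rewrite pnatr_eq0 -lt0n fact_gt0.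
rewrite /quad_binom quad_prodS factS natrM scalerA.
have -> : k.+1%:R ^+ 2 * ((k.+1%:R * k`!%:R) ^+ 2)^-1 = (k`!%:R ^+ 2)^-1 :> rat.
  by move: k.+1%:R k`!%:R k0 f0 => x w x0 w0; field; rewrite x0 w0.
by rewrite -!mul_polyC; ring.
Qed.

Lemma bin_rec n k : n.+1%:R ^+ 2 * 'C(n.+1, k)%:R =
  (2 * n ^ 2 + 2 * n + 1)%:R * 'C(n, k)%:R +
  (k%:R ^+ 2 * 'C(n, k.-1)%:R + (k * k.+1)%:R * 'C(n, k)%:R) - n%:R ^+ 2 * 'C(n.-1, k)%:R :> rat.
Proof.
have e1 : n%:R ^+ 2 * 'C(n.-1, k)%:R = n%:R * (n%:R - k%:R) * 'C(n, k)%:R :> rat.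
  rewrite expr2 -!mulrA; congr (_ * _); case: (leqP k n) => kn.
    by rewrite -natrB // -!natrM mul_bin_down.
  by rewrite !bin_small ?mulr0n ?mulr0 //; lia.
rewrite e1; case: k {e1} => [|k].
  by rewrite !bin0 -natr1; ring.
have e2 : k.+1%:R * 'C(n, k.+1)%:R = (n%:R - k%:R) * 'C(n, k)%:R :> rat.
  case: (leqP k n) => kn; first by rewrite -natrB // -!natrM mul_bin_left.
  by rewrite !bin_small ?mulr0n ?mulr0 //; lia.
rewrite binS natrD /= -[k.+1%:R](natr1 k) in e2 *.
apply/eqP; rewrite -subr_eq0; apply/eqP.
transitivity ((n%:R + k%:R + 2%:R) *
  ((n%:R - k%:R) * 'C(n, k)%:R - (k%:R + 1) * 'C(n, k.+1)%:R) : rat); first by ring.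
by rewrite e2 subrr mulr0.
Qed.

Lemma dual_hahn_rec n : n.+1%:R ^+ 2 *: dual_hahn n.+1 =
  (2 * n ^ 2 + 2 * n + 1)%:R *: dual_hahn n + 1 *: ('X * dual_hahn n) +
  (- 1 * n%:R ^+ 2) *: dual_hahn n.-1.
Proof.
rewrite (@dual_hahnE n n.+2) // (@dual_hahnE n.+1 n.+2) // (@dual_hahnE n.-1 n.+2) ?ltnS ?(leq_trans (leq_pred n)) //.
have -> : 'X * \sum_(k < n.+2) 'C(n, k)%:R *: quad_binom k =
   \sum_(k < n.+2) (k%:R ^+ 2 * 'C(n, k.-1)%:R + (k * k.+1)%:R * 'C(n, k)%:R) *: quad_binom k.
  under [RHS]eq_bigr do rewrite scalerDl.
  rewrite big_split /= [X in _ = X + _]big_ord_recl expr0n mul0r scale0r add0r.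
  rewrite big_distrr /= big_ord_recr /= bin_small // scale0r mulr0 addr0.
  rewrite [X in _ = _ + X]big_ord_recr /= bin_small // mulr0 scale0r addr0.
  rewrite -big_split; apply: eq_bigr => k _.
  rewrite [RHS]/= /bump add1n /= -[LHS]scalerAr mulX_quad_binom scalerDr.
  by congr (_ + _); rewrite -[LHS]/(_ *: (_ *: _)) scalerA mulrC.
rewrite !scaler_sumr -!big_split /=; apply: eq_bigr => k _.
rewrite ![_ *: (_ *: quad_binom k)]scalerA -!scalerDl; congr (_ *: _).
by rewrite bin_rec; ring.
Qed.

Lemma theta_quad_binom k : theta (quad_binom k) = - 2^-1 * (-1) ^+ k.
Proof.
rewrite /quad_binom linearZ /= theta_quad_prod.
have k0 : k`!%:R != 0 :> rat by rewrite pnatr_eq0 -lt0n fact_gt0.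
by rewrite mulrC mulrA mulfK // expf_neq0.
Qed.

Lemma theta_dual_hahn n : theta (dual_hahn n.+1) = 0.
Proof.
rewrite /dual_hahn linear_sum /=.
have -> : \sum_(k < n.+2) theta ('C(n.+1, k)%:R *: quad_binom k) =
   - 2^-1 * (1 - 1) ^+ n.+1 :> rat.
  rewrite exprBn mulr_sumr; apply: eq_bigr => k _.
  rewrite [LHS]linearZ /= theta_quad_binom expr1n expr1n !mulr1 -[_ *+ 'C(_, _)]mulr_natr; ring.
by rewrite subrr expr0n mulr0.
Qed.

Lemma theta1 : theta 1 = - 2^-1.
Proof. by rewrite -quad_binom0 theta_quad_binom expr0 mulr1. Qed.

Lemma quad_prod_comp k :
  quad_prod k \Po quad = ffact_poly k * (ffact_poly k \Po ('X + k%:R%:P)).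
Proof.
elim: k => [|k IHk]; first by rewrite /quad_prod /ffact_poly !big_ord0 !comp_polyC mulr1.
have -> : ffact_poly k.+1 \Po ('X + k.+1%:R%:P) =
    ('X + k.+1%:R%:P) * (ffact_poly k \Po ('X + k%:R%:P)).
  have -> : 'X + k.+1%:R%:P = ('X + 1) \Po ('X + k%:R%:P) :> {poly rat}.
    by rewrite comp_polyD comp_polyX -polyC1 comp_polyC -addrA -polyCD natr1.
  by rewrite comp_polyA ffact_poly_shift comp_polyM.
by rewrite quad_prodS_comp IHk ffact_polyS; ring.
Qed.

Lemma quad_binom_comp k : quad_binom k \Po quad = binom_poly k * binom_poly_up k.
Proof.
rewrite /quad_binom /binom_poly_up /binom_poly !comp_polyZ quad_prod_comp.
by rewrite -scalerAl -scalerAr scalerA expr2 invfM.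
Qed.

(** As a polynomial in z, [dual_hahn n] need not take integral values at the natural
    numbers; as a polynomial in x it is a combination of products of two binomials. *)
Lemma int_valued_dual_hahn n : int_valued (dual_hahn n \Po quad).
Proof.
rewrite /dual_hahn linear_sum /=; apply: int_valued_sum => k.
rewrite linearZ /= -mul_polyC quad_binom_comp; apply: int_valuedM; first exact: (int_valuedC ('C(n, k)%:Z)).
by apply: int_valuedM; [exact: int_valued_binom_poly|exact: int_valued_binom_poly_up].
Qed.

Lemma size_dual_hahn n : (size (dual_hahn n) <= n.+1)%N.
Proof.
apply: leq_trans (size_sum _ _ _) _; apply/bigmax_leqP => k _.
rewrite (leq_trans (size_scale_leq _ _)) // /quad_binom (leq_trans (size_scale_leq _ _)) //.
by rewrite /quad_prod size_prod_XsubC /index_enum -enumT size_enum_ord.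
Qed.

Lemma size_quad : size quad = 3%N.
Proof. by rewrite /quad size_polyDl size_polyXn // size_polyX. Qed.

Lemma int_valued_quad : int_valued quad.
Proof. by move=> m; rewrite hornerD hornerXn hornerX rpredD ?rpredX ?natr_int. Qed.

Lemma int_valued_odd : int_valued ('X *+ 2 + 1).
Proof. by move=> m; rewrite hornerD hornerMn hornerX -polyC1 hornerC rpredD ?rpredMn ?natr_int ?rpred1. Qed.

Lemma int_valued_comp_odd f : int_valued f -> int_valued (f \Po ('X *+ 2 + 1)).
Proof.
move=> fZ m; rewrite horner_comp hornerD hornerMn hornerX -polyC1 hornerC -mulrnA natr1.
exact: fZ.
Qed.

Section MinusThird.
Variable p3 : prime 3.
Local Notation Z3 := (zloc p3).

Lemma theta_integral (q : {poly rat}) : q \is a polyOver Z3 -> 3%:R * theta q \in Z3.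
Proof.
move=> qZ; have oddZ : 'X *+ 2 + 1 \is a polyOver Z3 by rewrite rpredD ?rpredMn ?polyOverX ?rpred1.
have uZ : ('X *+ 2 + 1) * (q \Po quad) \is a polyOver Z3.
  by apply: rpredM => //; apply: polyOver_comp => //; exact: quad_over.
rewrite /theta /volkenborn_alt mulrCA mulrBr rpredM ?zloc3_half // rpredB ?zloc_volkenborn //.
exact: polyOver_comp.
Qed.

Lemma size_comp_leq (f q : {poly rat}) : (size (f \Po q) <= ((size f).-1 * (size q).-1).+1)%N.
Proof. exact: size_comp_poly_leq. Qed.

Lemma size_odd : size ('X *+ 2 + 1 : {poly rat}) = 2%N.
Proof.
rewrite -scaler_nat size_polyDl size_scale ?size_polyX // ?pnatr_eq0 //.
by rewrite size_poly1.
Qed.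

Lemma zloc_dual_hahn n j : exists2 e, (3 ^ e <= 4 * (n + j).+1)%N &
  3%:R ^+ e * theta (dual_hahn n * 'X^n * 'X^j) \in Z3.
Proof.
exists (trunc_log 3 (4 * (n + j).+1)); first by rewrite trunc_logP.
set u := ('X *+ 2 + 1) * ((dual_hahn n * 'X^n * 'X^j) \Po quad).
have uZ : int_valued u.
  apply: int_valuedM; first exact: int_valued_odd.
  rewrite !comp_polyM !comp_Xn_poly; apply: int_valuedM; last exact/int_valuedXn/int_valued_quad.
  by apply: int_valuedM; [exact: int_valued_dual_hahn|exact/int_valuedXn/int_valued_quad].
have su : (size u <= 4 * (n + j).+1)%N.
  apply: leq_trans (size_polyMleq _ _) _; rewrite size_odd /=.
  have sf : (size (dual_hahn n * 'X^n * 'X^j)%R <= (2 * n + j).+1)%N.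
    apply: leq_trans (size_polyMleq _ _) _; rewrite size_polyXn addnS /=.
    apply: (@leq_trans ((n.+1 + n.+1).-1 + j)); last by lia.
    rewrite leq_add2r; apply: leq_trans (size_polyMleq _ _) _.
    by rewrite size_polyXn -!subn1 leq_sub2r // leq_add2r size_dual_hahn.
  have := size_comp_leq (dual_hahn n * 'X^n * 'X^j) quad; rewrite size_quad /=.
  by move: (size (_ \Po _)) (size (_ * 'X^j)%R) sf => m l; lia.
rewrite /theta /volkenborn_alt -/u mulrCA rpredM ?zloc3_half // mulrBr.
apply: rpredB; apply: zloc_volkenborn_int_valued => //; first exact: int_valued_comp_odd.
apply: leq_trans (size_comp_leq _ _) _; rewrite size_odd muln1.
by case: (size u) su => //=; lia.
Qed.

End MinusThird.

(** * Irrationality at the point -1/3 *)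

Lemma diff_quot_quad_prodS eta k : diff_quot eta (quad_prod k.+1) =
  quad_prod k + (eta - (k * k.+1)%:R) *: diff_quot eta (quad_prod k).
Proof.
apply: diff_quot_uniq; rewrite mulrDl -scalerAl diff_quotP quad_prodS hornerM hornerXsubC.
by rewrite -mul_polyC polyCM polyCB; ring.
Qed.

Lemma horner_ffactS k (x : rat) : (ffact_poly k.+1).[x + 1] = (x + 1) * (ffact_poly k).[x].
Proof.
have := congr1 (fun f => f.[x]) (ffact_poly_shift k).
by rewrite horner_comp hornerM !hornerD !hornerX -!polyC1 !hornerC.
Qed.

(** With [eta = y(y+1)], each factor [eta - i(i+1)] splits into [y - i] and
    [y + i + 1], which gathers the terms into two falling factorials. *)
Lemma theta_diff_quot_quad_prod (y : rat) k : theta (diff_quot (y * (y + 1)) (quad_prod k)) =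
  \sum_(j < k) theta (quad_prod j) *
    ((ffact_poly (k.-1 - j)).[y - j.+1%:R] * (ffact_poly (k.-1 - j)).[y + k%:R]).
Proof.
elim: k => [|k IHk].
  by rewrite big_ord0 /quad_prod big_ord0 diff_quot1 linear0.
rewrite diff_quot_quad_prodS linearD linearZ /= IHk big_ord_recr /= subnn.
have h0 z : (ffact_poly 0).[z] = 1 by rewrite /ffact_poly big_ord0 hornerC.
rewrite !h0 !mulr1 addrC mulr_sumr; congr (_ + _).
apply: eq_bigr => j _; rewrite mulrCA; congr (_ * _).
have -> : (k - j)%N = (k.-1 - j).+1.
  by rewrite -subSn ?prednK //; case: k {IHk} j => [[]|k j] //=; rewrite -ltnS.
have -> : y + k.+1%:R = y + k%:R + 1 by rewrite -natr1 addrA.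
rewrite horner_ffactS ffact_polyS hornerM hornerXsubC.
have jk := ltn_ord j.
have -> : (k.-1 - j)%:R = k%:R - j.+1%:R :> rat.
  by rewrite -natrB //; congr (_%:R); lia.
by rewrite natrM -natr1; ring.
Qed.

Section MinusThird.
Variable p3 : prime 3.
Local Notation Z3 := (zloc p3).
Variable y : rat.
Hypothesis yE : y = - 3%:R^-1.
Let eta : rat := y * (y + 1).
Local Notation M := (denom_pow 3 1).
Local Notation frac b := ((b : int)%:~R / (3 ^ 1)%:R : rat).

Lemma shift_frac (m : int) : y + m%:~R = frac (3%:Z * m - 1).
Proof. by rewrite yE rmorphB rmorphM /=; field. Qed.

Lemma eta_quad : quad.[y] = eta.
Proof. by rewrite /quad hornerD hornerXn hornerX /eta; ring. Qed.

Lemma denom_ffact n k (m : int) : (k <= n)%N ->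
  (M n)%:R * ((ffact_poly k).[y + m%:~R] / k`!%:R) \is a Num.int.
Proof.
move=> kn; have -> (z : rat) : (ffact_poly k).[z] / k`!%:R = (binom_poly k).[z].
  by rewrite hornerZ mulrC.
by rewrite shift_frac; exact: denom_pow_binom.
Qed.

Lemma dual_hahn_den_int n :
  (2 * lcm_upto n ^ 2 * M n ^ 2)%:R * (dual_hahn n).[eta] \is a Num.int.
Proof.
rewrite natrM natrX -mulrA rpredM ?natr_int // horner_sum mulr_sumr rpred_sum // => k _.
have kn : (k <= n)%N by rewrite -ltnS.
have k0 : k`!%:R != 0 :> rat by rewrite pnatr_eq0 -lt0n fact_gt0.
rewrite hornerZ mulrCA rpredM ?natr_int //.
have -> : (quad_binom k).[eta] = ((ffact_poly k).[y] / k`!%:R) * ((ffact_poly k).[y + k%:R] / k`!%:R).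
  rewrite -eta_quad -horner_comp quad_binom_comp hornerM /binom_poly_up horner_comp.
  by rewrite hornerD hornerX hornerC !hornerZ; field.
have h1 := denom_ffact 0 kn; have h2 := denom_ffact k kn; rewrite addr0 in h1.
rewrite expr2 mulrACA; exact: rpredM h1 h2.
Qed.

Lemma dual_hahn_num_int n :
  (2 * lcm_upto n ^ 2 * M n ^ 2)%:R * theta (diff_quot eta (dual_hahn n)) \is a Num.int.
Proof.
rewrite /dual_hahn !linear_sum /= mulr_sumr rpred_sum // => k _.
rewrite [diff_quot _ _]linearZ [theta _]linearZ /= mulrCA.
apply: rpredM; first exact: natr_int.
rewrite /quad_binom linearZ linearZ /= theta_diff_quot_quad_prod.
rewrite mulr_sumr mulr_sumr rpred_sum // => j _; have jk := ltn_ord j; have kn := ltn_ord k.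
pose i := (k.-1 - j)%N; have ijk : (j + i).+1 = k by rewrite /i; lia.
rewrite -/i theta_quad_prod.
have ji : (j + i < n)%N by lia.
have lZ := leibniz_triangle ji; rewrite ijk in lZ.
have i_n : (i <= n)%N by lia.
have h1 := denom_ffact (- j.+1%:Z) i_n; have h2 := denom_ffact k i_n.
rewrite rmorphN /= -pmulrn in h1.
have f0 m : m`!%:R != 0 :> rat by rewrite pnatr_eq0 -lt0n fact_gt0.
set B := _.[_] in h1 *; set C := _.[_] in h2 *.
have -> : (2 * lcm_upto n ^ 2 * M n ^ 2)%:R *
   ((k`!%:R ^+ 2)^-1 * (- 2^-1 * ((-1) ^+ j * j`!%:R ^+ 2) * (B * C))) =
   - (-1) ^+ j * ((lcm_upto n)%:R * (j`! * i`!)%:R / k`!%:R) ^+ 2 *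
   (((M n)%:R * (B / i`!%:R)) * ((M n)%:R * (C / i`!%:R))).
  rewrite !natrM; move: (f0 i) (f0 k) (f0 j).
  move: i`!%:R k`!%:R j`!%:R (M n)%:R (lcm_upto n)%:R => fi fk fj m l fi0 fk0 fj0.
  by field; rewrite fi0 fk0.
apply: rpredM; last exact: rpredM.
by apply: rpredM; [rewrite rpredN rpredX ?rpredN1|exact: rpredX].
Qed.

End MinusThird.

(** With [d n = (n+1)^2 (u (n+1) - u n)] the recurrence reads
    [d (n+1) = d n + eta * u (n+1)]; as [|eta| <= 1], the sequence u grows at most
    linearly. *)
Lemma dual_hahn_recurrence_growth (eta delta : rat) (u : nat -> rat) :
    `|eta| <= 1 -> 0 < delta ->
    (forall n, n.+2%:R ^+ 2 * u n.+2 =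
      ((2 * n.+1 ^ 2 + 2 * n.+1 + 1)%:R + 1 * eta) * u n.+1 + (- 1) * n.+1%:R ^+ 2 * u n) ->
  exists K, forall n, `|u n| <= K * (1 + delta) ^+ n.
Proof.
move=> eta1 d0 u_rec; pose d n := n.+1%:R ^+ 2 * (u n.+1 - u n).
have d_rec n : d n.+1 = d n + eta * u n.+1.
  have -> : d n.+1 = n.+2%:R ^+ 2 * u n.+2 - n.+2%:R ^+ 2 * u n.+1 by rewrite /d mulrBr.
  by rewrite u_rec /d; ring.
pose K := `|u 0%N| + `|u 1%N - u 0%N|.
have K0 : 0 <= K by rewrite addr_ge0.
have bound n : `|u n| <= K * n.+1%:R /\ `|d n| <= K * n.+1%:R ^+ 2.
  elim: n => [|n [un dn]].
    by rewrite /d (_ : 1%:R = 1 :> rat) // expr1n mul1r mulr1 /K lerDl lerDr.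
  have n1 : 0 < n.+1%:R :> rat by rewrite ltr0n.
  have un1 : `|u n.+1| <= K * n.+2%:R.
    have -> : u n.+1 = u n + d n / n.+1%:R ^+ 2.
      by rewrite /d mulrAC divff ?mul1r ?expf_neq0 ?lt0r_neq0 // addrC subrK.
    apply: le_trans (ler_normD _ _) _.
    have -> : K * n.+2%:R = K * n.+1%:R + K by rewrite -[n.+2%:R]natr1; ring.
    apply: lerD => //; rewrite normrM normfV [`|_ ^+ 2|]ger0_norm ?exprn_ge0 ?ler0n //.
    by rewrite ler_pdivrMr ?exprn_gt0.
  split=> //; rewrite d_rec; apply: le_trans (ler_normD _ _) _.
  apply: (@le_trans _ _ (K * n.+1%:R ^+ 2 + K * n.+2%:R)).
    apply: lerD => //; rewrite normrM -[leRHS]mul1r.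
    by apply: ler_pM.
  rewrite -mulrDr ler_wpM2l // -natrX -natrD -natrX ler_nat; lia.
exists (K / delta * (1 + delta)) => n; have [un _] := bound n.
apply: le_trans un _; rewrite -!mulrA ler_wpM2l // -exprS mulrC ler_pdivlMr //.
apply: le_trans (exprn_one_add n.+1 (ltW d0)).
by rewrite mulrC mulr_natr lerDr.
Qed.

(** Here [9 ^ n * M n ^ 2] divides an integer of size [lcm(1..n)^2 * M n ^ 2] times
    the remainder.  The rate 9 comes from the p-adic size of [1 / eta] alone. *)
Lemma irrational_minus_third (p3 : prime 3) (k0 : nat) (E A delta : rat) :
    0 < delta -> (0 < k0)%N -> ((1 + k0%:R^-1) ^+ k0.+1) ^+ 2 <= E -> E < A ->
    A * (1 + delta) ^+ 2 <= 9%:R ->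
  ~ rational_value p3 (- 3%:R^-1).
Proof.
move=> d0 k00 leE ltEA leA [a ya].
have [y yE] : exists y : rat, y = - 3%:R^-1 by exists (- 3%:R^-1).
pose eta := y * (y + 1); have etaE : eta = - (2%:R / 9%:R) by rewrite /eta yE; field.
rewrite -yE in ya; have ta := theta_geom_cvg yE etaE ya.
have eta0 : eta != 0 by rewrite etaE.
have etap := zloc3_eta p3 etaE.
have recN n : n.+1%:R ^+ 2 *: dual_hahn n.+1 =
  (2 * n ^ 2 + 2 * n + 1)%:R *: dual_hahn n + 1 *: ('X * dual_hahn n) +
  (- 1 * n%:R ^+ 2) *: dual_hahn n.-1 := dual_hahn_rec n.
have g0 (n : nat) : 1 != 0 :> rat by [].
have e0 : - 1 != 0 :> rat by [].
have t1 : theta 1 != 0 by rewrite theta1.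
have eta1 : `|eta| <= 1 by rewrite etaE.
have [K1 K1P] := @dual_hahn_recurrence_growth eta delta (fun n => (dual_hahn n).[eta]) eta1 d0
  (fun n => pade_den_rec eta recN n.+1).
have [K2 K2P] := @dual_hahn_recurrence_growth eta delta (fun n => theta (diff_quot eta (dual_hahn n)))
  eta1 d0 (fun n => pade_num_rec eta recN theta_dual_hahn n).
apply: (@pade_contradiction 3 p3 theta eta dual_hahn (fun n => 'X^n)
  (fun n => (2 * n ^ 2 + 2 * n + 1)%:R) (fun=> 1) (- 1) dual_hahn0 recN g0 e0
  theta_dual_hahn t1 eta0 etap _ _ ta (@theta_integral p3) 4%N (zloc_dual_hahn p3)
  (fun n => denom_pow 3 1 n ^ 2)%N (fun n => 2 * (1 * n + logn 3 n`!) + 2 * n)%N 2%N _ _ _ _ isT _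
  E A 9%:R 1 delta k0 d0 _ k00 leE ltEA leA _ _).
- by move=> n; rewrite size_polyXn.
- by move=> n; exact: dual_hahn_den_int.
- by move=> n; exact: dual_hahn_num_int.
- by move=> n; rewrite hornerXn expf_neq0.
- move=> n; rewrite hornerXn.
  have M0 : (denom_pow 3 1 n)%:R != 0 :> rat by rewrite pnatr_eq0 -lt0n denom_pow_gt0.
  have powE : 3%:R ^+ (2 * (1 * n + logn 3 n`!) + 2 * n) = (denom_pow 3 1 n)%:R ^+ 2 * 9%:R ^+ n :> rat.
    by rewrite exprD (mulnC 2 (_ + _)%N) !exprM -!natrX.
  have -> : (2 * lcm_upto n ^ 2 * denom_pow 3 1 n ^ 2)%:R / eta ^+ n /
      3%:R ^+ (2 * (1 * n + logn 3 n`!) + 2 * n) = (2 * lcm_upto n ^ 2)%:R * (- 2%:R^-1) ^+ n.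
    have -> : - 2%:R^-1 = (eta * 9%:R)^-1 by rewrite etaE; field.
    rewrite powE natrM natrX exprVn [(eta * _) ^+ n]exprMn_comm; last exact: mulrC.
    have eta0n : eta ^+ n != 0 by rewrite expf_neq0.
    have nine0n : 9%:R ^+ n != 0 :> rat by rewrite expf_neq0.
    have gen (u v w m : rat) : m != 0 -> v != 0 -> u != 0 ->
        w * m ^+ 2 / u / (m ^+ 2 * v) = w / (u * v).
      by move=> m0 v0 u0; field; rewrite m0 v0 u0.
    exact: gen.
  by rewrite rpredM ?zloc_nat // rpredX // rpredN zloc3_half.
- by move=> n; rewrite expn_gt0 denom_pow_gt0.
- by [].
- move=> n; rewrite mul1r exprD (mulnC 2 (_ + _)%N) !exprM -!natrX.
  by rewrite natrX mulrC.
have KK : forall n, 0 <= (1 + delta) ^+ n by move=> n; rewrite exprn_ge0 // addr_ge0 // ltW.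
exists (`|K1| + `|K2|) => n; split.
  apply: le_trans (K1P n) _; rewrite ler_wpM2r //.
  by rewrite (le_trans (ler_norm _)) // lerDl.
apply: le_trans (K2P n) _; rewrite ler_wpM2r //.
by rewrite (le_trans (ler_norm _)) // lerDr.
Qed.

(** * Irrationality at every fraction whose denominator is a prime power other than 2 *)

Lemma expn_to_nat (a n : BinNums.N) :
  (BinNat.N.to_nat a ^ BinNat.N.to_nat n)%N = BinNat.N.to_nat (BinNat.N.pow a n).
Proof.
rewrite Nnat.N2Nat.inj_pow; elim: (BinNat.N.to_nat n) => //= m <-.
by rewrite expnS multE.
Qed.

(** The powers compared below are out of reach of unary arithmetic, so the comparison
    is transferred to binary numbers. *)
Lemma leq_expn_binary a b c d e f g h :
  (let N := BinNat.N.of_nat in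
   BinNat.N.leb (BinNat.N.mul (BinNat.N.pow (N a) (N b)) (BinNat.N.pow (N c) (N d)))
                (BinNat.N.mul (BinNat.N.pow (N e) (N f)) (BinNat.N.pow (N g) (N h)))) ->
  (a ^ b * c ^ d <= e ^ f * g ^ h)%N.
Proof.
have toN m n : (m ^ n)%N =
    BinNat.N.to_nat (BinNat.N.pow (BinNat.N.of_nat m) (BinNat.N.of_nat n)).
  by rewrite -expn_to_nat !Nnat.Nat2N.id.
move=> /= /BinNat.N.leb_le; rewrite !toN -!multE -!Nnat.N2Nat.inj_mul /BinNat.N.le.
rewrite Nnat.N2Nat.inj_compare.
by move/PeanoNat.Nat.compare_le_iff/ssrnat.leP.
Qed.

Lemma ratio_pow_le (k m n d e : nat) : (0 < m)%N -> (0 < e)%N ->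
  (n ^ (k * 2) * e ^ 1 <= d ^ 1 * m ^ (k * 2))%N ->
  ((n%:R / m%:R) ^+ k) ^+ 2 <= d%:R / e%:R :> rat.
Proof.
move=> m0 e0; rewrite !expn1 => le_pow.
rewrite -exprM expr_div_n ler_pdivrMr ?exprn_gt0 ?ltr0n // mulrAC ler_pdivlMr ?ltr0n //.
by rewrite -!natrX -!natrM ler_nat.
Qed.

(** The numbers [741/100], [743/100] and [149/20] are chosen above [e^2 = 7.389...], close
    enough to stay below the growth rate of [M n] in the tightest case, F = 5, where
    it is at least [5^(156/125) = 7.453...]. *)
Lemma lcm_rate_bounds : exists (k0 : nat) (E A delta : rat),
  [/\ 0 < delta, (0 < k0)%N, ((1 + k0%:R^-1) ^+ k0.+1) ^+ 2 <= E, E < A &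
      A * (1 + delta) ^+ 2 <= 149%:R / 20%:R].
Proof.
have [k0 k0E] : exists k0, k0 = 400%N by exists 400%N.
have k00 : (0 < k0)%N by rewrite k0E.
exists k0, (741%:R / 100%:R), (743%:R / 100%:R), 1000%:R^-1; split; [lra|exact: k00| |lra|lra].
have -> : 1 + k0%:R^-1 = k0.+1%:R / k0%:R :> rat.
  by rewrite -natr1 mulrDl mul1r divff // pnatr_eq0 -lt0n.
by apply: ratio_pow_le => //; rewrite k0E; apply: leq_expn_binary; vm_compute.
Qed.

(** By Legendre's formula this is an equality. *)
Lemma leq_logn_fact_exp (p : nat) : prime p ->
  forall m, (\sum_(i < m) p ^ i <= logn p (p ^ m)`!)%N.
Proof.
move=> p_pr; elim=> [|m IHm]; first by rewrite big_ord0.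
by rewrite big_ord_recr /= addnC expnS (leq_trans _ (leq_logn_fact_mul p_pr _)) // leq_add2l.
Qed.

Lemma denom_pow_lower (p r m e : nat) : prime p -> (e <= r * p ^ m + \sum_(i < m) p ^ i)%N ->
  (149 ^ (p ^ m) * 1 ^ 0 <= p ^ e * 20 ^ (p ^ m))%N ->
  (149%:R / 20%:R) ^+ (p ^ m) <= (denom_pow p r (p ^ m))%:R :> rat.
Proof.
move=> p_pr le_e; rewrite muln1 => le_p.
rewrite expr_div_n ler_pdivrMr ?exprn_gt0 // -!natrX -natrM ler_nat.
rewrite (leq_trans le_p) // leq_mul2r leq_exp2l ?prime_gt1 // (leq_trans le_e) ?orbT //.
by rewrite leq_add2l leq_logn_fact_exp.
Qed.

Lemma prime_pow_cases (p k : nat) : prime p -> (0 < k)%N ->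
  [\/ (8 <= p ^ k)%N, p = 2%N /\ k \in [:: 1; 2]%N, p = 3%N /\ k = 1%N |
      p \in [:: 5; 7]%N /\ k = 1%N].
Proof.
move=> pr_p k0; case: (leqP 8 (p ^ k)) => [|lt8]; first by constructor 1.
have p2 := prime_gt1 pr_p.
have lt_p : (p < 8)%N.
  by apply: leq_ltn_trans lt8; rewrite -{1}[p]expn1 leq_exp2l.
have lt_k : (k < 3)%N.
  rewrite ltnNge; apply: contraL lt8 => k3; rewrite -leqNgt.
  by apply: (@leq_trans (2 ^ 3)) => //; rewrite (@leq_trans (p ^ 3)) ?leq_exp2r ?leq_exp2l.
case: k k0 lt_k lt8 => [|[|[|]]] //= _ _ lt8; move: p lt_p pr_p lt8 {p2}.
  case=> [|[|[|[|[|[|[|[|]]]]]]]] // _ _ _; try by constructor 2.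
  - by constructor 3.
  - by constructor 4.
  - by constructor 4.
by case=> [|[|[|[|[|[|[|[|]]]]]]]] // _ _ _; constructor 2.
Qed.

Lemma rational_value_shift_frac (p : nat) (p_pr : prime p) (r : nat) (b : int) (m : nat) :
  (0 < r)%N -> ~~ (p %| b)%Z ->
  rational_value p_pr (b%:~R / (p ^ r)%:R) ->
  rational_value p_pr ((b + m%:Z * (p ^ r)%:Z)%:~R / (p ^ r)%:R).
Proof.
move=> r0 pb yb; elim: m => [|m IHm]; first by rewrite mul0r addr0.
have pc (n : nat) : ~~ (p %| b + n%:Z * (p ^ r)%:Z)%Z.
  apply: contra pb => pbn.
  by rewrite -[b](addrK (n%:Z * (p ^ r)%:Z)) rpredB // dvdz_mull // dvdzE /= dvdn_exp.
have SE : (b + m.+1%:Z * (p ^ r)%:Z)%:~R / (p ^ r)%:R =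
    (b + m%:Z * (p ^ r)%:Z)%:~R / (p ^ r)%:R + 1 :> rat.
  have F0 : (p ^ r)%:R != 0 :> rat by rewrite pnatr_eq0 -lt0n expn_gt0 prime_gt0.
  have -> : b + m.+1%:Z * (p ^ r)%:Z = (b + m%:Z * (p ^ r)%:Z) + (p ^ r)%:Z.
    by rewrite -addn1 PoszD mulrDl mul1r addrA.
  by rewrite rmorphD /= mulrDl -pmulrn divff.
rewrite SE; apply: rational_value_shift => //; rewrite -?SE.
- exact: frac_neq0.
- exact: frac_neq0.
- exact: frac_inv_zloc.
- exact: frac_inv_zloc.
Qed.

Lemma rational_value_reflect_frac (p : nat) (p_pr : prime p) (r : nat) (b : int) :
  (0 < r)%N -> ~~ (p %| b)%Z ->
  rational_value p_pr (b%:~R / (p ^ r)%:R) ->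
  rational_value p_pr ((- b - (p ^ r)%:Z)%:~R / (p ^ r)%:R).
Proof.
move=> r0 pb.
have pc : ~~ (p %| - b - (p ^ r)%:Z)%Z.
  apply: contra pb => pbn; rewrite -rpredN -[- b](subrK (p ^ r)%:Z) rpredD //.
  by rewrite dvdzE /= dvdn_exp.
have RE : (- b - (p ^ r)%:Z)%:~R / (p ^ r)%:R = - 1 - b%:~R / (p ^ r)%:R :> rat.
  have F0 : (p ^ r)%:R != 0 :> rat by rewrite pnatr_eq0 -lt0n expn_gt0 prime_gt0.
  by rewrite rmorphB rmorphN /= mulrBl mulNr -pmulrn divff // addrC.
rewrite RE; apply: rational_value_reflect; rewrite -?RE.
- exact: frac_neq0.
- exact: frac_neq0.
- exact: frac_inv_zloc.
- exact: frac_inv_zloc.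
Qed.

(** Shifts go upwards; conjugated by the reflection they go downwards.  The
    reflection also exchanges the classes of 1 and 2 modulo 3. *)
Lemma rational_value_minus_third (p3 : prime 3) (b : int) : ~~ (3 %| b)%Z ->
  rational_value p3 (b%:~R / (3 ^ 1)%:R) -> rational_value p3 (- 3%:R^-1).
Proof.
have up (c : int) : (c <= -1)%R -> (c %% 3 = 2)%Z ->
    rational_value p3 (c%:~R / (3 ^ 1)%:R) -> rational_value p3 (- 3%:R^-1).
  move=> cN c2 yc.
  have c3 : ~~ (3 %| c)%Z by apply/negP => /dvdz_mod0P; rewrite c2.
  have [m mE] : exists m : nat, -1 = c + m%:Z * (3 ^ 1)%:Z.
    by exists `|((-1 - c) %/ 3)%Z|%N; lia.
  have := @rational_value_shift_frac 3 p3 1 _ m isT c3 yc.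
  by rewrite -mE rmorphN1 mulN1r.
have down (c : int) : ~~ (3 %| c)%Z ->
    rational_value p3 (c%:~R / (3 ^ 1)%:R) -> exists2 d : int, (d <= -1)%R /\ (d %% 3 = c %% 3)%Z &
    rational_value p3 (d%:~R / (3 ^ 1)%:R).
  move=> c3 yc; pose m := `|c|%N.
  have rc : ~~ (3 %| - c - (3 ^ 1)%:Z)%Z by lia.
  have := @rational_value_shift_frac 3 p3 1 _ m isT rc (@rational_value_reflect_frac 3 p3 1 _ isT c3 yc).
  have rmc : ~~ (3 %| - c - (3 ^ 1)%:Z + m%:Z * (3 ^ 1)%:Z)%Z by lia.
  move=> /(@rational_value_reflect_frac 3 p3 1 _ isT rmc) yd.
  by exists (- (- c - (3 ^ 1)%:Z + m%:Z * (3 ^ 1)%:Z) - (3 ^ 1)%:Z) => //; rewrite /m; lia.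
move=> b3 yb.
have [b2|b1] : (b %% 3 = 2)%Z \/ (b %% 3 = 1)%Z by lia.
  by have [d [dN d2] yd] := down b b3 yb; apply: up yd; rewrite ?d2.
have rb : ~~ (3 %| - b - (3 ^ 1)%:Z)%Z by lia.
have [d [dN d2] yd] := down _ rb (@rational_value_reflect_frac 3 p3 1 _ isT b3 yb).
by apply: up yd; rewrite ?d2 //; lia.
Qed.

(** For F at least 8 the factor [F ^ n] of [M n] is large enough.  For F = 4, 5, 7
    the contribution of [n!] is needed, and it is measured at n = 16, 125 and 7. *)
Lemma irrational_resolvent (p : nat) (p_pr : prime p) (k : nat) (b : int) :
    (0 < k)%N -> (p ^ k <> 2)%N -> ~~ (p %| b)%Z ->
  ~ rational_value p_pr (b%:~R / (p ^ k)%:R).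
Proof.
move=> k0 F2 pb.
have [c [E [A [delta [d0 c0 leE ltEA leAY]]]]] := lcm_rate_bounds.
(* e is a lower bound for the exponent of p in [M (p ^ m)]. *)
have main (m e : nat) : (e <= k * p ^ m + \sum_(i < m) p ^ i)%N ->
    (149 ^ (p ^ m) * 1 ^ 0 <= p ^ e * 20 ^ (p ^ m))%N ->
    ~ rational_value p_pr (b%:~R / (p ^ k)%:R).
  move=> em le149; have T0 : (0 < p ^ m)%N by rewrite expn_gt0 prime_gt0.
  exact: (irrational_of_lcm_bound k0 pb d0 c0 leE ltEA leAY T0 (denom_pow_lower p_pr em le149)).
have [F8|[pE]|[pE kE]|[p57 kE]] := prime_pow_cases p_pr k0.
- refine (main 0%N k _ _); first by rewrite muln1 leq_addr.
  by rewrite !expn1 muln1; apply: (@leq_trans (8 * 20)); rewrite ?leq_mul2r ?F8 ?orbT.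
- rewrite !inE => /orP[/eqP kE|/eqP kE]; first by case: F2; rewrite pE kE.
  refine (main 4%N 47%N _ _); rewrite pE ?kE; first by rewrite !big_ord_recr big_ord0.
  by apply: leq_expn_binary; vm_compute.
- move: p_pr pb {main F2}; rewrite pE kE => p3 pb /(rational_value_minus_third pb).
  apply: (irrational_minus_third d0 c0 leE ltEA).
  by apply: le_trans leAY _; rewrite ler_pdivrMr ?ltr0n // -natrM ler_nat.
move: p57; rewrite !inE => /orP[/eqP pE|/eqP pE].
- refine (main 3%N 156%N _ _); rewrite pE ?kE; first by rewrite !big_ord_recr big_ord0.
  by apply: leq_expn_binary; vm_compute.
- refine (main 1%N 8%N _ _); rewrite pE ?kE; first by rewrite !big_ord_recr big_ord0.
  by apply: leq_expn_binary; vm_compute.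
Qed.

(** * Units of Z_p and the Teichmüller character *)

Section PadicIntegers.
Variables (p : nat) (p_pr : prime p).
Local Notation Zp := (padic_int p_pr).
Implicit Types (x y z : Zp) (n : nat).

Lemma residue0 n : (0 : Zp) n = 0%N. Proof. exact: mod0n. Qed.

Lemma residueD x y n : (x + y) n = ((x n + y n) %% p ^ n)%N. Proof. by []. Qed.

Lemma residueM x y n : (x * y) n = ((x n * y n) %% p ^ n)%N. Proof. by []. Qed.

Lemma residue_reduce f fP n : (@reduce p p_pr f fP) n = (f n %% p ^ n)%N.
Proof. by []. Qed.

(** The residues of the quotient are obtained by dividing those of x, further up in
    the inverse system, by [p ^ n]. *)
Lemma residue_eq0_dvd n x : x n = 0%N -> exists z, x = p%:R ^+ n * z.
Proof.
move=> xn0.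
have xdvd m : (p ^ n %| x (m + n)%N)%N.
  by rewrite /dvdn residue_le ?leq_addl // xn0.
have zP m : (x (m + n) %/ p ^ n = x (m.+1 + n) %/ p ^ n %[mod p ^ m])%N.
  by rewrite -(residue_le x (leqnSn (m + n))) addSn expnD -modn_divl modn_mod.
exists (reduce p_pr zP); apply: residue_inj => m.
rewrite -natrX residueM residue_natr modnMml residue_reduce modnMmr mulnC divnK //.
by rewrite residue_le // leq_addr.
Qed.

(** By Euler's theorem, the inverse modulo [p ^ n] of a number prime to p is one of
    its powers. *)
Lemma padic_int_unitE x : x 1%N != 0%N -> x \in GRing.unit.
Proof.
move=> x1.
have xp n : coprime (x n) (p ^ n).
  case: n => [|n]; first by rewrite expn0 coprimen1.
  rewrite coprimeXr // coprime_sym prime_coprime //; apply: contra x1 => px.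
  by rewrite -(residue_le x (ltn0Sn n)) expn1 -/(dvdn _ _).
pose y n := (x n ^ (totient (p ^ n)).-1)%N.
have yx n : (y n * x n = 1 %[mod p ^ n])%N.
  rewrite /y mulnC -expnS prednK ?totient_gt0 ?expn_gt0 ?prime_gt0 //.
  exact: Euler_exp_totient.
have yx' n : (y n.+1 * x n = 1 %[mod p ^ n])%N.
  have := congr1 (fun t => t %% p ^ n)%N (yx n.+1).
  by rewrite !modn_dvdm ?dvdn_exp2l // -modnMmr -residueP.
have yP n : (y n = y n.+1 %[mod p ^ n])%N.
  rewrite -[y n in LHS]muln1 -modnMmr -(yx' n) modnMmr mulnCA -modnMmr yx modnMmr.
  by rewrite muln1.
apply/asboolP; exists (reduce p_pr yP); apply: residue_inj => n.
by rewrite residueM residue_reduce modnMml yx.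
Qed.

Lemma residue_int_eq0 (m : int) n : ((m%:~R : Zp) n == 0%N) = (p ^ n %| `|m|)%N.
Proof.
suff nat_case k : ((k%:R : Zp) n == 0%N) = (p ^ n %| k)%N.
  case: m => k; first by rewrite -pmulrn nat_case.
  have -> : `|Negz k|%N = k.+1 by [].
  rewrite NegzE mulrNz -pmulrn -nat_case; set x := k.+1%:R.
  have opp0 (t : Zp) : t n = 0%N -> (- t) n = 0%N.
    by move=> t0; rewrite -[RHS](residue0 n) -(subrr t) [RHS]residueD t0 add0n residue_mod.
  by apply/eqP/eqP => t0; have := opp0 _ t0; rewrite ?opprK.
by rewrite residue_natr.
Qed.

Lemma padic_natr_neq0 (k : nat) : (0 < k)%N -> (k%:R : Zp) != 0.
Proof.
move=> k0; apply/eqP => /(congr1 (fun x : Zp => x k)); rewrite residue0 => /eqP.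
rewrite [k%:R]pmulrn residue_int_eq0 absz_nat gtnNdvd // ltn_expl //.
exact: prime_gt1.
Qed.

Lemma padic_coset_of_residue (x : Zp) (m : int) n :
  (x n = (m%:~R : Zp) n) -> exists z, x - m%:~R = p%:R ^+ n * z.
Proof.
move=> xm; apply: residue_eq0_dvd; rewrite residueD xm -residueD subrr; exact: residue0.
Qed.

(** The root of unity is the limit of the [c ^ (p ^ n)], for c in the class of m. *)
Lemma teichmuller_odd_exists (m : int) : odd p -> ~~ (p %| m)%Z ->
  exists w : Zp, w ^+ p.-1 = 1 /\ exists z : Zp, w - m%:~R = p%:R * z.
Proof.
move=> p_odd pm; pose c := `|(m %% p)%Z|%N.
have cE : (m %% p)%Z = c%:Z by rewrite /c gez0_abs // modz_ge0 // -lt0n prime_gt0.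
have pc : coprime c p.
  rewrite coprime_sym prime_coprime //; apply: contra pm => pc.
  by rewrite (divz_eq m p) rpredD ?dvdz_mull // cE.
have tot n k : (c ^ (p ^ n * p.-1 * k) = 1 %[mod p ^ n])%N.
  case: n => [|n]; first by rewrite expn0 !modn1.
  have -> : (p ^ n.+1 * p.-1 * k = totient (p ^ n.+1) * (p * k))%N.
    by rewrite totient_pfactor //= expnS; ring.
  rewrite expnM -modnXm Euler_exp_totient ?coprimeXr // modnXm exp1n //.
have wP n : (c ^ (p ^ n) = c ^ (p ^ n.+1) %[mod p ^ n])%N.
  have -> : (p ^ n.+1 = p ^ n + p ^ n * p.-1 * 1)%N.
    by rewrite expnS muln1 -{1}(prednK (prime_gt0 p_pr)) mulSn mulnC.
  by rewrite expnD -modnMmr tot modnMmr muln1.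
pose w := reduce p_pr wP.
have wX k n : (w ^+ k) n = ((c ^ (p ^ n)) ^ k %% p ^ n)%N.
  elim: k => [|k IHk]; first by rewrite expr0 expn0.
  by rewrite exprS residueM IHk residue_reduce modnMml modnMmr expnS.
exists w; split.
  by apply: residue_inj => n; rewrite wX -expnM -[X in (c ^ X)%N]muln1 tot.
have [z zE] : exists z, w - m%:~R = p%:R ^+ 1 * z; last by exists z; rewrite zE expr1.
apply: padic_coset_of_residue.
have -> : (m%:~R : Zp) = c%:R + p%:R * (m %/ p)%Z%:~R.
  by rewrite {1}(divz_eq m p) cE addrC rmorphD rmorphM /= -!pmulrn mulrC.
rewrite residueD residue_natr residueM residue_natr expn1 modnn mul0n mod0n addn0 modn_mod.
rewrite residue_reduce expn1.
have -> : (c ^ p = c * c ^ totient p)%N by rewrite totient_prime // -expnS prednK ?prime_gt0.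
by rewrite -modnMmr Euler_exp_totient // modnMmr muln1.
Qed.

(** Only this congruence links the character to the zeta value. *)
Lemma teichmuller_congr (m : int) : ~~ (p %| m)%Z ->
  exists z : Zp, teichmuller p_pr m - m%:~R = p%:R * z.
Proof.
move=> pm; rewrite /teichmuller (negPf pm); case: eqVneq => [p2|p2]; last first.
  have p_odd : odd p by case: (even_prime p_pr) p2 => // ->.
  have [w wP] := teichmuller_odd_exists p_odd pm.
  by have [] := @getPex _ [set w : Zp | w ^+ p.-1 = 1 /\ exists z : Zp, w - m%:~R = p%:R * z]
    (ex_intro _ w wP).
have sgnz (k : int) : (-1) ^ k = 1 :> Zp \/ (-1) ^ k = -1 :> Zp.
  have sgn (n : nat) : (-1) ^+ n = 1 :> Zp \/ (-1) ^+ n = -1 :> Zp.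
    by rewrite -signr_odd; case: (odd n); [right|left].
  case: k => n; first exact: (sgn n).
  rewrite NegzE -exprnN; have [->|->] := sgn n.+1; first by left; rewrite invr1.
  by right; rewrite invrN1.
have pm2 : ~~ (2 %| m)%Z by move: pm; rewrite p2.
have [e [eE em]] : exists e : int, (-1) ^ ((m - 1) %/ 2)%Z = e%:~R :> Zp /\ (2 %| e - m)%Z.
  have [->|->] := sgnz ((m - 1) %/ 2)%Z; first by exists 1; split => //; lia.
  by exists (-1); split => //; lia.
have [q qE] : exists q, e - m = q * p%:Z by have /dvdzP[q qE] := em; exists q; rewrite p2.
by rewrite eE; exists q%:~R; rewrite -rmorphB qE rmorphM /= mulrC.
Qed.

Lemma teichmuller_unit (m : int) : ~~ (p %| m)%Z -> teichmuller p_pr m \in GRing.unit.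
Proof.
move=> pm; have [z zE] := teichmuller_congr pm; apply: padic_int_unitE.
have -> : teichmuller p_pr m = m%:~R + p%:R * z by rewrite -zE addrC subrK.
rewrite residueD residueM residue_natr expn1 modnn mul0n mod0n addn0 -[X in (_ %% X)%N]expn1 residue_mod.
by rewrite residue_int_eq0 expn1; move: pm; rewrite dvdzE.
Qed.
End PadicIntegers.

(** * Rational numbers in Q_p *)

Section RatrPadic.
Variables (p : nat) (p_pr : prime p).
Local Notation Zp := (padic_int p_pr).
Local Notation Qp := (padic p_pr).
Local Notation ratp := (ratr : rat -> Qp).

Lemma padic_of_int_natr n : padic_of_int (n%:R : Zp) = n%:R.
Proof. exact: rmorph_nat. Qed.

Lemma padic_intr_neq0 (m : int) : m != 0 -> (m%:~R : Qp) != 0.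
Proof.
have nat_case n : (0 < n)%N -> (n%:R : Qp) != 0.
  move=> n0; rewrite -padic_of_int_natr /padic_of_int tofrac_eq0.
  exact: padic_natr_neq0.
case: m => n n0; first by rewrite -pmulrn nat_case // lt0n.
by rewrite NegzE mulrNz oppr_eq0 -pmulrn nat_case.
Qed.

(** As Q_p has characteristic 0, [ratr] can be computed on fractions that are not
    reduced; that it is a morphism of fields follows. *)
Lemma ratr_frac (m n : int) : n != 0 -> ratp (m%:~R / n%:~R) = m%:~R / n%:~R.
Proof.
move=> n0; set r := m%:~R / n%:~R.
rewrite /ratr; apply/eqP; rewrite eqr_div ?padic_intr_neq0 ?denq_neq0 //.
rewrite -!rmorphM /= /r; apply/eqP; congr (_%:~R); apply/eqP; rewrite -(eqr_int rat).
rewrite !rmorphM /= -/r numqE /r; apply/eqP.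
have n0' : n%:~R != 0 :> rat by rewrite intr_eq0.
by move: (denq _)%:~R => d; field.
Qed.

Lemma ratr_padicD (x y : rat) : ratp (x + y) = ratp x + ratp y.
Proof.
rewrite -[x]divq_num_den -[y]divq_num_den; move: (numq x) (denq x) (denq_neq0 x) => a b b0.
move: (numq y) (denq y) (denq_neq0 y) => c d d0.
have q0 (e : int) : e != 0 -> e%:~R != 0 :> rat by rewrite intr_eq0.
rewrite addf_div ?q0 // -!rmorphM -rmorphD /= !ratr_frac ?mulf_neq0 //.
by rewrite addf_div ?padic_intr_neq0 // rmorphD !rmorphM.
Qed.

Lemma ratr_padicM (x y : rat) : ratp (x * y) = ratp x * ratp y.
Proof.
rewrite -[x]divq_num_den -[y]divq_num_den; move: (numq x) (denq x) (denq_neq0 x) => a b b0.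
move: (numq y) (denq y) (denq_neq0 y) => c d d0.
rewrite mulf_div -!rmorphM /= !ratr_frac ?mulf_neq0 //.
by rewrite mulf_div !rmorphM.
Qed.

Lemma ratr_padic_int (m : int) : ratp m%:~R = m%:~R.
Proof. by rewrite -[m%:~R in LHS]divr1 (ratr_frac m (oner_neq0 _)) divr1. Qed.

Lemma ratr_padic_nat n : ratp n%:R = n%:R.
Proof. by rewrite pmulrn ratr_padic_int -pmulrn. Qed.

Lemma ratr_padicN (x : rat) : ratp (- x) = - ratp x.
Proof. by rewrite -mulN1r ratr_padicM (ratr_padic_int (-1)) mulN1r. Qed.

Lemma ratr_padicX (x : rat) n : ratp (x ^+ n) = ratp x ^+ n.
Proof.
elim: n => [|n IHn]; first by rewrite !expr0 (ratr_padic_nat 1).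
by rewrite !exprS ratr_padicM IHn.
Qed.

Lemma ratr_padic_sum (I : Type) (s : seq I) (P : pred I) (F : I -> rat) :
  ratp (\sum_(i <- s | P i) F i) = \sum_(i <- s | P i) ratp (F i).
Proof.
apply: (big_morph ratp); first exact: ratr_padicD.
exact: (ratr_padic_nat 0).
Qed.

Lemma ratr_padic_zloc (w : rat) : w \in zloc p_pr -> exists z : Zp, ratp w = padic_of_int z.
Proof.
case/zlocP=> m [d [pd wE]].
have dU : (d%:R : Zp) \in GRing.unit.
  apply: padic_int_unitE; rewrite residue_natr expn1; exact: pd.
have d0 : (d%:R : Zp) != 0 by apply: contraTneq dU => ->; rewrite unitr0.
exists (m%:~R / d%:R).
have dQ0 : (d%:R : Qp) != 0 by rewrite -padic_of_int_natr /padic_of_int tofrac_eq0.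
apply: (mulIf dQ0); rewrite -{1}ratr_padic_nat -ratr_padicM wE ratr_padic_int.
by rewrite -padic_of_int_natr /padic_of_int -rmorphM /= divrK // rmorph_int.
Qed.

(** If p divided the reduced denominator, it would divide the numerator too. *)
Lemma zloc_ratr_padic (w : rat) (z : Zp) : ratp w = padic_of_int z -> w \in zloc p_pr.
Proof.
move=> wz; apply: contraT => pw.
have wE : ratp w * (denq w)%:~R = (numq w)%:~R.
  by rewrite /ratr divfK // padic_intr_neq0 // denq_neq0.
have zE : z * (denq w)%:~R = (numq w)%:~R.
  by apply/eqP; rewrite -(tofrac_eq (R := Zp)) rmorphM /= !rmorph_int -wE wz.
move: pw; rewrite inE negbK => pd.
have /eqP d1 : ((denq w)%:~R : Zp) 1%N == 0%N by rewrite residue_int_eq0 expn1.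
have : ((numq w)%:~R : Zp) 1%N == 0%N by rewrite -zE residueM d1 muln0 mod0n.
rewrite residue_int_eq0 expn1 => pn.
have := coprime_num_den w; rewrite /coprime => /eqP g1.
have : (p %| gcdn `|numq w| `|denq w|)%N by rewrite dvdn_gcd pn.
by rewrite g1 dvdn1 => /eqP p1; have := prime_gt1 p_pr; rewrite p1.
Qed.

End RatrPadic.

(** * Limits in Q_p *)

Section PadicLimits.
Variables (p : nat) (p_pr : prime p).
Local Notation Zp := (padic_int p_pr).
Local Notation Qp := (padic p_pr).
Local Notation ratp := (ratr : rat -> Qp).

(** The n-th residue of the limit is that of the n-th term. *)
Lemma padic_int_limit (z : nat -> Zp) :
  (forall J, exists t, z J.+1 - z J = p%:R ^+ J * t) ->
  exists x, forall J, exists t, z J - x = p%:R ^+ J * t.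
Proof.
move=> zP.
have zE J : (z J) J = (z J.+1) J.
  have [t /(canRL (subrK _)) ->] := zP J.
  rewrite residueD residueM -natrX residue_natr modnn mul0n mod0n add0n.
  by rewrite residue_mod.
have xP J : ((z J) J = (z J.+1) J.+1 %[mod p ^ J])%N.
  by rewrite -residueP residue_mod -zE.
exists (reduce p_pr xP) => J; apply: residue_eq0_dvd.
have e : (reduce p_pr xP) J = (z J) J by rewrite residue_reduce residue_mod.
rewrite residueD -e -residueD subrr; exact: residue0.
Qed.

Lemma padic_complete (u : nat -> rat) (c : nat) :
  (p%:R ^+ c * u 0%N \in zloc p_pr) ->
  (forall J, p%:R ^+ c * (u J.+1 - u J) / p%:R ^+ J \in zloc p_pr) ->
  exists x, forall J, exists z : Zp, p%:R ^+ c * (ratp (u J) - x) = padic_of_int (p%:R ^+ J * z).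
Proof.
move=> u0 uS.
have pn0 n : p%:R ^+ n != 0 :> rat by rewrite expf_neq0 // pnatr_eq0 -lt0n prime_gt0.
have pQ0 n : p%:R ^+ n != 0 :> Qp.
  by rewrite expf_neq0 // (padic_intr_neq0 p_pr (m := p%:Z)) // eqz_nat -lt0n prime_gt0.
have uZ J : p%:R ^+ c * u J \in zloc p_pr.
  elim: J => // J IHJ.
  have -> : p%:R ^+ c * u J.+1 = p%:R ^+ c * (u J.+1 - u J) / p%:R ^+ J * p%:R ^+ J + p%:R ^+ c * u J.
    by rewrite divfK //; ring.
  by rewrite rpredD // rpredM // rpredX // zloc_nat.
have [z zE] := choice (fun J => ratr_padic_zloc (uZ J)).
have [|x xP] := @padic_int_limit z.
  move=> J; have [t tE] := ratr_padic_zloc (uS J); exists t.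
  apply/eqP; rewrite -(tofrac_eq (R := Zp)) rmorphM rmorphB rmorphXn rmorph_nat /=.
  apply/eqP; rewrite -![tofrac _]/(padic_of_int _) -!zE -tE -!ratr_padic_nat -ratr_padicX -ratr_padicM.
  by rewrite -ratr_padicN -ratr_padicD [in RHS]mulrC divfK // mulrBr.
exists (padic_of_int x / p%:R ^+ c) => J; have [t tE] := xP J; exists t.
rewrite -tE /padic_of_int rmorphB /= mulrBr [X in _ - X = _]mulrC (divfK (pQ0 c)).
by rewrite -[tofrac (z J)]/(padic_of_int _) -zE ratr_padicM ratr_padicX ratr_padic_nat.
Qed.

Lemma padic_cvgn (f : nat -> Qp) (x : Qp) (c : nat) :
  (forall J, exists z : Zp, p%:R ^+ c * (f J - x) = padic_of_int (p%:R ^+ J * z)) ->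
  limn f = x.
Proof.
move=> fx; apply: cvg_lim; first exact: padic_hausdorff.
move=> A [n nA]; exists (n + c)%N => // J /= nJ; apply: nA.
have [z zE] := fx J; exists (p%:R ^+ (J - c - n) * z).
have pQ0 : p%:R ^+ c != 0 :> Qp.
  by rewrite expf_neq0 // (padic_intr_neq0 p_pr (m := p%:Z)) // eqz_nat -lt0n prime_gt0.
rewrite -[f J](subrK x) addrC; congr (_ + _); apply: (mulfI pQ0).
rewrite zE.
have -> : p%:R ^+ c = padic_of_int (p%:R ^+ c) :> Qp.
  by rewrite /padic_of_int rmorphXn rmorph_nat.
rewrite /padic_of_int -rmorphM; congr tofrac.
by rewrite !mulrA -!exprD; congr (_ ^+ _ * _); lia.
Qed.

End PadicLimits.

(** * The zeta value at 2 as a Bernoulli series *)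

Lemma padic_cvg_limn (p : nat) (p_pr : prime p) (u : nat -> rat) (b : rat) :
  padic_cvg p_pr u b -> limn (fun J => ratr (u J) : padic p_pr) = ratr b.
Proof.
move=> [c uc]; apply: (@padic_cvgn p p_pr _ _ c) => J.
have [z zE] := ratr_padic_zloc (uc J); exists z.
have pn0 : p%:R ^+ J != 0 :> rat by rewrite expf_neq0 // pnatr_eq0 -lt0n prime_gt0.
have pE n : p%:R ^+ n = ratr (p%:R ^+ n) :> padic p_pr by rewrite ratr_padicX ratr_padic_nat.
rewrite pE -ratr_padicN -ratr_padicD -ratr_padicM /padic_of_int rmorphM /= -[tofrac z]/(padic_of_int z) -zE.
by rewrite rmorphXn rmorph_nat /= pE -ratr_padicM [in RHS]mulrC divfK.
Qed.

Section HurwitzAtTwo.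
Variables (p : nat) (p_pr : prime p).
Local Notation Zp := (padic_int p_pr).
Local Notation Qp := (padic p_pr).
Local Notation ratp := (ratr : rat -> Qp).
Local Notation pint := (@padic_of_int p p_pr).

Lemma exponent_at_two : pint (1 - 2%:R) = - 1.
Proof. by rewrite mulr2n opprD addNKr /padic_of_int rmorphN1. Qed.

Lemma padic_fact_neq0 j : (j`!%:R : Qp) != 0.
Proof. by rewrite (padic_intr_neq0 p_pr (m := j`!%:Z)) // eqz_nat -lt0n fact_gt0. Qed.

Lemma padic_binomN1 j : padic_binom (- 1 : Qp) j = (- 1) ^+ j.
Proof.
suff e : \prod_(i < j) (- 1 - i%:R) = (- 1) ^+ j * j`!%:R :> Qp.
  by rewrite /padic_binom e mulfK // padic_fact_neq0.
elim: j => [|j IHj]; first by rewrite big_ord0 mul1r.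
by rewrite big_ord_recr /= IHj factS natrM exprS -natr1; ring.
Qed.

Variable (a : int).
Hypothesis pa : ~~ (p %| a)%Z.

Lemma teichmuller_neq0 : pint (teichmuller p_pr a) != 0.
Proof.
rewrite /padic_of_int tofrac_eq0; apply: contraTneq (teichmuller_unit p_pr pa) => ->.
by rewrite unitr0.
Qed.

Lemma padic_num_neq0 : (a%:~R : Qp) != 0.
Proof. by apply: padic_intr_neq0; apply: contraNneq pa => ->; rewrite dvdz0. Qed.

(** The binomial coefficients of -1 are signs, so the binomial series is the
    geometric series of [1 / u] in powers of [1 - u], a multiple of p. *)
Lemma padic_powN1_angle : padic_pow (angle p_pr a) (1 - 2%:R) = (angle p_pr a)^-1.
Proof.
set u := angle p_pr a; set w := teichmuller p_pr a.
have wU : w \in GRing.unit := teichmuller_unit p_pr pa.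
have aU : (a%:~R : Zp) \in GRing.unit.
  by apply: padic_int_unitE; rewrite residue_int_eq0 expn1; move: pa; rewrite dvdzE.
have [z zE] := teichmuller_congr p_pr pa.
have uE : u = pint (w^-1 * a%:~R).
  rewrite /u /angle /padic_of_int rmorphM rmorph_int /=; congr (_ * _).
  apply: (mulfI teichmuller_neq0); rewrite divff ?teichmuller_neq0 // /padic_of_int -rmorphM /=.
  by rewrite mulrV // rmorph1.
have u0 : u != 0 by rewrite /u /angle mulf_neq0 ?invr_neq0 ?teichmuller_neq0 ?padic_num_neq0.
have uVE : u^-1 = pint (w * a%:~R^-1).
  apply: (mulfI u0); rewrite divff // uE /padic_of_int -rmorphM /=.
  by rewrite mulrACA mulVr // mul1r mulrV // rmorph1.
have d1E : 1 - u = pint (p%:R * (w^-1 * z)).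
  by rewrite mulrCA -zE mulrBr mulVr // /padic_of_int rmorphB rmorph1 uE.
have geomE J : \sum_(0 <= j < J) (1 - u) ^+ j = u^-1 - u^-1 * (1 - u) ^+ J.
  elim: J => [|J IHJ]; first by rewrite big_nil expr0 mulr1 subrr.
  rewrite big_nat_recr //= IHJ exprS [in RHS]mulrA mulrBr mulr1 mulVf // mulrBl mul1r.
  by rewrite opprB addrA addrAC.
rewrite /padic_pow; apply: (@padic_cvgn p p_pr _ _ 0%N) => J.
exists (- (w * a%:~R^-1) * (w^-1 * z) ^+ J).
rewrite expr0 mul1r /series /=.
under eq_bigr => j _ do rewrite exponent_at_two padic_binomN1 -exprMn mulN1r opprB.
rewrite geomE addrAC subrr add0r d1E uVE /padic_of_int -rmorphXn -rmorphM -rmorphN /=.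
by congr tofrac; rewrite exprMn; ring.
Qed.

Lemma hurwitz_term (F : nat) j : (0 < F)%N ->
  padic_binom (pint (1 - 2%:R)) j * ratp (bernoulli j) * (F%:R / a%:~R) ^+ j =
  ratp (bernoulli j * (((- a)%:~R / F%:R)^-1) ^+ j).
Proof.
move=> F0; have a0 : a != 0 by apply: contraNneq pa => ->; rewrite dvdz0.
have -> : (((- a)%:~R / F%:R)^-1) = - 1 * (F%:Z%:~R / a%:~R) :> rat.
  by rewrite invf_div mulrNz invrN mulrN mulN1r -pmulrn.
rewrite ratr_padicM ratr_padicX ratr_padicM ratr_frac // ratr_padicN (ratr_padic_nat _ 1).
by rewrite exponent_at_two padic_binomN1 -pmulrn [in RHS]exprMn mulrAC [LHS]mulrC.
Qed.

Lemma volkenborn_geom (y : rat) J : y != 0 ->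
  y * L (geom_poly y J) = \sum_(0 <= j < J) bernoulli j * y^-1 ^+ j.
Proof.
move=> y0; rewrite /geom_poly raddf_sum /= mulr_sumr big_mkord; apply: eq_bigr => j _.
by rewrite linearZ /= volkenbornXn exprS mulrA mulrA mulfV // mul1r mulrC.
Qed.

Variables (r : nat).
Hypothesis r_gt0 : (0 < r)%N.
Local Notation F := (p ^ r)%N.
Local Notation y := ((- a)%:~R / (p ^ r)%:R : rat).

Lemma ndvdz_opp : ~~ (p %| - a)%Z. Proof. by rewrite dvdzE abszN -dvdzE. Qed.

Lemma minus_frac_neq0 : y != 0. Proof. exact: (frac_neq0 p_pr r ndvdz_opp). Qed.

Lemma hurwitz_seriesE J :
  series (fun j => padic_binom (pint (1 - 2%:R)) j * ratp (bernoulli j) * (F%:R / a%:~R) ^+ j) J =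
  ratp (y * L (geom_poly y J)).
Proof.
rewrite (volkenborn_geom _ minus_frac_neq0) ratr_padic_sum /series /=; apply: eq_bigr => j _.
by rewrite hurwitz_term // expn_gt0 prime_gt0.
Qed.

Lemma hurwitz_two : hurwitz_zeta (2%:R : Zp) a F =
  pint (teichmuller p_pr a) / (F%:R * a%:~R) *
  limn (fun J => ratp (y * L (geom_poly y J))).
Proof.
rewrite /hurwitz_zeta padic_powN1_angle.
have -> : series (fun j => padic_binom (pint (1 - 2%:R)) j * ratp (bernoulli j) * (F%:R / a%:~R) ^+ j) =
    (fun J => ratp (y * L (geom_poly y J))).
  by apply/funext => J; exact: hurwitz_seriesE.
congr (_ * _).
have -> : (2%:R : Zp) - 1 = 1 by rewrite mulr2n addrK.
rewrite /padic_of_int rmorph1 mulr1 /angle invfM invrK invfM.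
by rewrite mulrCA mulrA.
Qed.

(** The terms of the series have size [p ^ (1 - J)], because p clears the
    denominators of the Bernoulli numbers and divides F. *)
Lemma hurwitz_limit : exists x : Qp,
  limn (fun J => ratp (y * L (geom_poly y J))) = x /\
  forall J, exists z : Zp, p%:R ^+ 1 * (ratp (y * L (geom_poly y J)) - x) = pint (p%:R ^+ J * z).
Proof.
have [||x xP] := @padic_complete p p_pr (fun J => y * L (geom_poly y J)) 1.
- by rewrite /geom_poly big_ord0 linear0 !mulr0 rpred0.
- move=> J; rewrite !(volkenborn_geom _ minus_frac_neq0) big_nat_recr //= addrAC subrr add0r.
  rewrite expr1 mulrA -mulrA -expr_div_n rpredM ?zloc_bernoulli // rpredX //.
  exact: (frac_inv_zloc p_pr r_gt0 ndvdz_opp).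
by exists x; split=> //; exact: padic_cvgn xP.
Qed.

End HurwitzAtTwo.

Theorem corollary9p3 :
  (forall (p : nat) (p_pr : prime p) (F : nat) (a : int),
     (exists k : nat, F = (p ^ k)%N) -> (p %| F)%N -> F <> 2%N ->
     ~~ (p %| a)%Z ->
     irrational_padic
       ((padic_of_int (teichmuller p_pr a))^-1 * hurwitz_zeta (2 : padic_int p_pr) a F))
  /\ hurwitz_zeta (2 : padic_int (isT : prime 2)) 1 2 = 0.
Proof.
split=> [p p_pr F a [r ->] pF F2 pa [q qE]|].
  have r0 : (0 < r)%N.
    case: r pF {F2 qE} => //; rewrite expn0 dvdn1 => /eqP p1.
    by have := prime_gt1 p_pr; rewrite p1.
  apply: (irrational_resolvent (p_pr := p_pr) r0 F2 (ndvdz_opp pa)).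
  have [x [xE xP]] := hurwitz_limit p_pr pa r0.
  have F0 : ((p ^ r)%:R : padic p_pr) != 0.
    rewrite (padic_intr_neq0 p_pr (m := (p ^ r)%:Z)) // eqz_nat -lt0n expn_gt0.
    by rewrite prime_gt0.
  have xq : x = ratr (q * ((p ^ r)%:R * a%:~R)).
    have cancel (K : fieldType) (t u v : K) : t != 0 -> u != 0 -> v = t^-1 * (t / u * v) * u.
      by move=> t0 u0; field; rewrite u0 t0.
    rewrite !ratr_padicM ratr_padic_nat ratr_padic_int -qE hurwitz_two // xE.
    by apply: cancel; rewrite ?mulf_neq0 ?padic_num_neq0 ?teichmuller_neq0.
  have y0 := minus_frac_neq0 p_pr pa r.
  set y := (- a)%:~R / (p ^ r)%:R; set b := q * _ in xq.
  exists (y^-1 * b).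
  apply: (@eq_padic_cvg p p_pr (fun J => y^-1 * (y * volkenborn (geom_poly y J)))).
    by move=> J; rewrite mulKf.
  apply: padic_cvgZ; exists 1%N => J; have [z zE] := xP J.
  apply: (@zloc_ratr_padic p p_pr _ z).
  have pQ0 : p%:R ^+ J != 0 :> padic p_pr.
    by rewrite expf_neq0 // (padic_intr_neq0 p_pr (m := p%:Z)) // eqz_nat -lt0n prime_gt0.
  have pR0 : p%:R ^+ J != 0 :> rat.
    by rewrite expf_neq0 // pnatr_eq0 -lt0n prime_gt0.
  apply: (mulfI pQ0).
  have pE : p%:R ^+ J = ratr (p%:R ^+ J) :> padic p_pr by rewrite ratr_padicX ratr_padic_nat.
  rewrite [in LHS]pE -ratr_padicM mulrC divfK // ratr_padicM ratr_padicD ratr_padicN -xq.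
  rewrite expr1 ratr_padic_nat -[X in X * _]expr1 zE.
  by rewrite /padic_of_int rmorphM rmorphXn rmorph_nat.
have pa : ~~ (2 %| 1)%Z by [].
rewrite -[X in hurwitz_zeta _ _ X](expn1 2) (hurwitz_two _ pa) //.
have y0 := minus_frac_neq0 (isT : prime 2) pa 1.
have yp := frac_inv_zloc (isT : prime 2) (isT : (0 < 1)%N) (ndvdz_opp pa).
set y := (- 1)%:~R / (2 ^ 1)%:R in y0 yp *.
(* [y = -1/2] is the fixed point of the reflection. *)
have yR : - 1 - y = y by rewrite /y expn1; field.
have := @geom_reflect_cvg0 2 isT _ y0; rewrite yR => /(_ y0 yp yp) /(padic_cvgZ (y / 2%:R)).
rewrite mulr0 => y_cvg.
suff -> : limn (fun J => ratr (y * L (geom_poly y J)) : padic (isT : prime 2)) = 0.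
  by rewrite mulr0.
rewrite (padic_cvg_limn (b := 0)); first exact: (ratr_padic_nat _ 0).
by apply: eq_padic_cvg y_cvg => J; field.
Qed.
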